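(* Let $G$ be a finite group acting faithfully on a complete non-singular toric variety $X$ over $\mathbb{C}$. If $G$ has a fixed point on $X$, then $X$ is $G$-versal.
   Context: All varieties are irreducible and, together with group actions and maps, are defined over $\mathbb{C}$. The $G$-action on the toric variety $X$ is by arbitrary variety automorphisms; it need not preserve the torus. A faithful $G$-variety is a variety with a faithful $G$-action. An irreducible $G$-variety $X$ is $G$-versal if it is faithful and, for any faithful $G$-variety $Y$ and any non-empty $G$-invariant open subset $U\subset X$, there exists a $G$-equivariant rational map $Y\dashrightarrow U$. *)

(* Defs.v *)
From HB Require Import structures.
From mathcomp Require Import all_boot all_order all_algebra all_fingroup.
From mathcomp Require Import classical_sets reals.
From mathcomp Require Import complex mpoly.

Set Implicit Arguments.
Unset Strict Implicit.
Unset Printing Implicit Defensive.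

Import GRing.Theory.
Local Open Scope classical_set_scope.
Local Open Scope ring_scope.

(* Complex varieties are presented classically (Weil, Serre), as point sets   *)
(* glued from finitely many Zariski closed subsets of affine spaces.  Here    *)
(* R is a model of the real numbers, so that R[i] is the field C.             *)

Definition algebraic_set (R : realType) (n : nat) (A : set 'rV[R[i]]_n) : Prop :=
  exists S : set {mpoly R[i][n]}, A = [set v | forall p, S p -> p.@[v 0] = 0].

(* Bare charts; the values of [chart i] outside [dom i] are irrelevant.       *)
Record atlas (R : realType) : Type := Atlas {
  point :> Type;
  index : finType;
  edim : index -> nat;
  dom : index -> set point;
  chart : forall i, point -> 'rV[R[i]]_(edim i) }.

Arguments edim {R a} i : rename.
Arguments dom {R a} i _ : rename.
Arguments chart {R a} i _ : rename.

Definition atlas_prod (R : realType) (X Y : atlas R) : atlas R :=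
  @Atlas R (X * Y)%type (index X * index Y)%type
    (fun ij => (edim ij.1 + edim ij.2)%N)
    (fun ij => [set xy | dom ij.1 xy.1 /\ dom ij.2 xy.2])
    (fun ij xy => row_mx (chart ij.1 xy.1) (chart ij.2 xy.2)).

Definition zclosed (R : realType) (X : atlas R) (Z : set X) : Prop :=
  forall i : index X, exists2 A : set 'rV[R[i]]_(edim i), algebraic_set A &
    forall x, dom i x -> (Z x <-> A (chart i x)).

Definition zopen (R : realType) (X : atlas R) (U : set X) : Prop :=
  zclosed (~` U).

Definition zirreducible (R : realType) (X : atlas R) (Z : set X) : Prop :=
  Z !=set0 /\
  forall A B : set X, zclosed A -> zclosed B ->
    Z `<=` A `|` B -> Z `<=` A \/ Z `<=` B.

(* On U, the function f is locally a quotient of polynomials in the           *)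
(* coordinates of each chart.                                                 *)
Definition regular_on (R : realType) (X : atlas R) (U : set X) (f : X -> R[i]) :
    Prop :=
  zopen U /\
  forall (i : index X) (x : X), U x -> dom i x ->
    exists p q : {mpoly R[i][edim i]}, q.@[chart i x 0] != 0 /\
      forall y, U y -> dom i y -> q.@[chart i y 0] != 0 ->
        f y = p.@[chart i y 0] / q.@[chart i y 0].

(* Rational maps are handled through morphisms on open subsets: f is a total  *)
(* function, but only its restriction to U matters.                           *)
Definition morphism_on (R : realType) (X Y : atlas R) (U : set X) (f : X -> Y) :
    Prop :=
  (forall W : set Y, zopen W -> zopen (U `&` f @^-1` W)) /\
  (forall (W : set Y) (h : Y -> R[i]),
     regular_on W h -> regular_on (U `&` f @^-1` W) (h \o f)).

Definition isomorphism_on (R : realType) (X Y : atlas R)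
    (U : set X) (V : set Y) (f : X -> Y) : Prop :=
  exists g : Y -> X,
    [/\ morphism_on U f, morphism_on V g,
        forall x, U x -> V (f x) /\ g (f x) = x &
        forall y, V y -> U (g y) /\ f (g y) = y].

(* Regularity of the chart coordinates on [dom i], tested in all the other    *)
(* charts, says at once that [dom i] is open and that the transition maps     *)
(* are regular.                                                               *)
Definition prevariety_axiom (R : realType) (X : atlas R) : Prop :=
  [/\ forall x : X, exists i, dom i x,
      forall (i : index X) (x y : X),
        dom i x -> dom i y -> chart i x = chart i y -> x = y,
      forall i : index X, algebraic_set (chart i @` dom i) &
      forall (i : index X) (k : 'I_(edim i)),
        regular_on (dom i) (fun x => chart i x 0 k)].

Definition separated (R : realType) (X : atlas R) : Prop :=
  @zclosed R (atlas_prod X X) [set xy | xy.1 = xy.2].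

Record variety (R : realType) : Type := Variety {
  variety_atlas :> atlas R;
  variety_prevariety : prevariety_axiom variety_atlas;
  variety_separated : separated variety_atlas;
  variety_irreducible : zirreducible [set: variety_atlas] }.

Definition complete_variety (R : realType) (X : variety R) : Prop :=
  forall (Y : variety R) (Z : set (atlas_prod X Y)),
    zclosed Z -> zclosed ([set y | exists x, Z (x, y)] : set Y).

Definition irreducible_chain (R : realType) (X : atlas R) (d : nat) : Prop :=
  exists Z : nat -> set X,
    (forall k, (k <= d)%N -> zclosed (Z k) /\ zirreducible (Z k)) /\
    (forall k, (k < d)%N -> Z k `<` Z k.+1).

Definition krull_dim (R : realType) (X : atlas R) (d : nat) : Prop :=
  irreducible_chain X d /\ ~ irreducible_chain X d.+1.

(* Zariski tangent space at x, computed in the chart i.                       *)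
Definition tangent_vector (R : realType) (X : atlas R) (i : index X) (x : X)
    (v : 'rV[R[i]]_(edim i)) : Prop :=
  forall p : {mpoly R[i][edim i]},
    (forall y, dom i y -> p.@[chart i y 0] = 0) ->
    \sum_(k < edim i) (p^`M(k)).@[chart i x 0] * v 0 k = 0.

Definition nonsingular (R : realType) (X : variety R) : Prop :=
  exists2 d : nat, krull_dim X d &
    forall (i : index X) (x : X), dom i x ->
      exists2 V : {vspace 'rV[R[i]]_(edim i)},
        (forall v, v \in V <-> tangent_vector x v) & (\dim V = d)%N.

Definition affine_space (R : realType) (n : nat) : atlas R :=
  @Atlas R 'rV[R[i]]_n unit (fun=> n) (fun=> setT) (fun=> id).

Definition torus (R : realType) (n : nat) : set (affine_space R n) :=
  [set t : 'rV[R[i]]_n | forall k, t 0 k != 0].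

(* X contains a torus as a non-empty open subset, and the action of the torus *)
(* on itself by translations extends to an algebraic action a on X.           *)
(* Normality is not required; it is automatic when X is non-singular.         *)
Definition toric (R : realType) (X : variety R) : Prop :=
  exists (n : nat) (e : affine_space R n -> X)
         (a : atlas_prod (affine_space R n) X -> X),
    [/\ exists2 V : set X, zopen V & isomorphism_on (@torus R n) V e,
        @morphism_on R (atlas_prod (affine_space R n) X) X
          [set tx | torus tx.1] a,
        forall x, a (const_mx 1, x) = x,
        forall s t x, torus s -> torus t ->
          a (s, a (t, x)) = a (map2_mx *%R s t, x) &
        forall s t, torus s -> torus t ->
          a (s, e t) = e (map2_mx *%R s t)].

(* Actions are right actions in MathComp; passing to the inverse, none of the *)
(* notions below depends on the side.                                         *)
Record gvariety (R : realType) (gT : finGroupType) : Type := GVariety {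
  gvariety_variety :> variety R;
  gact : {action gT &-> gvariety_variety};
  gact_morphism : forall g : gT,
    @morphism_on R gvariety_variety gvariety_variety setT (gact^~ g) }.

Definition faithful_action (R : realType) (gT : finGroupType)
    (X : gvariety R gT) : Prop :=
  forall g : gT, (forall x : X, gact X x g = x) -> g = 1%g.

Definition has_fixed_point (R : realType) (gT : finGroupType)
    (X : gvariety R gT) : Prop :=
  exists x : X, forall g : gT, gact X x g = x.

Definition invariant_set (R : realType) (gT : finGroupType)
    (X : gvariety R gT) (U : set X) : Prop :=
  forall (g : gT) (x : X), U x -> U (gact X x g).

(* A rational map is represented by a morphism f on a non-empty open set V;   *)
(* as X is separated, f \o g and g \o f are the same rational map exactly     *)
(* when they agree wherever both are defined.                                 *)
Definition equivariant_rational_map (R : realType) (gT : finGroupType)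
    (Y X : gvariety R gT) (U : set X) : Prop :=
  exists (V : set Y) (f : Y -> X),
    [/\ zopen V, V !=set0, morphism_on V f, (forall y, V y -> U (f y)) &
        forall (g : gT) (y : Y), V y -> V (gact Y y g) ->
          f (gact Y y g) = gact X (f y) g].

Definition versal (R : realType) (gT : finGroupType) (X : gvariety R gT) :
    Prop :=
  faithful_action X /\
  forall Y : gvariety R gT, faithful_action Y ->
  forall U : set X, zopen U -> U !=set0 -> invariant_set U ->
    equivariant_rational_map Y U.

(* Main.v *)
Require Import Defs.
From HB Require Import structures.
From mathcomp Require Import all_boot all_order all_algebra all_fingroup.
From mathcomp Require Import boolp classical_sets reals complex mpoly.
From mathcomp Require Import ring zify.
Require Import Defs.

(* Write K for the complex numbers and e : T -> X for the embedding of the    *)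
(* torus T of K^n.                                                            *)
(*                                                                            *)
(* Cones.  As X is complete, the rational map w |-> e(w^L) of K^n has a value *)
(* p at the origin as soon as the unimodular matrix L is in general position  *)
(* with respect to the exponents occurring in the charts.  The torus fixes p, *)
(* and since X is non-singular, n monomials are coordinates of X at p.  Only  *)
(* finitely many such coordinate systems occur and their cones cover Z^n;     *)
(* extending the place f |-> f(x) to the monomials and applying Gordan's      *)
(* theorem, one sees that their charts cover X.  The rays U of these cones    *)
(* give homogeneous coordinates w |-> e(w^U), K^N --> X, as in Cox's          *)
(* construction.                                                              *)
(*                                                                            *)
(* Lifts.  An automorphism g of X lifts to a polynomial map Phi_g of K^N:     *)
(* the torus coordinates of g(e(w^U)) are products of powers of primes, and   *)
(* the exponents of each prime form a vector of Z^n, that is, a non-negative  *)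
(* combination of the rays of some cone.  The lift is unique up to the group  *)
(* H of the h such that h^U = 1, which acts freely on the fibres of the       *)
(* homogeneous coordinates.  Hence the lifts that fix a given point over the  *)
(* fixed point of G form an action of G on K^N, and they are homogeneous for  *)
(* some positive grading invariant under G.                                   *)
(*                                                                            *)
(* Equivariant maps.  On a faithful G-variety Y, take a free orbit G y and    *)
(* interpolate F : Y --> K^N such that F(g y) = Phi_g(x), where x lies over   *)
(* the given open set.  Averaging the maps Phi_g o F o g^-1 keeps these       *)
(* values, and if the components of F of weight less than m are equivariant,  *)
(* then so are those of weight m of the average, as the component of weight m *)
(* of Phi_g is affine in the coordinates of weight m.  Thus F becomes         *)
(* equivariant after finitely many steps, and so is e(F^U) : Y --> X.         *)

(** A linear representation is versal because a map into it with prescribed values on a free orbit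
    can be made equivariant by averaging. The proof puts X in a similar position: X is covered by
    part of an affine space K^N on which G acts by polynomial maps that are triangular for a
    positive grading, and triangularity is enough for averaging.

    The coordinates w |-> e(w^U) present X as a quotient of part of K^N by the diagonal group H of
    the h with h^U = 1 ([center_surj], [center_fibre], [center_free]). An automorphism lifts because
    polynomials factor into primes and every lattice vector has exactly one non-negative
    representation by the rays of a cone ([cone_exists], [cone_unique], [lift_exists]); the lift is
    unique up to H ([lift_unique]). The lifts of the elements of G thus form an extension of G by H,
    and a fixed point splits it: each g has exactly one lift fixing a chosen point over the fixed
    point ([equivariant_lift]).

    A complete fan has a linear relation with positive coefficients between its rays, that is, a
    one-parameter subgroup of H with positive weights. Transporting the weights by the lifts and
    summing over G gives an invariant grading ([ray_relation], [invariant_grading]). By positivity,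
    in a polynomial of weight m a variable of weight m occurs only as a linear term
    ([meval_average]), so repeated averaging makes F equivariant one weight at a time without
    changing it on the orbit ([average_equivariant], [average_orbit]). One value on the orbit lies
    over the given open set, so the resulting rational map to X meets this set.

    What remains is to extract the fan from the bare definition of a toric variety. Completeness
    makes limits of monomial maps exist ([limit_exists]) and separatedness makes them unique
    ([center_uniq]). On a cone where finitely many differences of exponents keep their signs, the
    limit depends only on these signs ([coherent_limit]), so finitely many limit points suffice. At
    each of them the exponents of the local ring form a semigroup generated by a basis of Z^n: its
    indecomposable elements are independent in the cotangent space, hence at most n in number, and
    Krull's theorem passes from formal to actual regularity ([local_toric_coordinates]). A valuative
    argument shows that the charts so found cover X ([charts_cover]). *)

Set Implicit Arguments.
Unset Strict Implicit.
Unset Printing Implicit Defensive.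

Import Order.TTheory GRing.Theory Num.Theory.
Local Open Scope classical_set_scope.
Local Open Scope ring_scope.


(** * Multivariate polynomials *)

Section MpolyTools.
Variables (K : numFieldType).

Lemma mmap_comp n (S1 S2 : comNzRingType) (h : 'I_n -> S1)
    (f : {rmorphism K -> S1}) (g : {rmorphism S1 -> S2}) (p : {mpoly K[n]}) :
  g (mmap f h p) = mmap (g \o f) (g \o h) p.
Proof.
rewrite /mmap rmorph_sum; apply: eq_bigr => m _.
rewrite rmorphM /mmap1 rmorph_prod; congr (_ * _).
by apply: eq_bigr => i _; rewrite rmorphXn.
Qed.

Lemma mmap_eq n (S1 : nzRingType) (f f' : K -> S1) (h h' : 'I_n -> S1) p :
  f =1 f' -> h =1 h' -> mmap f h p = mmap f' h' p.
Proof.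
move=> ff hh; rewrite /mmap; apply: eq_bigr => m _.
by rewrite ff (mmap1_eq _ hh).
Qed.

Lemma mmap_id n (p : {mpoly K[n]}) : mmap (@mpolyC n K) (fun i => 'X_i) p = p.
Proof.
rewrite [RHS]mpolyE /mmap; apply: eq_bigr => m _.
by rewrite mmap1_id mul_mpolyC.
Qed.

Lemma meval_mmap n k (h : 'I_n -> {mpoly K[k]}) (p : {mpoly K[n]}) v :
  (mmap (@mpolyC k K) h p).@[v] = p.@[fun i => (h i).@[v]].
Proof.
rewrite /meval mmap_comp; apply: mmap_eq => // x /=.
by rewrite -/(meval v _) mevalC.
Qed.

Lemma poly_nonroot (q : {poly K}) : q != 0 -> exists x, q.[x] != 0.
Proof.
move=> q0; pose s := [seq (i%:R : K) | i <- iota 0 (size q)].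
have us : uniq s.
  by rewrite map_inj_uniq ?iota_uniq // => i j /eqP; rewrite eqr_nat => /eqP.
case: (boolP (all (root q) s)) => [ar|/allPn[x _ xr]]; last by exists x.
by have := max_poly_roots q0 ar us; rewrite size_map size_iota ltnn.
Qed.

(* The isomorphism K[x_0, ..., x_n] = K[x_0, ..., x_(n-1)][x_n]. *)
Definition split_last n : {mpoly K[n.+1]} -> {poly {mpoly K[n]}} :=
  mmap (polyC \o @mpolyC n K)
    (fun i => if unlift ord_max i is Some j then ('X_j)%:P else 'X).

HB.instance Definition _ n := GRing.RMorphism.on (@split_last n).

Definition join_last n : {poly {mpoly K[n]}} -> {mpoly K[n.+1]} :=
  horner_eval 'X_ord_max \o map_poly (@mwiden n K).

HB.instance Definition _ n := GRing.RMorphism.on (@join_last n).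

Lemma split_lastK n : cancel (@split_last n) (@join_last n).
Proof.
move=> p; rewrite -[RHS](mmap_id p) /split_last.
have -> := mmap_comp
  (fun i => if unlift ord_max i is Some j then ('X_j)%:P else 'X)
  (polyC \o @mpolyC n K) (@join_last n) p.
apply: mmap_eq => [c|i] /=.
  by rewrite /join_last /= map_polyC /horner_eval hornerC /= mwidenC.
rewrite /join_last /=; case: unliftP => [j ->|->].
  rewrite map_polyC /horner_eval hornerC /= mwidenX mnmwiden1.
  congr 'X_[U_(_)]; apply: val_inj.
  by rewrite /= /bump leqNgt ltn_ord.
by rewrite map_polyX /horner_eval hornerX.
Qed.

Lemma split_last_widen n (q : {mpoly K[n]}) : split_last (mwiden q) = q%:P.
Proof.
rewrite -[in RHS](mmap_id q) /mwiden.
have -> := mmap_comp (fun i => 'X_(widen_ord (leqnSn n) i)) (@mpolyC n.+1 K)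
  (@split_last n) q.
have -> := mmap_comp (fun i => 'X_i) (@mpolyC n K) (@polyC {mpoly K[n]}) q.
apply: mmap_eq => [c|i] /=.
  by rewrite /split_last /= mmapC.
rewrite /split_last /= mmapX mmap1U; case: unliftP => [j|] /= e.
  congr ('X_ _)%:P; apply: val_inj.
  by move/(congr1 val): e; rewrite /= /bump leqNgt ltn_ord.
by move/(congr1 val): e => /= e; have := ltn_ord i; rewrite e ltnn.
Qed.

Lemma join_lastK n : cancel (@join_last n) (@split_last n).
Proof.
move=> P; rewrite -[RHS]coefK poly_def.
rewrite /join_last /= /horner_eval horner_coef raddf_sum /=.
rewrite size_map_inj_poly ?mwiden0 //; last first.
  move=> x y e; apply: (@polyC_inj {mpoly K[n]}).
  by rewrite -!split_last_widen e.
apply: eq_bigr => i _.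
rewrite rmorphM rmorphXn coef_map /= split_last_widen.
by rewrite /split_last mmapX mmap1U unlift_none mul_polyC.
Qed.

Lemma split_last_eq0 n (p : {mpoly K[n.+1]}) : (split_last p == 0) = (p == 0).
Proof.
by apply/eqP/eqP => [e|->]; rewrite ?rmorph0 // -[p]split_lastK e rmorph0.
Qed.

Lemma meval_split_last n (p : {mpoly K[n.+1]}) (v : 'I_n.+1 -> K) :
  p.@[v] = (map_poly (meval (v \o lift ord_max)) (split_last p)).[v ord_max].
Proof.
rewrite /split_last mmap_comp -/(horner_eval _ _) mmap_comp /meval.
apply: mmap_eq => [c|i] /=.
  by rewrite map_polyC /horner_eval hornerC /= -/(meval _ _) mevalC.
case: unliftP => [j ->|->].
  by rewrite map_polyC /horner_eval hornerC /= -/(meval _ _) mevalXU.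
by rewrite map_polyX /horner_eval hornerX.
Qed.

Lemma mpoly_nonzero n (p : {mpoly K[n]}) : p != 0 ->
  exists v : 'rV[K]_n, p.@[v 0] != 0.
Proof.
suff: p != 0 -> exists v, p.@[v] != 0.
  move=> H /H [v pv]; exists (\row_i v i).
  by rewrite (@meval_eq _ _ _ v) // => i; rewrite mxE.
elim: n p => [|n IH] p p0.
  exists (fun=> 0); rewrite (nvar0_mpolyC p) mevalC.
  by apply: contra p0 => /eqP e; rewrite (nvar0_mpolyC p) e mpolyC0.
have: split_last p != 0 by rewrite split_last_eq0.
rewrite -lead_coef_eq0 => /IH [v vc].
have: map_poly (meval v) (split_last p) != 0.
  apply: contra vc => /eqP e.
  by rewrite lead_coefE -coef_map /= e coef0.
move/poly_nonroot => [x xr].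
exists (fun i => if unlift ord_max i is Some j then v j else x).
rewrite meval_split_last unlift_none.
congr (_ != 0): xr; congr (_ .[x]); apply: eq_map_poly => q.
by apply: meval_eq => i /=; rewrite liftK.
Qed.

Lemma mpoly_ext n (p q : {mpoly K[n]}) :
  (forall v : 'rV[K]_n, p.@[v 0] = q.@[v 0]) -> p = q.
Proof.
move=> e; apply/eqP; rewrite -subr_eq0; apply/negP => /negP /mpoly_nonzero [v].
by rewrite mevalB e subrr eqxx.
Qed.

End MpolyTools.


(** * Generic properties, monomial maps and germs of rational functions *)

Lemma mpoly_rind (K : nzRingType) n (P : {mpoly K[n]} -> Prop) :
  (forall c, P c%:MP) -> (forall i, P 'X_i) ->
  (forall p q, P p -> P q -> P (p + q)) ->
  (forall p q, P p -> P q -> P (p * q)) -> forall p, P p.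
Proof.
move=> PC PX PD PM p; rewrite [p]mpolyE.
elim/big_ind: _ => // [|m _]; first by rewrite -[0](mpolyC0 n K).
rewrite -mul_mpolyC; apply: (PM _ _ (PC _)); rewrite mpolyXE_id.
elim/big_ind: _ => // [|i _]; first by rewrite -(mpolyC1 n K).
elim: (m i) => [|d IH]; first by rewrite expr0 -(mpolyC1 n K).
by rewrite exprS; apply: PM.
Qed.

Lemma mpolyX_neq0 (R : nzRingType) n (m : 'X_{1..n}) : 'X_[R, m] != 0.
Proof. by rewrite -msize_poly_eq0 msizeX. Qed.

Section Generic.
Variables (K : numFieldType).

(** Truth on a non-empty principal open set. A rational function on K^n is represented by any total
    function, two of them being identified when they agree in the sense of [gen]. *)
Definition gen n (P : 'rV[K]_n -> Prop) :=
  exists2 Q : {mpoly K[n]}, Q != 0 & forall v : 'rV[K]_n, Q.@[v 0] != 0 -> P v.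

Lemma gen_ex n (P : 'rV[K]_n -> Prop) : gen P -> exists v, P v.
Proof. by case=> Q /mpoly_nonzero [v Qv] H; exists v; apply: H. Qed.

Lemma genW n (P P' : 'rV[K]_n -> Prop) :
  (forall v, P v -> P' v) -> gen P -> gen P'.
Proof. by move=> H [Q Q0 HQ]; exists Q => // v /HQ /H. Qed.

Lemma gen_true n (P : 'rV[K]_n -> Prop) : (forall v, P v) -> gen P.
Proof. by move=> H; exists 1; rewrite ?oner_neq0. Qed.

Lemma genI n (P P' : 'rV[K]_n -> Prop) :
  gen P -> gen P' -> gen (fun v => P v /\ P' v).
Proof.
move=> [Q Q0 HQ] [Q' Q0' HQ']; exists (Q * Q'); rewrite ?mulf_neq0 // => v.
by rewrite mevalM mulf_eq0 negb_or => /andP[/HQ ? /HQ' ?].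
Qed.

Lemma gen_and n (P P' P'' : 'rV[K]_n -> Prop) :
  (forall v, P v -> P' v -> P'' v) -> gen P -> gen P' -> gen P''.
Proof. by move=> H gP gP'; apply: genW (genI gP gP') => v []; apply: H. Qed.

Lemma gen_all n (I : finType) (P : I -> 'rV[K]_n -> Prop) :
  (forall i, gen (P i)) -> gen (fun v => forall i, P i v).
Proof.
move=> H; have /choice [Q HQ] i : exists Q : {mpoly K[n]}, Q != 0 /\
   forall v : 'rV[K]_n, Q.@[v 0] != 0 -> P i v by case: (H i) => Q; exists Q.
exists (\prod_i Q i); first by apply/prodf_neq0 => i _; case: (HQ i).
move=> v; rewrite rmorph_prod => /prodf_neq0 H' i.
by case: (HQ i) => _; apply; apply: H'.
Qed.

Lemma gen_neq0 n (p : {mpoly K[n]}) : p != 0 -> gen (fun v : 'rV[K]_n => p.@[v 0] != 0).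
Proof. by exists p. Qed.

Lemma gen_eq n (p q : {mpoly K[n]}) : gen (fun v : 'rV[K]_n => p.@[v 0] = q.@[v 0]) -> p = q.
Proof.
case=> Q Q0 H; apply/eqP; rewrite -subr_eq0; apply/negP => /negP pq.
have /mpoly_nonzero [v] : Q * (p - q) != 0 by rewrite mulf_neq0.
rewrite mevalM mulf_eq0 negb_or => /andP[/H e].
by rewrite mevalB e subrr eqxx.
Qed.

Lemma gen_eq0 n (p : {mpoly K[n]}) : gen (fun v : 'rV[K]_n => p.@[v 0] = 0) -> p = 0.
Proof. by move=> H; apply: gen_eq; apply: genW H => v ->; rewrite meval0. Qed.

Definition tor n (t : 'rV[K]_n) := forall k, t 0 k != 0.

Lemma gen_tor n : gen (@tor n).
Proof.
apply: gen_all => i; exists 'X_i => [|v]; first exact: mpolyX_neq0.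
by rewrite mevalXU.
Qed.

Lemma exprz_sum (I : Type) (r : seq I) (P : pred I) (F : I -> int) (x : K) :
  x != 0 -> x ^ (\sum_(i <- r | P i) F i) = \prod_(i <- r | P i) x ^ F i.
Proof. by move=> x0; apply: (big_morph _ (fun a b => expfzDr a b x0)). Qed.

Lemma exprz_prod (I : Type) (r : seq I) (P : pred I) (F : I -> K) (z : int) :
  (\prod_(i <- r | P i) F i) ^ z = \prod_(i <- r | P i) F i ^ z.
Proof. by apply: (big_morph _ (fun a b => expfzMl a b z)); rewrite exp1rz. Qed.

(** The point w^A, meant for w in the torus; a negative power of a zero coordinate is 0, a junk
    value. *)
Definition mexp q n (A : 'M[int]_(q, n)) (w : 'rV[K]_q) : 'rV[K]_n :=
  \row_j \prod_k w 0 k ^ A k j.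

Lemma mexpE q n (A : 'M[int]_(q, n)) w j : mexp A w 0 j = \prod_k w 0 k ^ A k j.
Proof. by rewrite mxE. Qed.

Lemma mexp_tor q n (A : 'M[int]_(q, n)) w : tor w -> tor (mexp A w).
Proof.
by move=> tw k; rewrite mexpE; apply/prodf_neq0 => i _; rewrite expfz_neq0.
Qed.

Lemma mexp_mulmx q n r (A : 'M[int]_(q, n)) (B : 'M[int]_(n, r)) w : tor w ->
  mexp B (mexp A w) = mexp (A *m B) w.
Proof.
move=> tw; apply/rowP => j; rewrite !mexpE.
transitivity (\prod_k \prod_l (w 0 l ^ (A l k * B k j))).
  apply: eq_bigr => k _; rewrite mexpE exprz_prod.
  by apply: eq_bigr => l _; rewrite exprz_exp.
rewrite exchange_big; apply: eq_bigr => l _ /=.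
by rewrite mxE exprz_sum.
Qed.

Lemma mexp1 n (w : 'rV[K]_n) : mexp 1%:M w = w.
Proof.
apply/rowP => j; rewrite mexpE (bigD1 j) //= mxE eqxx expr1z big1 ?mulr1 //.
by move=> k kj; rewrite mxE (negbTE kj) expr0z.
Qed.

Lemma mexp_map2 q n (A : 'M[int]_(q, n)) (s w : 'rV[K]_q) :
  mexp A (map2_mx *%R s w) = map2_mx *%R (mexp A s) (mexp A w).
Proof.
apply/rowP => j; rewrite [RHS]mxE !mexpE -big_split; apply: eq_bigr => k _ /=.
by rewrite mxE expfzMl.
Qed.

Lemma tor_map2 n (s t : 'rV[K]_n) : tor s -> tor t -> tor (map2_mx *%R s t).
Proof. by move=> ts tt k; rewrite mxE mulf_neq0. Qed.

(** Coordinates in Z have non-negative exponents, so only the others can enter a denominator, and a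
    power of their product clears it. The identity therefore holds also where coordinates in Z
    vanish. All large D are provided so that two polynomials can share one. *)
Lemma mexp_pull q n (A : 'M[int]_(q, n)) (Z : pred 'I_q) :
  (forall k j, Z k -> 0 <= A k j) -> forall p : {mpoly K[n]},
  exists D0, forall D, (D0 <= D)%N -> exists p' : {mpoly K[q]},
    forall w : 'rV[K]_q, (forall k, ~~ Z k -> w 0 k != 0) ->
      p'.@[w 0] = (\prod_(k | ~~ Z k) w 0 k) ^+ D * p.@[mexp A w 0].
Proof.
move=> HA; apply: mpoly_rind.
- move=> c; exists 0%N => D _; exists (c%:MP * (\prod_(k | ~~ Z k) 'X_k) ^+ D).
  move=> w _; rewrite mevalM !mevalC mulrC; congr (_ * _).
  by rewrite rmorphXn rmorph_prod; congr (_ ^+ _); apply: eq_bigr => i _; rewrite /= mevalXU.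
- move=> j; exists (\sum_k absz (A k j))%N => D HD.
  exists (\prod_k 'X_k ^+ absz (if Z k then A k j else D%:Z + A k j)) => w Hw.
  rewrite mevalXU mexpE rmorph_prod /=.
  rewrite -prodrXl [X in X * _]big_mkcond -big_split; apply: eq_bigr => k _ /=.
  rewrite rmorphXn /= mevalXU.
  case Zk: (Z k) => /=.
    by rewrite mul1r exprnP gez0_abs // HA.
  rewrite !exprnP gez0_abs; first by rewrite expfzDr ?Hw ?Zk.
  have : (absz (A k j) <= D)%N by apply: leq_trans HD; rewrite (bigD1 k) //= leq_addr.
  lia.
- move=> p p' [D1 H1] [D2 H2]; exists (D1 + D2)%N => D HD.
  have [|r1 E1] := H1 D; first by lia.
  have [|r2 E2] := H2 D; first by lia.
  by exists (r1 + r2) => w Hw; rewrite !mevalD E1 // E2 // mulrDr.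
- move=> p p' [D1 H1] [D2 H2]; exists (D1 + D2)%N => D HD.
  have [//|r1 E1] := H1 D1 _.
  have [|r2 E2] := H2 (D - D1)%N; first by lia.
  exists (r1 * r2) => w Hw; rewrite !mevalM E1 // E2 //.
  by rewrite mulrACA -exprD subnKC //; lia.
Qed.

(** The map w |-> w^A is onto the torus, with section z |-> z^B, hence dominant. *)
Lemma gen_pull q n (A : 'M[int]_(q, n)) (B : 'M[int]_(n, q)) P :
  B *m A = 1%:M -> gen P -> gen (fun w => P (mexp A w)).
Proof.
move=> BA [Q Q0 HQ].
have [D0 /(_ D0 (leqnn _))[p' Hp]] := @mexp_pull q n A pred0 (fun _ _ => False_ind _ \o notF) Q.
apply: gen_and (gen_neq0 (p := p') _) (gen_tor q) => [v pv tv|].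
  apply: HQ; apply: contra pv => /eqP e; rewrite Hp ?e ?mulr0 //.
have [z [/negP Qz tz]] := gen_ex (genI (gen_neq0 Q0) (gen_tor n)).
apply/eqP => p0; apply: Qz; have := Hp (mexp B z) (fun k _ => mexp_tor B tz k).
rewrite p0 meval0 mexp_mulmx // BA mexp1 => /esym/eqP.
rewrite mulf_eq0 expf_eq0 => /orP[/andP[_]|//].
move/prodf_eq0 => [k _ /eqP kz]; have := mexp_tor B tz k.
by rewrite kz eqxx.
Qed.

(* [regat w0 f v]: the rational function f is defined at w0, with value v. *)
Definition regat n (w0 : 'rV[K]_n) (f : 'rV[K]_n -> K) (v : K) :=
  exists a b : {mpoly K[n]}, [/\ b.@[w0 0] != 0, b.@[w0 0] * v = a.@[w0 0] &
    gen (fun w : 'rV[K]_n => b.@[w 0] * f w = a.@[w 0])].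

Section Regat.
Variables (n : nat) (w0 : 'rV[K]_n).
Implicit Types f g : 'rV[K]_n -> K.

Lemma meval_neq0 (b : {mpoly K[n]}) : b.@[w0 0] != 0 -> b != 0.
Proof. by apply: contraNneq => ->; rewrite meval0. Qed.

Lemma regat_ext f g v : gen (fun w => f w = g w) -> regat w0 f v -> regat w0 g v.
Proof.
move=> fg [a [b [b0 e H]]]; exists a, b; split => //.
by apply: gen_and fg H => w ->.
Qed.

Lemma regat_const c : regat w0 (fun=> c) c.
Proof.
exists c%:MP, 1; rewrite meval1 oner_eq0 mevalC mul1r; split => //.
by apply: gen_true => w; rewrite meval1 mevalC mul1r.
Qed.

Lemma regat_mevalM (p : {mpoly K[n]}) : regat w0 (fun w => p.@[w 0]) p.@[w0 0].
Proof.
exists p, 1; rewrite meval1 oner_eq0 mul1r; split => //.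
by apply: gen_true => w; rewrite meval1 mul1r.
Qed.

Lemma regatD f g u v : regat w0 f u -> regat w0 g v ->
  regat w0 (fun w => f w + g w) (u + v).
Proof.
move=> [a [b [b0 e H]]] [a' [b' [b0' e' H']]].
exists (a * b' + a' * b), (b * b').
rewrite mevalM mulf_neq0 //; split => //.
  by rewrite mevalD !mevalM -e -e'; ring.
by apply: gen_and H H' => w h h'; rewrite mevalD !mevalM -h -h'; ring.
Qed.

Lemma regatM f g u v : regat w0 f u -> regat w0 g v ->
  regat w0 (fun w => f w * g w) (u * v).
Proof.
move=> [a [b [b0 e H]]] [a' [b' [b0' e' H']]].
exists (a * a'), (b * b').
rewrite mevalM mulf_neq0 //; split => //.
  by rewrite !mevalM -e -e'; ring.
by apply: gen_and H H' => w h h'; rewrite !mevalM -h -h'; ring.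
Qed.

Lemma regatB f g u v : regat w0 f u -> regat w0 g v ->
  regat w0 (fun w => f w - g w) (u - v).
Proof.
move=> hf hg; have := regatD hf (regatM (regat_const (-1)) hg).
by rewrite mulN1r; apply: regat_ext; apply: gen_true => w; rewrite mulN1r.
Qed.

Lemma regatV f u : u != 0 -> regat w0 f u -> regat w0 (fun w => (f w)^-1) u^-1.
Proof.
move=> u0 [a [b [b0 e H]]].
have a0 : a.@[w0 0] != 0 by rewrite -e mulf_neq0.
exists b, a; split => //; first by rewrite -e mulfK.
apply: gen_and (gen_neq0 (meval_neq0 a0)) H => w aw bw.
rewrite -bw mulfK //; apply: contra aw => /eqP e'.
by rewrite -bw e' mulr0.
Qed.

Lemma regat_meval k (f : 'I_k -> 'rV[K]_n -> K) (v : 'I_k -> K)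
    (P : {mpoly K[k]}) :
  (forall i, regat w0 (f i) (v i)) ->
  regat w0 (fun w => P.@[fun i => f i w]) P.@[v].
Proof.
move=> H; elim/mpoly_rind: P => [c|i|p q hp hq|p q hp hq].
- rewrite mevalC; apply: regat_ext (regat_const c).
  by apply: gen_true => w; rewrite mevalC.
- rewrite mevalXU; apply: regat_ext (H i).
  by apply: gen_true => w; rewrite mevalXU.
- rewrite mevalD; apply: regat_ext (regatD hp hq).
  by apply: gen_true => w; rewrite mevalD.
- rewrite mevalM; apply: regat_ext (regatM hp hq).
  by apply: gen_true => w; rewrite mevalM.
Qed.

Lemma regat_uniq f u v : regat w0 f u -> regat w0 f v -> u = v.
Proof.
move=> [a [b [b0 e H]]] [a' [b' [b0' e' H']]].
have E : a * b' = a' * b.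
  apply: gen_eq; apply: gen_and H H' => w h h'.
  by rewrite !mevalM -h -h'; ring.
have := congr1 (meval (w0 0)) E; rewrite !mevalM -e -e' => E'.
have b00 : b.@[w0 0] * b'.@[w0 0] != 0 by rewrite mulf_neq0.
by apply: (mulfI b00); rewrite mulrAC E' mulrAC; congr (_ * _); rewrite mulrC.
Qed.

Lemma regat_eq0 f v : gen (fun w => f w = 0) -> regat w0 f v -> v = 0.
Proof.
move=> f0 H; apply: regat_uniq (regat_const 0).
by apply: regat_ext H; exact: f0.
Qed.

End Regat.

End Generic.


(** * Noetherianity and Krull's intersection theorem *)

(** Jump repeatedly to an index at which f is minimal on the remaining tail. *)
Lemma monotone_subseq (f : nat -> nat) : exists phi : nat -> nat,
  (forall k, (phi k < phi k.+1)%N) /\ (forall k, (f (phi k) <= f (phi k.+1))%N).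
Proof.
have am N : exists i, (N <= i)%N /\ forall j, (N <= j)%N -> (f i <= f j)%N.
  have ex : exists v, `[< exists2 i, (N <= i)%N & f i = v >].
    by exists (f N); apply/asboolP; exists N.
  case: (ex_minnP ex) => v /asboolP [i Ni <-] H.
  by exists i; split => // j Nj; apply: H; apply/asboolP; exists j.
have [a Ha] := choice am.
pose phi := fix phi k := if k is k'.+1 then a (phi k').+1 else a 0%N.
exists phi; split => k.
  by case: (Ha (phi k).+1).
have Nk : (phi k <= phi k.+1)%N by rewrite ltnW //; case: (Ha (phi k).+1).
case: k Nk => [|k] Nk; first by case: (Ha 0%N) => _; apply.
case: (Ha (phi k).+1) => h1 h2; apply: h2.
by apply: leq_trans h1 Nk.
Qed.

(** Pass to a subsequence once for each variable, making one more exponent non-decreasing each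
    time. *)
Lemma dickson n (m : nat -> 'X_{1..n}) :
  exists i j, (i < j)%N /\ (m i <= m j)%MM.
Proof.
have H k : exists phi : nat -> nat, (forall i j, (i < j)%N -> (phi i < phi j)%N) /\
    forall (l : 'I_n), (l < k)%N -> forall i j, (i <= j)%N ->
      (m (phi i) l <= m (phi j) l)%N.
  elim: k => [|k [phi [h1 h2]]]; first by exists id.
  case: (ltnP k n) => kn; last first.
    by exists phi; split => // l _; apply: h2; apply: leq_trans (ltn_ord l) kn.
  have [psi [g1 g2]] := monotone_subseq (fun i => m (phi i) (Ordinal kn)).
  have gm : {homo psi : i j / (i < j)%N} by apply: homo_ltn => // ? ? ?; apply: ltn_trans.
  exists (phi \o psi); split => [i j ij|l].
    by apply: h1; apply: gm.
  rewrite ltnS leq_eqVlt => /orP[/eqP lk|lk] i j ij.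
    have -> : l = Ordinal kn by apply: val_inj.
    apply: (homo_leq (f := fun i => m (phi (psi i)) (Ordinal kn)) (r := leq)) => //.
    by move=> ? ? ?; apply: leq_trans.
  apply: h2 => //=; move: ij; rewrite leq_eqVlt => /orP[/eqP->//|/gm /ltnW//].
have [phi [h1 h2]] := H n.
exists (phi 0%N), (phi 1%N); split; first exact: h1.
by apply/mnm_lepP => l; apply: h2.
Qed.

Section Noetherian.
Variables (K : numFieldType) (n : nat).
Implicit Types (I : {mpoly K[n]} -> Prop) (p q r f : {mpoly K[n]}).

Definition ideal I := [/\ I 0, forall p q, I p -> I q -> I (p + q) &
  forall r p, I p -> I (r * p)].

Lemma idealN I p : ideal I -> I p -> I (- p).
Proof. by case=> _ _ H /(H (-1)); rewrite mulN1r. Qed.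

Lemma idealB I p q : ideal I -> I p -> I q -> I (p - q).
Proof. by move=> hI Ip Iq; case: (hI) => _ D _; apply: D (idealN hI Iq). Qed.

Lemma ideal_sum I (T : Type) (s : seq T) (P : pred T) (F : T -> {mpoly K[n]}) :
  ideal I -> (forall i, P i -> I (F i)) -> I (\sum_(i <- s | P i) F i).
Proof. by case=> I0 ID _ H; elim/big_ind: _. Qed.

Lemma mcoeffM_subm p m d : (m <= d)%MM -> (p * 'X_[d - m])@_d = p@_m.
Proof. by move=> md; rewrite -(mcoeffMX p (d - m) m) submK. Qed.

(** Hilbert's basis theorem. If every step were strict, choose in each step a new element with
    minimal leading monomial. By [dickson] one of these monomials divides a later one, and
    cancelling the leading term contradicts minimality. *)
Lemma ideal_acc (I : nat -> {mpoly K[n]} -> Prop) :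
  (forall k, ideal (I k)) -> (forall k p, I k p -> I k.+1 p) ->
  exists k, forall p, I k.+1 p -> I k p.
Proof.
move=> idI incI; apply: contrapT => /forallNP H.
have min k : exists p, [/\ I k.+1 p, ~ I k p &
    forall q, I k.+1 q -> ~ I k q -> ~ (mlead q < mlead p)%O].
  have /existsNP [p /not_implyP [p1 p2]] := H k.
  move: {2}(mlead p) (erefl (mlead p)) => l; move: p p1 p2.
  elim/(well_founded_ind (@ltom_wf n)): l => l IH p p1 p2 pl.
  case: (pselect (exists q, [/\ I k.+1 q, ~ I k q & (mlead q < mlead p)%O])).
    by move=> [q [q1 q2 ql]]; apply: (IH (mlead q)) q1 q2 erefl; rewrite -pl.
  by move/forallNP => N; exists p; split => // q q1 q2 ql; apply: (N q).
have [f Hf] := choice min.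
have [i [j [ij le]]] := dickson (fun i => mlead (f i)).
have incl a b p : (a <= b)%N -> I a p -> I b p.
  by move=> /subnK <-; elim: (b - a)%N => // d IH /IH; apply: incI.
have [fi1 fi2 _] := Hf i; have [fj1 fj2 fjm] := Hf j.
have fi0 : f i != 0 by apply: contra_notN fi2 => /eqP->; case: (idI i).
have fj0 : f j != 0 by apply: contra_notN fj2 => /eqP->; case: (idI j).
pose c := mleadc (f j) / mleadc (f i).
have c0 : c != 0 by rewrite mulf_neq0 ?invr_eq0 ?mleadc_eq0.
pose h := (c *: 'X_[mlead (f j) - mlead (f i)]) * f i.
have lh : mlead h = mlead (f j).
  rewrite /h mleadM ?mleadZ ?mleadXm ?submK //.
  by rewrite scaler_eq0 (negbTE c0) mpolyX_neq0.
have Ih : I j h by case: (idI j) => _ _; apply; apply: incl fi1.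
have hj : mleadc h = mleadc (f j).
  rewrite lh /h -scalerAl mcoeffZ.
  have -> : ('X_[mlead (f j) - mlead (f i)] * f i)@_(mlead (f j)) = mleadc (f i).
    by rewrite mulrC mcoeffM_subm.
  by rewrite divfK ?mleadc_eq0.
have gI : I j.+1 (f j - h) by apply: idealB => //; apply: incI.
have gN : ~ I j (f j - h).
  move=> g; apply: fj2; rewrite -(subrK h (f j)).
  by case: (idI j) => _ D _; apply: D.
apply: (fjm _ gI gN).
have g0 : f j - h != 0 by apply: contra_notN gN => /eqP->; case: (idI j).
rewrite lt_neqAle; apply/andP; split.
  apply/eqP => e; have := mlead_supp g0.
  by rewrite mcoeff_msupp e mcoeffB -[X in _ - h@_X]lh hj subrr eqxx.
by apply: le_trans (mleadB_le _ _) _; rewrite lh joinxx.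
Qed.

Lemma ideal_max (P : ({mpoly K[n]} -> Prop) -> Prop) I0 : P I0 ->
  (forall I, P I -> ideal I) ->
  exists I, P I /\ forall J, P J -> (forall p, I p -> J p) -> forall p, J p -> I p.
Proof.
move=> PI0 Pid; apply: contrapT => /forallNP H.
have step (I : {I | P I}) : exists J : {I | P I}, (forall p, sval I p -> sval J p) /\
    exists p, sval J p /\ ~ sval I p.
  have /not_andP [//|/existsNP [J /not_implyP [PJ /not_implyP [IJ /existsNP [p /not_implyP pp]]]]] := H (sval I).
    by case: I => /= I PI; rewrite /not.
  by exists (exist _ J PJ); split => //; exists p.
have [s Hs] := choice step.
pose c := fix c k := if k is k'.+1 then s (c k') else exist _ I0 PI0.
have [k Hk] := @ideal_acc (fun k => sval (c k)) (fun k => Pid _ (svalP (c k)))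
   (fun k => (Hs (c k)).1).
have [_ [p [p1 p2]]] := Hs (c k).
by apply: p2; apply: Hk.
Qed.

(** The J-th power of the maximal ideal of the origin. *)
Definition ordge J p := forall m, (mdeg m < J)%N -> p@_m = 0.

Lemma ordge_ideal J : ideal (ordge J).
Proof.
split=> [m _|p q hp hq m mJ|r p hp m mJ]; first by rewrite mcoeff0.
  by rewrite mcoeffD hp // hq // addr0.
rewrite mcoeffM big1 // => -[k1 k2] /eqP /= e.
have em := etrans (congr1 mdeg e) (mdegD _ _).
by rewrite (hp k2) ?mulr0 //; lia.
Qed.

Lemma ordgeM J J' p q : ordge J p -> ordge J' q -> ordge (J + J') (p * q).
Proof.
move=> hp hq m mJ; rewrite mcoeffM big1 // => -[k1 k2] /eqP /= e.
have em := etrans (congr1 mdeg e) (mdegD _ _).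
case: (ltnP (mdeg k1) J) => h1; first by rewrite hp // mul0r.
by rewrite (hq k2) ?mulr0 //; lia.
Qed.

Lemma ordgeW J J' p : (J <= J')%N -> ordge J' p -> ordge J p.
Proof. by move=> JJ h m mJ; apply: h; apply: leq_trans mJ JJ. Qed.

(* Krull's intersection theorem at the origin: a maximal ideal among those    *)
(* containing I + mf but not f contains a power of every variable.            *)
Lemma krull I f : ideal I ->
  (forall j, exists h, I h /\ ordge j (f - h)) ->
  exists q, q@_0 != 0 /\ I (q * f).
Proof.
move=> idI H; apply: contrapT => /forallNP N.
pose P J := [/\ ideal J, forall h, I h -> J h,
  forall r, r@_0 = 0 -> J (r * f) & ~ J f].
have [I0 ID IM] := idI.
have P0 : P (fun p => exists h r, [/\ I h, r@_0 = 0 & p = h + r * f]).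
  split.
  - split.
    + by exists 0, 0; rewrite mcoeff0 mul0r addr0.
    + move=> p q [h [r [hI r0 ->]]] [h' [r' [hI' r0' ->]]].
      exists (h + h'), (r + r'); rewrite mcoeffD r0 r0' addr0.
      by split; [apply: ID| |ring].
    + move=> s p [h [r [hI r0 ->]]]; exists (s * h), (s * r); split.
      * exact: IM.
      * by rewrite rmorphM /= r0 mulr0.
      * by ring.
  - by move=> h hI; exists h, 0; rewrite mcoeff0 mul0r addr0.
  - by move=> r r0; exists 0, r; rewrite add0r.
  - move=> [h [r [hI r0 e]]]; apply: (N (1 - r)).
    rewrite mcoeffB mcoeff1 eqxx r0 subr0 oner_neq0; split => //.
    by rewrite mulrBl mul1r {1}e addrK.
have [J [[idJ IJ mJ fJ] maxJ]] := ideal_max P0 (fun J h => let: And4 a _ _ _ := h in a).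
have [J0 JD JM] := idJ.
have pw k : exists d, J ('X_k ^+ d).
  have [||d Hd] := @ideal_acc (fun d r => J ('X_k ^+ d * r)).
  - move=> d; split; first by rewrite mulr0.
      by move=> p q hp hq; rewrite mulrDr; apply: JD.
    by move=> r p hp; rewrite mulrCA; apply: JM.
  - by move=> d p hp; rewrite exprS -mulrA; apply: JM.
  exists d; apply: contrapT => XJ.
  pose J' p := exists r h, J h /\ p = 'X_k ^+ d * r + h.
  have idJ' : ideal J'.
    split; first by exists 0, 0; rewrite mulr0 addr0.
      move=> p q [r [h [hJ ->]]] [r' [h' [hJ' ->]]].
      by exists (r + r'), (h + h'); split; [apply: JD|rewrite mulrDr addrACA].
    move=> s p [r [h [hJ ->]]]; exists (s * r), (s * h).
    by split; [apply: JM|rewrite mulrDr mulrCA].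
  have JJ' p : J p -> J' p by exists 0, p; rewrite mulr0 add0r.
  (* If f = X_k^d r + h with h in J, then X_k^(d+1) r is in J because X_k f is, and stationarity
     puts X_k^d r, hence f, in J. Otherwise maximality of J forces X_k^d into J. *)
  case: (pselect (J' f)) => [[r [h [hJ e]]]|fJ'].
    have /Hd Jr : J ('X_k ^+ d.+1 * r).
      have -> : 'X_k ^+ d.+1 * r = 'X_k * f - 'X_k * h by rewrite e exprS; ring.
      apply: idealB => //; last exact: JM.
      by apply: mJ; rewrite mcoeffX mnm1_eq0.
    by apply: fJ; rewrite e; apply: JD.
  apply: XJ; apply: (maxJ J') => //; last by exists 1, 0; rewrite mulr1 addr0.
  split => //; first by move=> h /IJ /JJ'.
  by move=> r /mJ /JJ'.
have [d Hd] := choice pw.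
(* A monomial of degree above the sum of the d_k is divisible by some X_k^(d_k), hence lies in J. *)
have [h [hI hf]] := H (\sum_k d k).+1%N.
apply: fJ; rewrite -(subrK h f); apply: JD; last exact: IJ.
rewrite [f - h]mpolyE; apply: ideal_sum => // m _.
case: (ltnP (mdeg m) (\sum_k d k).+1) => hm.
  by rewrite hf // scale0r.
have [k hk] : exists k, (d k <= m k)%N.
  apply: contrapT => /forallNP HN; suff : (mdeg m <= \sum_k d k)%N by lia.
  rewrite mdegE; apply: leq_sum => k _; apply: ltnW; rewrite ltnNge; apply/negP.
  exact: HN.
have -> : m = (m - U_(k) *+ d k + U_(k) *+ d k)%MM.
  rewrite submK //; apply/mnm_lepP => l; rewrite mulmnE mnm1E.
  by case: eqP => [<-|_]; rewrite ?mul1n ?mul0n.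
by rewrite mpolyXD -mpolyXn scalerAl; apply: JM.
Qed.

End Noetherian.


(** * Taylor expansions at the origin *)

Lemma meval_at0 (K : numFieldType) n (p : {mpoly K[n]}) :
  p.@[(0 : 'rV[K]_n) 0] = p@_0.
Proof.
elim/mpoly_rind: p => [c|i|p q hp hq|p q hp hq].
- by rewrite mevalC mcoeffC eqxx mulr1.
- by rewrite mevalXU mxE mcoeffX mnm1_eq0.
- by rewrite mevalD mcoeffD hp hq.
- by rewrite mevalM rmorphM /= hp hq.
Qed.

Section Jets.
Variables (K : numFieldType) (n : nat).
Implicit Types (p q a b : {mpoly K[n]}) (f g : 'rV[K]_n -> K).

Lemma ordge0 p : ordge 0 p.
Proof. by []. Qed.

Lemma ordge1 p : ordge 1 p <-> p@_0 = 0.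
Proof.
split=> [H|H m]; first by apply: H; rewrite mdeg0.
by rewrite ltnS leqn0 mdeg_eq0 => /eqP->.
Qed.

Lemma ordgeD J p q : ordge J p -> ordge J q -> ordge J (p + q).
Proof. by case: (@ordge_ideal K n J) => _ H _; apply: H. Qed.

Lemma ordgeB J p q : ordge J p -> ordge J q -> ordge J (p - q).
Proof. exact: (idealB (@ordge_ideal K n J)). Qed.

Lemma ordgeMl J r p : ordge J p -> ordge J (r * p).
Proof. by case: (@ordge_ideal K n J) => _ _ H; apply: H. Qed.

Lemma ordge_z J : ordge J (0 : {mpoly K[n]}).
Proof. by case: (@ordge_ideal K n J). Qed.

Lemma ordge_sum J (T : Type) (s : seq T) (P : pred T) (F : T -> {mpoly K[n]}) :
  (forall i, P i -> ordge J (F i)) -> ordge J (\sum_(i <- s | P i) F i).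
Proof. exact: (ideal_sum _ (@ordge_ideal K n J)). Qed.

Lemma ordgeC J p q : ordge J (p - q) -> ordge J (q - p).
Proof. by move=> /(idealN (@ordge_ideal K n J)); rewrite opprB. Qed.

Lemma ordge_trans J p q r : ordge J (p - q) -> ordge J (q - r) -> ordge J (p - r).
Proof. by move=> h h'; have := ordgeD h h'; rewrite addrA subrK. Qed.

Lemma ordge_coef J p q m : ordge J (p - q) -> (mdeg m < J)%N -> p@_m = q@_m.
Proof. by move=> h /h; rewrite mcoeffB => /eqP; rewrite subr_eq0 => /eqP. Qed.

Lemma ordge_all p : (forall J, ordge J p) -> p = 0.
Proof. by move=> h; apply/mpolyP => m; rewrite mcoeff0; apply: (h (mdeg m).+1). Qed.

Lemma ordgeX p J : p@_0 = 0 -> ordge J (p ^+ J).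
Proof.
move=> /ordge1 p0; elim: J => [|J IH]; first exact: ordge0.
by rewrite exprS -add1n; apply: ordgeM.
Qed.

(** A truncated geometric series in 1 - b / b_0, where b_0 is the constant term. *)
Lemma unit_jet b J : b@_0 != 0 -> exists b', ordge J (b * b' - 1).
Proof.
move=> b0; pose r := 1 - (b@_0)^-1 *: b.
have r0 : r@_0 = 0 by rewrite mcoeffB mcoeff1 eqxx mcoeffZ mulVf // subrr.
exists ((b@_0)^-1 *: \sum_(i < J) r ^+ i).
rewrite -scalerAr scalerAl.
have -> : (b@_0)^-1 *: b = 1 - r by rewrite /r opprB addrC subrK.
rewrite -(opprB r 1) mulNr -subrX1 opprB addrAC subrr add0r.
by apply: (idealN (@ordge_ideal K n J)); apply: ordgeX.
Qed.

Lemma ordge_unit b p J : b@_0 != 0 -> ordge J (b * p) -> ordge J p.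
Proof.
move=> /(unit_jet J) [b' hb] h.
have -> : p = b' * (b * p) - p * (b * b' - 1) by ring.
by apply: ordgeB; apply: ordgeMl.
Qed.

(* [jet J f p]: p is the Taylor expansion of f at the origin up to order J. *)
Definition jet J f p := exists a b, [/\ b@_0 != 0,
  gen (fun w : 'rV[K]_n => b.@[w 0] * f w = a.@[w 0]) & ordge J (b * p - a)].

Lemma jet_uniq J f g p q : gen (fun w => f w = g w) ->
  jet J f p -> jet J g q -> ordge J (p - q).
Proof.
move=> fg [a [b [b0 ba bp]]] [a' [b' [b0' ba' bp']]].
have E : a * b' = a' * b.
  apply: gen_eq; apply: gen_and fg (genI ba ba') => w e [h h'].
  by rewrite !mevalM -h -h' e; ring.
apply: (@ordge_unit (b * b')); first by rewrite rmorphM /= mulf_neq0.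
have -> : b * b' * (p - q) = b' * (b * p - a) - b * (b' * q - a') by ring: E.
by apply: ordgeB; apply: ordgeMl.
Qed.

Lemma jet_ext J f g p : gen (fun w => f w = g w) -> jet J f p -> jet J g p.
Proof.
move=> fg [a [b [b0 ba bp]]]; exists a, b; split => //.
by apply: gen_and fg ba => w ->.
Qed.

Lemma jetW J J' f p : (J <= J')%N -> jet J' f p -> jet J f p.
Proof.
by move=> JJ [a [b [b0 ba bp]]]; exists a, b; split => //; apply: ordgeW bp.
Qed.

Lemma jet_ex J f v : regat 0 f v -> exists p, jet J f p.
Proof.
move=> [a [b [b0 _ H]]]; rewrite meval_at0 in b0.
have [b' hb] := unit_jet J b0.
exists (a * b'), a, b; split => //.
have -> : b * (a * b') - a = a * (b * b' - 1) by ring.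
exact: ordgeMl.
Qed.

Lemma jet_mpoly J p : jet J (fun w => p.@[w 0]) p.
Proof.
exists p, 1; rewrite mcoeff1 eqxx oner_eq0; split => //.
  by apply: gen_true => w; rewrite meval1 mul1r.
by rewrite mul1r subrr; apply: ordge_z.
Qed.

Lemma jetD J f g p q : jet J f p -> jet J g q -> jet J (fun w => f w + g w) (p + q).
Proof.
move=> [a [b [b0 ba bp]]] [a' [b' [b0' ba' bp']]].
exists (a * b' + a' * b), (b * b'); rewrite rmorphM /= mulf_neq0 //; split => //.
  by apply: gen_and ba ba' => w h h'; rewrite mevalD !mevalM -h -h'; ring.
have -> : b * b' * (p + q) - (a * b' + a' * b) =
  b' * (b * p - a) + b * (b' * q - a') by ring.
by apply: ordgeD; apply: ordgeMl.
Qed.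

Lemma jetM J f g p q : jet J f p -> jet J g q -> jet J (fun w => f w * g w) (p * q).
Proof.
move=> [a [b [b0 ba bp]]] [a' [b' [b0' ba' bp']]].
exists (a * a'), (b * b'); rewrite rmorphM /= mulf_neq0 //; split => //.
  by apply: gen_and ba ba' => w h h'; rewrite !mevalM -h -h'; ring.
have -> : b * b' * (p * q) - a * a' =
  (b' * q) * (b * p - a) + a * (b' * q - a') by ring.
by apply: ordgeD; apply: ordgeMl.
Qed.

Lemma jet_meval J k (f : 'I_k -> 'rV[K]_n -> K) (p : 'I_k -> {mpoly K[n]})
    (P : {mpoly K[k]}) : (forall i, jet J (f i) (p i)) ->
  jet J (fun w => P.@[fun i => f i w]) (mmap (@mpolyC n K) p P).
Proof.
move=> H; elim/mpoly_rind: P => [c|i|P Q hP hQ|P Q hP hQ].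
- rewrite mmapC; apply: jet_ext (jet_mpoly J _).
  by apply: gen_true => w; rewrite !mevalC.
- rewrite mmapX mmap1U; apply: jet_ext (H i).
  by apply: gen_true => w; rewrite mevalXU.
- rewrite mmapD; apply: jet_ext (jetD hP hQ).
  by apply: gen_true => w; rewrite mevalD.
- rewrite rmorphM /=; apply: jet_ext (jetM hP hQ).
  by apply: gen_true => w; rewrite mevalM.
Qed.

Lemma jet_regat J f p : (0 < J)%N -> jet J f p -> regat 0 f p@_0.
Proof.
move=> J0 [a [b [b0 ba bp]]]; exists a, b; rewrite !meval_at0; split => //.
have : (b * p - a)@_0 = 0 by apply: bp; rewrite mdeg0.
by rewrite mcoeffB rmorphM /= => /eqP; rewrite subr_eq0 => /eqP.
Qed.

Lemma jet_num J f p a b : gen (fun w : 'rV[K]_n => b.@[w 0] * f w = a.@[w 0]) ->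
  jet J f p -> ordge J (b * p - a).
Proof.
by move=> ba fp; apply: jet_uniq ba (jetM (jet_mpoly J b) fp) (jet_mpoly J a).
Qed.

Lemma mmap_mcoeff0 k (p : 'I_k -> {mpoly K[n]}) (P : {mpoly K[k]}) :
  (forall i, (p i)@_0 = 0) -> (mmap (@mpolyC n K) p P)@_0 = P@_0.
Proof.
move=> p0; rewrite -meval_at0 meval_mmap -meval_at0; apply: meval_eq => i.
by rewrite meval_at0 p0 mxE.
Qed.

Lemma mmap1_ordge k (p : 'I_k -> {mpoly K[n]}) (m : 'X_{1..k}) :
  (forall i, (p i)@_0 = 0) -> ordge (mdeg m) (mmap1 p m).
Proof.
move=> p0; rewrite /mmap1 mdegE; elim/big_ind2: _ => [|p1 J1 p2 J2|i _].
- exact: ordge0.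
- exact: ordgeM.
- exact: ordgeX.
Qed.

Lemma mmap_ordge k (p : 'I_k -> {mpoly K[n]}) (P : {mpoly K[k]}) J :
  (forall i, (p i)@_0 = 0) -> ordge J P -> ordge J (mmap (@mpolyC n K) p P).
Proof.
move=> p0 hP; rewrite /mmap; apply: ordge_sum => m _.
case: (ltnP (mdeg m) J) => hm; last first.
  by apply: ordgeMl; apply: ordgeW hm _; apply: mmap1_ordge.
by rewrite (hP m hm) mpolyC0 mul0r; apply: ordge_z.
Qed.

Lemma mmap_congr k (p q : 'I_k -> {mpoly K[n]}) (P : {mpoly K[k]}) J :
  (forall i, ordge J (p i - q i)) ->
  ordge J (mmap (@mpolyC n K) p P - mmap (@mpolyC n K) q P).
Proof.
move=> h; elim/mpoly_rind: P => [c|i|P Q hP hQ|P Q hP hQ].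
- by rewrite !mmapC subrr; apply: ordge_z.
- by rewrite !mmapX !mmap1U.
- by rewrite !mmapD opprD addrACA; apply: ordgeD.
rewrite !rmorphM /=; move: hP hQ.
move: (mmap _ p P) (mmap _ p Q) (mmap _ q P) (mmap _ q Q) => a b c d hac hbd.
have -> : a * b - c * d = b * (a - c) + c * (b - d) by ring.
by apply: ordgeD; apply: ordgeMl.
Qed.

Definition rescale (t : 'rV[K]_n) p := mmap (@mpolyC n K) (fun k => t 0 k *: 'X_k) p.

Lemma meval_rescale t p (w : 'rV[K]_n) :
  (rescale t p).@[w 0] = p.@[(map2_mx *%R t w) 0].
Proof.
rewrite /rescale meval_mmap; apply: meval_eq => k.
by rewrite mevalZ mevalXU mxE.
Qed.

Lemma mcoeff_rescale t p m : (rescale t p)@_m = (\prod_k t 0 k ^+ m k) * p@_m.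
Proof.
rewrite {2}[p]mpolyE /rescale /mmap !raddf_sum mulr_sumr; apply: eq_bigr => m' _ /=.
have -> : mmap1 (fun k => t 0 k *: 'X_k) m' =
    (\prod_k t 0 k ^+ m' k) *: 'X_[m'] :> {mpoly K[n]}.
  rewrite /mmap1 mpolyXE_id -mul_mpolyC rmorph_prod -big_split; apply: eq_bigr => k _ /=.
  by rewrite exprZn mul_mpolyC.
rewrite mcoeffCM !mcoeffZ mcoeffX; case: eqP => [->|_]; last by rewrite !mulr0.
by rewrite mulrCA.
Qed.

Lemma gen_rescale (t : 'rV[K]_n) (P : 'rV[K]_n -> Prop) : tor t -> gen P ->
  gen (fun w => P (map2_mx *%R t w)).
Proof.
move=> tt [Q Q0 H]; exists (rescale t Q); last first.
  by move=> w; rewrite meval_rescale; apply: H.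
have [v Qv] := mpoly_nonzero Q0.
apply: contra Qv => /eqP e; apply/eqP.
have := meval_rescale t Q (\row_k ((t 0 k)^-1 * v 0 k)); rewrite e meval0 => ->.
by apply: meval_eq => k; rewrite !mxE mulVKf.
Qed.

Lemma jet_rescale J f p t : tor t -> jet J f p ->
  jet J (fun w => f (map2_mx *%R t w)) (rescale t p).
Proof.
move=> tt [a [b [b0 ba bp]]]; exists (rescale t a), (rescale t b).
split.
- rewrite mcoeff_rescale mulf_neq0 //; apply/prodf_neq0 => k _.
  by rewrite expf_neq0.
- by apply: genW (gen_rescale tt ba) => w; rewrite !meval_rescale.
- rewrite /rescale -rmorphM -rmorphB /= -/(rescale t _) => m mJ.
  by rewrite mcoeff_rescale bp // mulr0.
Qed.

End Jets.


(** * Toric coordinates on a non-singular germ *)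

Definition rowz k (m : 'X_{1..k}) : 'rV[int]_k := \row_j (m j)%:Z.

Definition mcomb s n (M : 'I_s -> 'X_{1..n}) (t : 'X_{1..s}) : 'X_{1..n} :=
  (\sum_i M i *+ t i)%MM.

Definition expmx s n (M : 'I_s -> 'X_{1..n}) : 'M[int]_(s, n) :=
  \matrix_(i, j) (M i j)%:Z.

Lemma rowz_inj k : injective (@rowz k).
Proof.
by move=> m m' /rowP e; apply/mnmP => i; have := e i; rewrite !mxE => -[].
Qed.

Lemma rowz1 k (j : 'I_k) : rowz U_(j)%MM = delta_mx 0 j.
Proof. by apply/rowP => l; rewrite !mxE mnm1E eqxx eq_sym; case: eqP. Qed.

Lemma rowzD k (m m' : 'X_{1..k}) : rowz (m + m')%MM = rowz m + rowz m'.
Proof. by apply/rowP => j; rewrite !mxE mnmDE PoszD. Qed.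

Lemma rowz_mcomb s n (M : 'I_s -> 'X_{1..n}) t :
  rowz (mcomb M t) = rowz t *m expmx M.
Proof.
apply/rowP => j; rewrite !mxE mnm_sumE -natz natr_sum; apply: eq_bigr => i _.
by rewrite mulmnE !mxE natz mulrC PoszM.
Qed.

Lemma mcombD s n (M : 'I_s -> 'X_{1..n}) t t' :
  mcomb M (t + t')%MM = (mcomb M t + mcomb M t')%MM.
Proof. by apply: rowz_inj; rewrite rowzD !rowz_mcomb rowzD mulmxDl. Qed.

Lemma mcomb1 s n (M : 'I_s -> 'X_{1..n}) i : mcomb M U_(i)%MM = M i.
Proof.
apply: rowz_inj; rewrite rowz_mcomb; apply/rowP => j; rewrite mxE (bigD1 i) //=.
rewrite big1 ?addr0 => [|k ki]; rewrite !mxE mnm1E ?eqxx ?mul1r //.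
by rewrite eq_sym (negbTE ki) mul0r.
Qed.

Section LocalAlgebra.
Variables (K : numFieldType) (n E : nat).
(** The coordinates of a chart of X, centred at a limit point and pulled back to K^n by a monomial
    map. [c_tangent] expresses non-singularity: there are enough relations with independent linear
    parts. [c_torus] says that the torus preserves the local ring, and [c_birat] that the chart
    determines w generically. *)
Variable c : 'I_E -> 'rV[K]_n -> K.
Hypothesis c_reg : forall k, regat 0 (c k) 0.

Local Notation "P ^@ w" := (P.@[fun k => c k w]) (at level 2).

Definition rel_ideal (P : {mpoly K[E]}) := gen (fun w => P^@w = 0).

Hypothesis c_tangent : exists r (H : 'I_r -> {mpoly K[E]}),
  [/\ (E <= r + n)%N, forall i, rel_ideal (H i) &
      row_free (\matrix_(i < r, k < E) (H i)@_U_(k))].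
Hypothesis c_torus : forall t, tor t -> forall k, exists P Q : {mpoly K[E]},
  Q@_0 != 0 /\ gen (fun w => Q^@w * c k (map2_mx *%R t w) = P^@w).
Hypothesis c_birat : forall j, exists P Q : {mpoly K[E]},
  ~ rel_ideal Q /\ gen (fun w : 'rV[K]_n => w 0 j * Q^@w = P^@w).

Lemma rel_ideal_ideal : ideal rel_ideal.
Proof.
split; first by apply: gen_true => w; rewrite meval0.
  by move=> p q; apply: gen_and => w; rewrite mevalD => -> ->; rewrite addr0.
by move=> r p; apply: genW => w; rewrite mevalM => ->; rewrite mulr0.
Qed.

Lemma val_reg (P : {mpoly K[E]}) : regat 0 (fun w => P^@w) P@_0.
Proof.
have -> : P@_0 = P.@[fun=> 0].
  by rewrite -meval_at0; apply: meval_eq => k; rewrite mxE.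
exact: regat_meval P c_reg.
Qed.

Lemma not_rel (P : {mpoly K[E]}) : ~ rel_ideal P -> gen (fun w => P^@w != 0).
Proof.
move=> nP; have [a [b [b0 e ba]]] := val_reg P.
have a0 : a != 0.
  apply: contra_notN nP => /eqP a0; apply: gen_and ba (gen_neq0 (meval_neq0 b0)).
  move=> w; rewrite a0 meval0 => /eqP; rewrite mulf_eq0 => /orP[->//|/eqP->//].
apply: gen_and ba (gen_neq0 a0) => w <-; by rewrite mulf_eq0 negb_or => /andP[].
Qed.

Lemma not_relM (P Q : {mpoly K[E]}) :
  ~ rel_ideal P -> ~ rel_ideal Q -> ~ rel_ideal (P * Q).
Proof.
move=> /not_rel hP /not_rel hQ hPQ.
have [w [[h1 h2] h3]] := gen_ex (genI (genI hP hQ) hPQ).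
by move/eqP: h3; rewrite mevalM mulf_eq0 (negbTE h1) (negbTE h2).
Qed.

Lemma cj_ex : exists cj : nat -> 'I_E -> {mpoly K[n]}, forall J k, jet J (c k) (cj J k).
Proof.
have /choice [f Hf] : forall Jk : nat * 'I_E, exists p, jet Jk.1 (c Jk.2) p.
  by move=> [J k]; apply: jet_ex (c_reg k).
by exists (fun J k => f (J, k)) => J k; apply: (Hf (J, k)).
Qed.

(** The expansions for different orders J are chosen independently; [sub_le] shows that they agree
    up to the smaller order. *)
Definition cj := projT1 (cid cj_ex).

Lemma cjP J k : jet J (c k) (cj J k).
Proof. exact: (projT2 (cid cj_ex)). Qed.

Definition sub J P := mmap (@mpolyC n K) (cj J) P.

Lemma subP J P : jet J (fun w => P^@w) (sub J P).
Proof. exact/jet_meval/cjP. Qed.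

Lemma sub_le J J' P : (J <= J')%N -> ordge J (sub J' P - sub J P).
Proof.
move=> JJ; apply: jet_uniq (jetW JJ (subP J' P)) (subP J P).
exact: gen_true.
Qed.

Lemma cj0 J k : (0 < J)%N -> (cj J k)@_0 = 0.
Proof. by move=> J0; apply: regat_uniq (jet_regat J0 (cjP J k)) (c_reg k). Qed.

Lemma sub_mcoeff0 J P : (0 < J)%N -> (sub J P)@_0 = P@_0.
Proof. by move=> J0; apply: mmap_mcoeff0 => k; apply: cj0. Qed.

Lemma subM J P Q : sub J (P * Q) = sub J P * sub J Q.
Proof. exact: rmorphM. Qed.
Lemma subB J P Q : sub J (P - Q) = sub J P - sub J Q.
Proof. exact: rmorphB. Qed.
Lemma subD J P Q : sub J (P + Q) = sub J P + sub J Q.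
Proof. exact: rmorphD. Qed.
Lemma sub1 J : sub J 1 = 1.
Proof. exact: rmorph1. Qed.
Lemma subZ J a P : sub J (a *: P) = a *: sub J P.
Proof. by rewrite /sub mmapZ mul_mpolyC. Qed.

Lemma sub_sum J (I : Type) (s : seq I) (A : pred I) F :
  sub J (\sum_(i <- s | A i) F i) = \sum_(i <- s | A i) sub J (F i).
Proof. exact: raddf_sum. Qed.

Lemma sub_rel J P : rel_ideal P -> ordge J (sub J P).
Proof.
move=> hP; rewrite -[sub J P]subr0.
apply: jet_uniq (subP J P) (jet_mpoly J 0).
by apply: genW hP => w ->; rewrite meval0.
Qed.

Lemma sub_ordge J j P : (0 < J)%N -> ordge j P -> ordge j (sub J P).
Proof. by move=> J0; apply: mmap_ordge => k; apply: cj0. Qed.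

Lemma rel0 P : rel_ideal P -> P@_0 = 0.
Proof. by move=> hP; apply: regat_eq0 (val_reg P). Qed.

(** The monomials in the closure of the local ring among formal power series: polynomials in the
    [c k] approximate them to every order. *)
Definition expo (m : 'X_{1..n}) := forall J, exists P, ordge J (sub J P - 'X_[m]).

Lemma expo0 : expo 0.
Proof. by move=> J; exists 1; rewrite sub1 mpolyX0 subrr; apply: ordge_z. Qed.

Lemma expoD m m' : expo m -> expo m' -> expo (m + m').
Proof.
move=> h h' J; have [P hP] := h J; have [Q hQ] := h' J.
exists (P * Q); rewrite subM mpolyXD.
move: (sub J P) (sub J Q) ('X_[m] : {mpoly K[n]}) ('X_[m'] : {mpoly K[n]}) hP hQ.
move=> a b x y ha hb.
have -> : a * b - x * y = b * (a - x) + x * (b - y) by ring.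
by apply: ordgeD; apply: ordgeMl.
Qed.

(* The truncated function ring is stable under the torus, because the charts *)
(* transform into one another.                                               *)
Lemma sub_rescale J t P : tor t -> (0 < J)%N ->
  exists P', ordge J (rescale t (sub J P) - sub J P').
Proof.
move=> tt J0.
have H k : exists Pk, ordge J (rescale t (cj J k) - sub J Pk).
  have [Pk [Q [Q0 hQ]]] := c_torus tt k.
  have [Q' hQ'] := unit_jet J Q0.
  exists (Pk * Q').
  have h1 : ordge J (sub J Q * rescale t (cj J k) - sub J Pk).
    apply: jet_uniq hQ _ (subP J Pk).
    exact: jetM (subP J Q) (jet_rescale tt (cjP J k)).
  have h2 := sub_ordge J0 hQ'; rewrite subB sub1 subM in h2.
  rewrite subM; move: (sub J Q) (sub J Pk) (sub J Q') (rescale t _) h1 h2.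
  move=> q p q' r h1 h2.
  have -> : r - p * q' = q' * (q * r - p) - r * (q * q' - 1) by ring.
  by apply: ordgeB; apply: ordgeMl.
have [P' hP'] := choice H.
exists (mmap (@mpolyC E K) P' P).
have -> : rescale t (sub J P) = mmap (@mpolyC n K) (fun k => rescale t (cj J k)) P.
  apply: mpoly_ext => w; rewrite meval_rescale !meval_mmap; apply: meval_eq => k.
  by rewrite meval_rescale.
have -> : sub J (mmap (@mpolyC E K) P' P) = mmap (@mpolyC n K) (fun k => sub J (P' k)) P.
  apply: mpoly_ext => w; rewrite !meval_mmap; apply: meval_eq => k.
  by rewrite meval_mmap.
exact: mmap_congr.
Qed.

(** A torus-stable space of truncated series contains every monomial occurring in one of its members
    p. If m' is another exponent of p, a point t with a single coordinate equal to 2 separates it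
    from m, and p(t w) - t^(m') p(w) loses m' but keeps m. The number of monomials decreases until
    only m is left. *)
Lemma expo_supp J P m : (mdeg m < J)%N -> (sub J P)@_m != 0 -> expo m.
Proof.
move=> mJ pm J1; pose J' := maxn J J1.
have J0 : (0 < J')%N by rewrite /J'; lia.
suff [P' hP'] : exists P', ordge J' ('X_[m] - sub J' P').
  exists P'; apply: ordge_trans (ordgeC _) (ordgeC _) => /=; last first.
    by apply: ordgeW hP'; rewrite leq_maxr.
  by apply: sub_le; rewrite leq_maxr.
have : (sub J' P)@_m != 0.
  by rewrite (ordge_coef (sub_le P (leq_maxl J J1))).
have : exists P', ordge J' (sub J' P - sub J' P').
  by exists P; rewrite subrr; apply: ordge_z.
move: {P pm} (sub J' P) => p.
have [N] := ubnP (size (msupp p)); elim: N p => // N IH p pN [P hP] pm.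
case: (pselect (exists2 m', m' \in msupp p & m' != m)) => [[m' pm' mm']|H]; last first.
  have pE : p = p@_m *: 'X_[m].
    apply/mpolyP => m'; rewrite mcoeffZ mcoeffX.
    case: eqP => [->|/eqP mm']; first by rewrite mulr1.
    rewrite mulr0; apply/eqP; rewrite mcoeff_eq0; apply/negP => h.
    by apply: H; exists m'; rewrite // eq_sym.
  exists ((p@_m)^-1 *: P).
  have -> : 'X_[m] = (p@_m)^-1 *: p by rewrite {2}pE scalerA mulVf // scale1r.
  rewrite subZ -scalerBr -mul_mpolyC; exact: ordgeMl.
have [k mk] : exists k, m k != m' k.
  apply: contrapT => /forallNP h; move/eqP: mm'; apply; apply/mnmP => k.
  by apply/eqP; rewrite eq_sym; apply: contrapT => /negP; apply: h.
pose t : 'rV[K]_n := \row_i (if i == k then 2 else 1).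
have tt : tor t by move=> i; rewrite mxE; case: ifP; rewrite ?oner_eq0 ?pnatr_eq0.
pose tau (l : 'X_{1..n}) := \prod_i t 0 i ^+ l i.
have tauE l : tau l = 2 ^+ l k.
  rewrite /tau (bigD1 k) //= mxE eqxx big1 ?mulr1 // => i ik.
  by rewrite mxE (negbTE ik) expr1n.
pose q := rescale t p - tau m' *: p.
have qE l : q@_l = (tau l - tau m') * p@_l.
  by rewrite mcoeffB mcoeff_rescale mcoeffZ mulrBl.
apply: (IH q).
- rewrite -ltnS; apply: leq_ltn_trans pN.
  have sub : {subset msupp q <= rem m' (msupp p)}.
    move=> l; rewrite mcoeff_msupp qE mulf_eq0 negb_or subr_eq0 => /andP[h1 h2].
    rewrite mem_rem_uniq ?msupp_uniq // inE mcoeff_msupp h2 andbT.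
    by apply: contraNneq h1 => ->.
  have := uniq_leq_size (msupp_uniq q) sub; rewrite size_rem //.
  by case: (msupp p) pm'.
- have [P' hP'] := sub_rescale P tt J0.
  exists (P' - tau m' *: P); rewrite /q subB subZ.
  have hr : ordge J' (rescale t p - rescale t (sub J' P)).
    by rewrite /rescale -rmorphB /= -/(rescale t _) => l lJ; rewrite mcoeff_rescale hP ?mulr0.
  have := ordge_trans hr hP'.
  have hs : ordge J' (tau m' *: p - tau m' *: sub J' P).
    by rewrite -scalerBr -mul_mpolyC; apply: ordgeMl.
  move=> h; have := ordgeB h hs; congr ordge.
  move: (rescale t p) (tau m' *: p) (sub J' P') (tau m' *: sub J' P) => a b x y.
  by ring.
- rewrite qE mulf_neq0 // subr_eq0 !tauE -!natrX eqr_nat eqn_exp2l //.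
Qed.

(* A filtration D of the exponents that contains all the exponents of the     *)
(* coordinates in degree 1 controls the exponents of polynomials of order j.  *)
Lemma filtered_supp (D : nat -> 'X_{1..n} -> Prop) :
  D 0%N 0%MM ->
  (forall j j' m m', D j m -> D j' m' -> D (j + j')%N (m + m')%MM) ->
  (forall j m, D j.+1 m -> D j m) ->
  (forall m, expo m -> m != 0%MM -> D 1%N m) ->
  forall j J P m, ordge j P -> (mdeg m < J)%N -> (sub J P)@_m != 0 -> D j m.
Proof.
move=> D0 DD Dm D1 j J P m hP mJ.
have Dle i i' l : (i <= i')%N -> D i' l -> D i l.
  by move=> /subnK <-; elim: (i' - i)%N => // d IH /Dm /IH.
pose sup e (p : {mpoly K[n]}) := forall l, (mdeg l < J)%N -> p@_l != 0 -> D e l.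
have supM e e' p q : sup e p -> sup e' q -> sup (e + e')%N (p * q).
  move=> hp hq l lJ; rewrite mcoeffM; apply: contraNP => nD.
  apply/eqP/big1 => -[k1 k2] /eqP /= el.
  have el' := etrans (congr1 mdeg el) (mdegD _ _).
  apply/eqP; rewrite mulf_eq0 -[_ || _]negbK negb_or; apply/negP => /andP[h1 h2].
  by apply: nD; rewrite el; apply: DD; [apply: hp|apply: hq] => //; lia.
have sup_c k : sup 1%N (cj J k).
  move=> l lJ h; have lJ0 : (0 < J)%N by lia.
  apply: D1; first by apply: (expo_supp (P := 'X_k) lJ); rewrite /sub mmapX mmap1U.
  by apply: contraNneq h => ->; rewrite cj0.
have sup1 : sup 0%N 1.
  move=> l _; rewrite mcoeff1; case: (l =P 0%MM) => [-> _|_] //.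
  by rewrite eqxx.
have sup_mon mu : sup (mdeg mu) (mmap1 (cj J) mu).
  rewrite /mmap1 mdegE; elim/big_ind2: _ => [//|p1 J1 p2 J2|i _].
    exact: supM.
  elim: (mu i) => [|d IH]; first by rewrite expr0.
  by rewrite exprS -add1n; apply: supM.
rewrite /sub /mmap raddf_sum /=; move=> h.
have [mu hmu] : exists mu, (P@_mu)%:MP * mmap1 (cj J) mu != 0 /\
     ((P@_mu)%:MP * mmap1 (cj J) mu)@_m != 0.
  apply: contrapT => /forallNP H; move/eqP: h; apply; apply: big1_seq => mu _.
  apply/eqP; apply: contrapT => /negP h; apply: (H mu); split => //.
  by apply: contraNneq h => ->; rewrite mcoeff0.
case: hmu => _; rewrite mcoeffCM mulf_eq0 negb_or => /andP[h1 h2].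
apply: (@Dle j (mdeg mu)); last exact: sup_mon h2.
by rewrite leqNgt; apply: contra h1 => hj; rewrite hP.
Qed.

Definition indec m := [/\ expo m, m != 0%MM &
  forall m1 m2, expo m1 -> expo m2 -> m1 != 0%MM -> m2 != 0%MM -> m <> (m1 + m2)%MM].

Lemma ordge2 (P : {mpoly K[E]}) : P@_0 = 0 -> (forall j, P@_U_(j) = 0) -> ordge 2 P.
Proof.
move=> P0 P1 m; case: (posnP (mdeg m)) => [/eqP|m0].
  by rewrite mdeg_eq0 => /eqP ->.
case: (ltngtP (mdeg m) 1%N) => [||e _]; [lia|lia|].
by have /mdeg1P [i /eqP ->] : mdeg m == 1%N by apply/eqP.
Qed.

Section Independence.
Variables (r : nat) (H : 'I_r -> {mpoly K[E]}).
Hypothesis H_rel : forall i, rel_ideal (H i).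
Let lin k (P : 'I_k -> {mpoly K[E]}) : 'M[K]_(k, E) := \matrix_(i, j) (P i)@_U_(j).
Hypothesis H_free : row_free (lin H).

Lemma lin_comb k (P : 'I_k -> {mpoly K[E]}) (y : 'rV[K]_k) j :
  (\sum_i y 0 i *: P i)@_U_(j) = (y *m lin P) 0 j.
Proof.
rewrite raddf_sum mxE; apply: eq_bigr => i _.
by rewrite /= mcoeffZ mxE.
Qed.

(** A linear dependence involving the P i would give, modulo relations, a polynomial of order 2
    whose expansion contains some w^(M i0). Then [filtered_supp] would write M i0 as a sum of two
    non-zero exponents. *)
Lemma indec_free s (M : 'I_s -> 'X_{1..n}) (P : 'I_s -> {mpoly K[E]}) J :
  (forall i, indec (M i)) -> injective M ->
  (forall i, (mdeg (M i) < J)%N) ->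
  (forall i, ordge J (sub J (P i) - 'X_[M i])) ->
  row_free (col_mx (lin H) (lin P)).
Proof.
move=> indM injM MJ hP.
rewrite -kermx_eq0; apply/negPn/negP => /rowV0Pn [v /sub_kermxP].
rewrite -[v]hsubmxK; move: (lsubmx v) (rsubmx v) => x y; rewrite mul_row_col => xy v0.
have y0 : y != 0.
  apply: contra v0 => /eqP y0; move: xy; rewrite y0 mul0mx addr0 => xH.
  have : (x <= kermx (lin H))%MS by apply/sub_kermxP.
  by rewrite (eqP (_ : kermx _ == 0)) ?kermx_eq0 // submx0 => /eqP ->; rewrite row_mx0.
have [i0 yi0] : exists i, y 0 i != 0.
  apply: contrapT => /forallNP h; move/eqP: y0; apply; apply/rowP => i; rewrite mxE.
  by apply/eqP; apply: contrapT => /negP; apply: h.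
have J0 : (0 < J)%N by have := MJ i0; lia.
have Pi0 i : (P i)@_0 = 0.
  rewrite -(sub_mcoeff0 _ J0) (ordge_coef (hP i)) ?mdeg0 // mcoeffX.
  by case: (indM i) => _ /negbTE ->.
pose R := \sum_i y 0 i *: P i + \sum_i x 0 i *: H i.
have R2 : ordge 2 R.
  apply: ordge2.
    rewrite mcoeffD !raddf_sum /= !big1 ?addr0 // => i _.
      by rewrite mcoeffZ (rel0 (H_rel i)) mulr0.
    by rewrite mcoeffZ Pi0 mulr0.
  move=> j; rewrite mcoeffD !lin_comb addrC.
  by have := congr1 (fun A : 'rV_E => A 0 j) xy; rewrite !mxE.
pose D j m := [/\ expo m, (0 < j)%N -> m != 0%MM &
  (1 < j)%N -> exists m1 m2, [/\ expo m1, expo m2, m1 != 0%MM, m2 != 0%MM & m = (m1 + m2)%MM]].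
have expN0 m m' : m != 0%MM -> (m + m')%MM != 0%MM.
  by rewrite mnmD_eq0 negb_and => ->.
have : D 2%N (M i0).
  apply: (filtered_supp _ _ _ _ R2 (MJ i0)).
  - by split => //; apply: expo0.
  - move=> j j' m m' [h1 h2 h3] [h1' h2' h3']; split.
    + exact: expoD.
    + move=> jj; case: (posnP j) => j0; last by apply/expN0/h2.
      by rewrite addmC; apply/expN0/h2'; lia.
    + move=> jj; case: (posnP j) => j0.
        have [|m1 [m2 [e1 e2 n1 n2 ->]]] := h3'; first by lia.
        exists m1, (m + m2)%MM; split => //; first exact: expoD.
          by rewrite addmC; apply: expN0.
        by rewrite addmA [(m + m1)%MM]addmC -addmA.
      case: (posnP j') => j0'.
        have [|m1 [m2 [e1 e2 n1 n2 ->]]] := h3; first by lia.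
        exists m1, (m2 + m')%MM; split => //; first exact: expoD.
          exact: expN0.
        by rewrite addmA.
      by exists m, m'; split => //; [apply: h2|apply: h2'].
  - by move=> j m [h1 h2 h3]; split => // jj; [apply: h2|apply: h3]; lia.
  - by move=> m h1 h2; split.
  rewrite /R subD (_ : (sub J _ + sub J _)@_(M i0) = y 0 i0) //.
  have h1 : (sub J (\sum_i x 0 i *: H i))@_(M i0) = 0.
    apply: (@sub_rel J) => //; apply: ideal_sum rel_ideal_ideal _ => i _.
    by rewrite -mul_mpolyC; case: rel_ideal_ideal => _ _; apply.
  rewrite mcoeffD h1 addr0 sub_sum raddf_sum /= (bigD1 i0) //= big1 => [|i ii].
    rewrite subZ mcoeffZ (ordge_coef (hP i0)) // mcoeffX eqxx mulr1.
    by rewrite addr0.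
  rewrite subZ mcoeffZ (ordge_coef (hP i)) // mcoeffX.
  by rewrite (inj_eq injM) (negbTE ii) mulr0.
case=> _ _ /(_ isT) [m1 [m2 [e1 e2 n1 n2 e]]].
by case: (indM i0) => _ _ /(_ m1 m2 e1 e2 n1 n2).
Qed.

End Independence.

Lemma indec_lift s (M : 'I_s -> 'X_{1..n}) J :
  (forall i, indec (M i)) -> (forall i, (mdeg (M i) < J)%N) ->
  exists P : 'I_s -> {mpoly K[E]}, forall i, ordge J (sub J (P i) - 'X_[M i]).
Proof.
move=> indM MJ; have h i : exists P, ordge J (sub J P - 'X_[M i]).
  by case: (indM i) => /(_ J).
by have [P hP] := choice h; exists P.
Qed.

(** The r relations and the s monomials have independent linear parts in E variables, and E <= r +
    n. *)
Lemma indec_bound s (M : 'I_s -> 'X_{1..n}) :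
  (forall i, indec (M i)) -> injective M -> (s <= n)%N.
Proof.
move=> indM injM; have [r [H [rE Hrel Hfree]]] := c_tangent.
pose J := (\max_i mdeg (M i)).+1.
have MJ i : (mdeg (M i) < J)%N by rewrite ltnS (leq_bigmax i).
have [P hP] := indec_lift indM MJ.
have := indec_free Hrel Hfree indM injM MJ hP.
rewrite -row_leq_rank => h; have := leq_trans h (rank_leq_col _); lia.
Qed.

Lemma indec_enum : exists s (M : 'I_s -> 'X_{1..n}),
  [/\ injective M, forall i, indec (M i), (s <= n)%N &
      forall m, indec m -> exists i, m = M i].
Proof.
pose Q k := `[< exists M : 'I_k -> 'X_{1..n}, injective M /\ forall i, indec (M i) >].
have ex : exists k, Q k by exists 0%N; apply/asboolP; exists (fun=> 0%MM); split; case.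
have bd k : Q k -> (k <= n)%N.
  by move=> /asboolP [M [injM indM]]; apply: indec_bound indM injM.
case: (ex_maxnP ex bd) => s /asboolP [M [injM indM]] maxs.
exists s, M; split => //; first exact: indec_bound indM injM.
move=> m indm; apply: contrapT => /forallNP h.
suff /maxs : Q s.+1 by rewrite ltnn.
apply/asboolP; exists (fun i => if unlift ord0 i is Some j then M j else m); split.
  move=> i j; case: (unliftP ord0 i) => [i' ->|->]; case: (unliftP ord0 j) => [j' ->|->] //=.
  - by move/injM ->.
  - by move=> e; case: (h i').
  - by move=> e; case: (h j').
by move=> i; case: (unliftP ord0 i).
Qed.

Lemma expo_decomp s (M : 'I_s -> 'X_{1..n}) :
  (forall m, indec m -> exists i, m = M i) ->
  forall m, expo m -> exists t, m = mcomb M t.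
Proof.
move=> hM m; have [N] := ubnP (mdeg m); elim: N m => // N IH m mN em.
case: (eqVneq m 0%MM) => [->|m0].
  exists 0%MM; apply: rowz_inj; rewrite rowz_mcomb.
  have rz k : rowz (0 : 'X_{1..k})%MM = 0 by apply/rowP => j; rewrite !mxE mnm0E.
  by rewrite !rz mul0mx.
case: (pselect (indec m)) => [/hM [i ->]|nind]; first by exists U_(i)%MM; rewrite mcomb1.
have [m1 [m2 [e1 e2 n1 n2 e]]] : exists m1 m2,
    [/\ expo m1, expo m2, m1 != 0%MM, m2 != 0%MM & m = (m1 + m2)%MM].
  apply: contrapT => h; apply: nind; split => // m1 m2 e1 e2 n1 n2 e.
  by apply: h; exists m1, m2.
rewrite -!mdeg_eq0 in n1 n2; rewrite e mdegD in mN.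
have [||t1 ht1] := IH m1; [lia|by []|].
have [||t2 ht2] := IH m2; [lia|by []|].
by exists (t1 + t2)%MM; rewrite mcombD -ht1 -ht2.
Qed.

Lemma nonrel_supp Q : ~ rel_ideal Q ->
  exists J m, (mdeg m < J)%N /\ (sub J Q)@_m != 0.
Proof.
move=> nQ; apply: contrapT => h; apply: nQ.
have [a [b [b0 e ba]]] := val_reg Q.
have a0 : a = 0.
  apply: ordge_all => J; have := jet_num ba (subP J Q).
  have : ordge J (b * sub J Q).
    apply: ordgeMl => m mJ; apply/eqP; apply: contrapT => /negP hm.
    by apply: h; exists J, m.
  by move=> h1 h2; have := ordgeB h1 h2; rewrite opprB addrC subrK.
apply: gen_and ba (gen_neq0 (meval_neq0 b0)) => w.
by rewrite a0 meval0 => /eqP; rewrite mulf_eq0 => /orP[->//|/eqP].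
Qed.

(** Writing w_j = P(c) / Q(c), an exponent m occurring in Q(c) gives the exponent m + e_j in
    P(c). *)
Lemma expo_diff j : exists m, expo m /\ expo (m + U_(j))%MM.
Proof.
have [P [Q [nQ hPQ]]] := c_birat j.
have [J [m [mJ hm]]] := nonrel_supp nQ.
have mJ1 : (mdeg (m + U_(j))%MM < J.+1)%N by rewrite mdegD mdeg1; lia.
exists m; split; first exact: expo_supp mJ hm.
apply: (expo_supp (P := P) mJ1).
have hX : jet J.+1 (fun w : 'rV[K]_n => w 0 j) 'X_j.
  have := jet_mpoly J.+1 ('X_j : {mpoly K[n]}); apply: jet_ext.
  by apply: gen_true => w; rewrite mevalXU.
have h := jet_uniq hPQ (jetM hX (subP J.+1 Q)) (subP J.+1 P).
rewrite -(ordge_coef h mJ1) mulrC addmC mcoeffMX.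
by rewrite (ordge_coef (sub_le Q (leqnSn J)) mJ).
Qed.

(** By [expo_diff] the indecomposable exponents generate Z^n, and a generating family of at most n
    vectors is a basis. *)
Lemma expo_basis : exists M : 'I_n -> 'X_{1..n},
  [/\ injective M, forall i, indec (M i), expmx M \in unitmx &
      forall m, expo m -> exists t, m = mcomb M t].
Proof.
have [s [M [injM indM sn hM]]] := indec_enum.
have dec := expo_decomp hM.
have row_ex j : exists x : 'rV[int]_s, x *m expmx M = delta_mx 0 j.
  have [m [/dec [t mt] /dec [t' mt']]] := expo_diff j.
  exists (rowz t' - rowz t); rewrite mulmxBl -!rowz_mcomb -mt -mt' rowzD addrAC subrr add0r.
  by rewrite rowz1.
have [x hx] := choice row_ex.
pose N : 'M[int]_(n, s) := \matrix_j x j.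
have NM : N *m expmx M = 1%:M.
  apply/row_matrixP => j; rewrite row_mul rowK hx.
  by rewrite row1.
have ns : s = n by apply/eqP; rewrite eqn_leq sn (mulmx1_min NM).
move: ns M injM indM hM dec row_ex x hx N NM => -> M injM indM hM dec _ x _ N NM.
exists M; split => //.
by case: (mulmx1_unit NM).
Qed.

Section Basis.
Variable M : 'I_n -> 'X_{1..n}.
Hypotheses (M_inj : injective M) (M_indec : forall i, indec (M i))
  (M_unit : expmx M \in unitmx)
  (M_dec : forall m, expo m -> exists t, m = mcomb M t).

Let mx := (\max_i mdeg (M i))%N.

Lemma mcomb_inj : injective (mcomb M).
Proof.
move=> t t' e; apply: rowz_inj.
by rewrite -[rowz t](mulmxK M_unit) -[rowz t'](mulmxK M_unit) -!rowz_mcomb e.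
Qed.

Lemma mdeg_mcomb t : (mdeg (mcomb M t) <= mdeg t * mx)%N.
Proof.
rewrite mdeg_sum [X in (_ <= X * _)%N]mdegE big_distrl /=; apply: leq_sum => i _.
by rewrite mdegMn mulnC leq_mul2l (leq_bigmax i) orbT.
Qed.

(** The polynomial P in the new coordinates u_i = w^(M i), expressed through w. *)
Definition mono (P : {mpoly K[n]}) := mmap (@mpolyC n K) (fun i => 'X_[M i]) P.

Lemma monoX t : mono 'X_[t] = 'X_[mcomb M t].
Proof. by rewrite /mono mmapX /mmap1 mprodXnE. Qed.

Lemma monoZ a P : mono (a *: P) = a *: mono P.
Proof. by rewrite /mono mmapZ mul_mpolyC. Qed.

Lemma monoD P Q : mono (P + Q) = mono P + mono Q.
Proof. exact: rmorphD. Qed.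

Lemma mcoeff_mono P t : (mono P)@_(mcomb M t) = P@_t.
Proof.
rewrite {1}[P]mpolyE.
have -> : mono (\sum_(m <- msupp P) P@_m *: 'X_[m]) =
   \sum_(m <- msupp P) P@_m *: 'X_[mcomb M m].
  rewrite /mono raddf_sum; apply: eq_bigr => m _ /=.
  by rewrite -/(mono _) monoZ monoX.
rewrite [in RHS](mpolyE P) !raddf_sum; apply: eq_bigr => m _ /=.
by rewrite !mcoeffZ !mcoeffX (inj_eq mcomb_inj).
Qed.

Lemma meval_mono P (w : 'rV[K]_n) : (mono P).@[w 0] = P.@[mexp (expmx M)^T w 0].
Proof.
rewrite /mono meval_mmap; apply: meval_eq => i.
by rewrite mevalX mexpE; apply: eq_bigr => k _; rewrite !mxE.
Qed.

Lemma lift0 (P : 'I_n -> {mpoly K[E]}) J i :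
  (mdeg (M i) < J)%N -> ordge J (sub J (P i) - 'X_[M i]) -> (P i)@_0 = 0.
Proof.
move=> MJ hP; have J0 : (0 < J)%N by lia.
rewrite -(sub_mcoeff0 _ J0) (ordge_coef hP) ?mdeg0 // mcoeffX.
by case: (M_indec i) => _ /negbTE ->.
Qed.

Section Lift.
Variables (P : 'I_n -> {mpoly K[E]}) (J : nat).
Hypotheses (MJ : forall i, (mdeg (M i) < J)%N)
  (hP : forall i, ordge J (sub J (P i) - 'X_[M i])).
Let P0 i : (P i)@_0 = 0 := lift0 (MJ i) (hP i).

Definition approx j (p : {mpoly K[E]}) := exists T H,
  rel_ideal H /\ ordge j (p - mmap (@mpolyC E K) P T - H).

Lemma approx_ordge j p : ordge j p -> approx j p.
Proof.
move=> hp; exists 0, 0; rewrite raddf0 !subr0; split => //.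
by case: rel_ideal_ideal.
Qed.

Lemma approxD j p q : approx j p -> approx j q -> approx j (p + q).
Proof.
move=> [T [H [hH h]]] [T' [H' [hH' h']]]; exists (T + T'), (H + H'); split.
  by case: rel_ideal_ideal => _ D _; apply: D.
rewrite raddfD /=; move: (mmap _ P T) (mmap _ P T') h h' => a b h h'.
have -> : p + q - (a + b) - (H + H') = (p - a - H) + (q - b - H') by ring.
exact: ordgeD.
Qed.

Lemma approxZ j a p : approx j p -> approx j (a *: p).
Proof.
move=> [T [H [hH h]]]; exists (a *: T), (a *: H); split.
  by rewrite -mul_mpolyC; case: rel_ideal_ideal => _ _; apply.
by rewrite mmapZ mul_mpolyC -!scalerBr -mul_mpolyC; apply: ordgeMl.
Qed.

(** The r relations and the n lifts P i have r + n >= E independent linear parts, which therefore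
    span all linear forms. *)
Lemma approx_var k : exists y : 'I_n -> K, exists2 H, rel_ideal H &
  ordge 2 ('X_k - \sum_i y i *: P i - H).
Proof.
have [r [H [rE Hrel Hfree]]] := c_tangent.
have fr := indec_free Hrel Hfree M_indec M_inj MJ hP.
set L := col_mx _ _ in fr.
have fu : row_full L.
  by rewrite /row_full eqn_leq rank_leq_col; apply: leq_trans rE _; rewrite row_leq_rank.
have : ((delta_mx 0 k : 'rV[K]_E) <= L)%MS by apply: submx_full.
case/submxP => v; rewrite -[v]hsubmxK mul_row_col.
move: (lsubmx v) (rsubmx v) => x y e.
exists (y 0), (\sum_i x 0 i *: H i).
  apply: ideal_sum rel_ideal_ideal _ => i _.
  by rewrite -mul_mpolyC; case: rel_ideal_ideal => _ _; apply.
apply: ordge2.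
  rewrite !mcoeffB mcoeffX mnm1_eq0 !raddf_sum /= !big1 ?addr0 // => i _.
    by rewrite mcoeffZ (rel0 (Hrel i)) mulr0 ?oppr0.
  by rewrite mcoeffZ P0 mulr0 ?oppr0.
move=> j; rewrite !mcoeffB !lin_comb mcoeffX.
have := congr1 (fun A : 'rV_E => A 0 j) e; rewrite mxE eqxx mxE eq_mnm1 eq_sym => /= ->.
by ring.
Qed.

(** Replace each variable by its linear approximation A k. Two polynomials of order d that agree
    modulo relations and order d + 1 keep this property, with degrees added, under products. *)
Lemma approx_mono m : approx (mdeg m).+1 'X_[m].
Proof.
have /choice [y hy] := approx_var.
pose A k := \sum_i y k i *: P i.
pose T k : {mpoly K[n]} := \sum_i y k i *: 'X_i.
have AT k : A k = mmap (@mpolyC E K) P (T k).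
  rewrite /A /T raddf_sum; apply: eq_bigr => i _ /=.
  by rewrite mmapZ mmapX mmap1U mul_mpolyC.
have A1 k : ordge 1 (A k).
  apply: ordge_sum => i _; rewrite -mul_mpolyC; apply: ordgeMl.
  by apply/ordge1; apply: P0.
pose Q d p q := [/\ ordge d p, ordge d q & exists2 H, rel_ideal H & ordge d.+1 (p - q - H)].
have QM d d' p q p' q' : Q d p q -> Q d' p' q' -> Q (d + d')%N (p * p') (q * q').
  move=> [hp hq [H hH h]] [hp' hq' [H' hH' h']]; split; [exact: ordgeM|exact: ordgeM|].
  have [_ ID IM] := rel_ideal_ideal.
  exists (p' * H + q * H'); first by apply: ID; apply: IM.
  have -> : p * p' - q * q' - (p' * H + q * H') =
     (p - q - H) * p' + q * (p' - q' - H') by ring.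
  by apply: ordgeD; [rewrite -addSn|rewrite -addnS]; apply: ordgeM.
have Q1 : Q 0%N 1 1.
  split; [exact: ordge0|exact: ordge0|exists 0; first by case: rel_ideal_ideal].
  by rewrite subrr subr0; apply: ordge_z.
have QX k : Q 1%N 'X_k (A k).
  split; [|exact: A1|exact: hy].
  by apply/ordge1; rewrite mcoeffX mnm1_eq0.
have : Q (mdeg m) 'X_[m] (mmap1 A m).
  rewrite mpolyXE_id /mmap1 mdegE.
  elim: (index_enum _) => [|i s IH]; first by rewrite !big_nil.
  rewrite !big_cons; apply: (@QM _ _ _ _ _ _ _ IH).
  elim: (m i) => [|e IHe]; first by rewrite !expr0.
  by rewrite !exprS -add1n; apply: QM.
move=> [_ _ [H hH h]]; exists (mmap1 T m), H; split => //.
rewrite (_ : mmap _ _ _ = mmap1 A m) // /mmap1 rmorph_prod.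
by apply: eq_bigr => k _; rewrite rmorphXn /= AT.
Qed.

Lemma approx_step j p : ordge j p -> approx j.+1 p.
Proof.
move=> hp; rewrite [p]mpolyE; elim/big_ind: _ => [||m _].
- by apply: approx_ordge; apply: ordge_z.
- by move=> a b; apply: approxD.
case: (ltnP (mdeg m) j) => mj.
  by rewrite hp // scale0r; apply: approx_ordge; apply: ordge_z.
apply: approxZ; have [T [H [hH h]]] := approx_mono m.
by exists T, H; split => //; apply: ordgeW h; rewrite ltnS.
Qed.

Lemma approx_all j p : approx j p.
Proof.
elim: j => [|j [T [H [hH /approx_step [T' [H' [hH' h']]]]]]].
  by apply: approx_ordge; apply: ordge0.
exists (T + T'), (H + H'); split; first by case: rel_ideal_ideal => _ D _; apply: D.
rewrite raddfD /=; move: (mmap _ P T) (mmap _ P T') h' => a b.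
by congr ordge; ring.
Qed.

End Lift.

Lemma udeg_supp j J p m : ordge j p -> (mdeg m < J)%N -> (sub J p)@_m != 0 ->
  exists t, m = mcomb M t /\ (j <= mdeg t)%N.
Proof.
apply: (filtered_supp (D := fun j m => exists t, m = mcomb M t /\ (j <= mdeg t)%N)).
- exists 0%MM; split; rewrite ?mdeg0 //; apply: rowz_inj; rewrite rowz_mcomb.
  have rz k : rowz (0 : 'X_{1..k})%MM = 0 by apply/rowP => l; rewrite !mxE mnm0E.
  by rewrite !rz mul0mx.
- move=> i i' l l' [t [-> ht]] [t' [-> ht']]; exists (t + t')%MM.
  by rewrite mcombD mdegD leq_add.
- by move=> i l [t [-> ht]]; exists t; split => //; apply: ltnW.
- move=> l /M_dec [t ->] h; exists t; split => //.
  rewrite lt0n mdeg_eq0; apply: contra h => /eqP ->; apply/eqP; apply: rowz_inj.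
  have rz k : rowz (0 : 'X_{1..k})%MM = 0 by apply/rowP => i; rewrite !mxE mnm0E.
  by rewrite rowz_mcomb !rz mul0mx.
Qed.

(** Compares two filtrations. Modulo relations, p is T(P) plus a remainder R of order j, and by
    [udeg_supp] the expansion of R involves only monomials of degree at least j in the u_i. As [mx]
    bounds the degree in w of each u_i, the terms of T of degree below j are visible below order J,
    and so vanish. *)
Lemma order_control j J p : (j.+1 * mx < J)%N -> ordge J (sub J p) ->
  exists2 H, rel_ideal H & ordge j (p - H).
Proof.
move=> jJ hp.
have MJ i : (mdeg (M i) < J)%N.
  by apply: leq_ltn_trans jJ; rewrite mulSn; apply: leq_trans (leq_addr _ _); apply: (leq_bigmax i).
have [P hP] := indec_lift M_indec MJ.
have [T [H [hH hR]]] := approx_all MJ hP j p.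
pose R := p - mmap (@mpolyC E K) P T - H.
have E1 : ordge J (mono T + sub J R).
  have h1 : ordge J (sub J (mmap (@mpolyC E K) P T) - mono T).
    have -> : sub J (mmap (@mpolyC E K) P T) = mmap (@mpolyC n K) (fun i => sub J (P i)) T.
      by apply: mpoly_ext => w; rewrite !meval_mmap; apply: meval_eq => k; rewrite meval_mmap.
    exact: mmap_congr.
  have h2 := @sub_rel J _ hH.
  rewrite /R !subB; move: (sub J (mmap _ _ _)) (mono T) (sub J p) (sub J H) h1 hp h2.
  move=> a b x y h1 hx hy; have -> : b + (x - a - y) = x - y - (a - b) by ring.
  by apply: ordgeB => //; apply: ordgeB.
have Tj : ordge j T.
  move=> t tj; have tJ : (mdeg (mcomb M t) < J)%N.
    apply: leq_ltn_trans jJ; apply: leq_trans (mdeg_mcomb t) _.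
    by rewrite leq_mul2r (ltnW (ltnW _)) ?orbT // ltnS.
  have := E1 _ tJ; rewrite mcoeffD mcoeff_mono => e.
  apply/eqP; apply: contrapT => /negP Tt.
  have : (sub J R)@_(mcomb M t) != 0.
    by apply: contraNneq Tt => e'; rewrite e' addr0 in e; rewrite e.
  move/(udeg_supp hR tJ) => [t' [/mcomb_inj <-]]; lia.
exists H => //.
have -> : p - H = R + mmap (@mpolyC E K) P T by rewrite /R; ring.
apply: ordgeD => //; apply: mmap_ordge => // i.
exact: lift0 (MJ i) (hP i).
Qed.

(** The monomial is a quotient f / g of polynomials in the chart. Approximating it by its lifts P i
    and using [order_control], one finds f in the ideal generated by g and the relations, up to any
    order. Then [krull] gives q f = r g modulo relations, with q invertible at the origin, and the
    monomial is r / q. *)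
Lemma chart_mono i : exists P Q : {mpoly K[E]}, [/\ Q@_0 != 0, P@_0 = 0 &
  gen (fun w => Q^@w * ('X_[M i]).@[w 0] = P^@w)].
Proof.
have [P0 hP0] := choice c_birat; have [Q0 hQ0] := choice hP0.
pose g := \prod_j Q0 j ^+ M i j; pose f := \prod_j P0 j ^+ M i j.
have ng : ~ rel_ideal g.
  rewrite /g; elim/big_rec: _ => [|j p _ hp].
    by move=> h; have [w /eqP] := gen_ex h; rewrite meval1 oner_eq0.
  apply: not_relM hp => //; elim: (M i j) => [|e IH].
    by move=> h; have [w /eqP] := gen_ex h; rewrite expr0 meval1 oner_eq0.
  by rewrite exprS; apply: not_relM IH; case: (hQ0 j).
have fg : gen (fun w => ('X_[M i]).@[w 0] * g^@w = f^@w).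
  have := gen_all (fun j => (hQ0 j).2); apply: genW => w h.
  rewrite mevalX /g /f !rmorph_prod -big_split; apply: eq_bigr => j _ /=.
  by rewrite !rmorphXn /= -exprMn h.
pose A p := exists H r, rel_ideal H /\ p = H + r * g.
have [I0 ID IM] := rel_ideal_ideal.
have idA : ideal A.
  split; first by exists 0, 0; rewrite mul0r addr0.
    move=> p q [H [r [hH ->]]] [H' [r' [hH' ->]]]; exists (H + H'), (r + r').
    by split; [apply: ID|rewrite mulrDl addrACA].
  move=> s p [H [r [hH ->]]]; exists (s * H), (s * r).
  by split; [apply: IM|rewrite mulrDr mulrA].
have [|q [q0 [H [r [hH e]]]]] := @krull _ _ A f idA.
  move=> j; pose J := (j.+1 * mx).+1.
  have MJ l : (mdeg (M l) < J)%N.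
    by rewrite ltnS mulSn; apply: leq_trans (leq_addr _ _); apply: (leq_bigmax l).
  have [P hP] := indec_lift M_indec MJ.
  have hp : ordge J (sub J (f - g * P i)).
    have h1 : ordge J ('X_[M i] * sub J g - sub J f).
      exact: jet_uniq fg (jetM (jet_mpoly J _) (subP J g)) (subP J f).
    have h2 := hP i; rewrite subB subM.
    move: (sub J f) (sub J g) (sub J (P i)) ('X_[M i] : {mpoly K[n]}) h1 h2 => a b x y h1 h2.
    have -> : a - b * x = - (y * b - a) - b * (x - y) by ring.
    apply: ordgeB; last exact: ordgeMl.
    exact: (idealN (@ordge_ideal _ _ J)).
  have [H hH h] := order_control (ltnSn _) hp.
  exists (H + P i * g); split; first by exists H, (P i).
  by move: h; congr ordge; ring.
exists r, q; split => //; last first.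
  apply: gen_and (not_rel ng) (genI hH fg) => w gw [Hw fw].
  have := congr1 (fun p => p^@w) e; rewrite /= !(mevalM, mevalD) Hw add0r -fw => e'.
  by apply: (mulIf gw); rewrite -mulrA e'.
have hX : regat 0 (fun w : 'rV[K]_n => ('X_[M i]).@[w 0]) 0.
  have <- : ('X_[M i] : {mpoly K[n]}).@[(0 : 'rV[K]_n) 0] = 0.
    by rewrite meval_at0 mcoeffX; case: (M_indec i) => _ /negbTE ->.
  exact: regat_mevalM.
rewrite -(mulr0 q@_0); apply: regat_uniq (val_reg r) _.
apply: regat_ext (regatM (val_reg q) hX).
apply: gen_and (not_rel ng) (genI hH fg) => w gw [Hw fw].
have := congr1 (fun p => p^@w) e; rewrite /= !(mevalM, mevalD) Hw add0r -fw => e'.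
by apply: (mulIf gw); rewrite -mulrA e'.
Qed.

Lemma jet_mono J k : exists G, ordge J (cj J k - mono G).
Proof.
have H (p : {mpoly K[n]}) : (forall m, (mdeg m < J)%N -> p@_m != 0 -> expo m) ->
    exists G, ordge J (p - mono G).
  move=> hp; suff : exists G, ordge J ((\sum_(m <- msupp p) p@_m *: 'X_[m]) - mono G).
    by rewrite -mpolyE.
  elim: (msupp p) => [|m s [G hG]].
    by exists 0; rewrite big_nil /mono raddf0 subrr; apply: ordge_z.
  rewrite big_cons; case: (ltnP (mdeg m) J) => mJ; last first.
    exists G; rewrite -addrA; apply: ordgeD => //; rewrite -mul_mpolyC.
    apply: ordgeMl => l lJ; rewrite mcoeffX; case: eqP => // ml.
    by move: lJ; rewrite -ml ltnNge mJ.
  case: (eqVneq p@_m 0) => [->|pm]; first by exists G; rewrite scale0r add0r.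
  have [t ->] := M_dec (hp m mJ pm).
  exists (p@_(mcomb M t) *: 'X_[t] + G); rewrite monoD monoZ monoX.
  by rewrite opprD addrACA subrr add0r.
apply: H => m mJ hm; apply: (expo_supp (P := 'X_k) mJ).
by rewrite /sub mmapX mmap1U.
Qed.

Lemma M_inv : (expmx M)^T *m (invmx (expmx M))^T = 1%:M.
Proof. by rewrite -trmx_mul mulVmx // trmx1. Qed.

(** In the coordinates u the function [c k] is a quotient a' / b'. Its expansions involve only
    exponents in [expo], so they are polynomials in u by [jet_mono]; hence a' lies in the ideal of
    b' up to any order, and [krull] provides an equation q a' = r b' with q invertible at the
    origin. *)
Lemma chart_coord k : regat 0 (fun u => c k (mexp (invmx (expmx M))^T u)) 0.
Proof.
have [a [b [b0 e ba]]] := c_reg k.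
set A := (invmx (expmx M))^T.
have [D1 h1] := @mexp_pull K n n A pred0 (fun _ _ => False_ind _ \o notF) a.
have [D2 h2] := @mexp_pull K n n A pred0 (fun _ _ => False_ind _ \o notF) b.
pose D := maxn D1 D2.
have [a' ha] := h1 D (leq_maxl _ _); have [b' hb] := h2 D (leq_maxr _ _).
have mexpK (w : 'rV[K]_n) : tor w -> mexp A (mexp (expmx M)^T w) = w.
  by move=> tw; rewrite mexp_mulmx // M_inv mexp1.
have AM : A *m (expmx M)^T = 1%:M by rewrite -trmx_mul mulmxV // trmx1.
have b'0 : b' != 0.
  have [w [tw bw]] := gen_ex (genI (gen_tor K n) (gen_neq0 (meval_neq0 b0))).
  have tu := mexp_tor (expmx M)^T tw.
  have := hb _ (fun k _ => tu k); rewrite mexpK // => hb'.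
  apply: contraTneq isT => b'0; move: hb'; rewrite b'0 meval0 => /esym/eqP.
  rewrite mulf_eq0 (negbTE bw) orbF expf_eq0 => /andP[_ /prodf_eq0 [l _]].
  by rewrite (negbTE (tu l)).
pose I p := exists r, p = r * b'.
have idI : ideal I.
  split; first by exists 0; rewrite mul0r.
    by move=> p q [r ->] [s ->]; exists (r + s); rewrite mulrDl.
  by move=> s p [r ->]; exists (s * r); rewrite mulrA.
have [|q [q0 [r qr]]] := @krull _ _ I a' idI.
  move=> j; have [G hG] := jet_mono (j * mx).+1 k.
  exists (G * b'); split; first by exists G.
  (* In terms of w, a' - G b' is the monomial that cleared the denominators times a - G(u) b, hence
     of order J. A monomial of degree below j in u has degree below J in w, so order J in w implies
     order j in u. *)
  pose J := (j * mx).+1; pose xi := mono (a' - G * b').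
  have xiE : xi = 'X_[mcomb M [multinom D | _ < n]] * (a - mono G * b).
    apply: gen_eq; apply: genW (gen_tor K n) => w tw.
    have tu := mexp_tor (expmx M)^T tw.
    rewrite /xi meval_mono mevalB mevalM ha; last by move=> l _; apply: tu.
    rewrite hb; last by move=> l _; apply: tu.
    rewrite mexpK // [RHS]mevalM [in RHS]mevalB [in RHS]mevalM meval_mono.
    rewrite -monoX meval_mono mevalX.
    have -> : \prod_i mexp (expmx M)^T w 0 i ^+ [multinom D | _ < n] i =
        (\prod_(k0 | ~~ pred0 k0) mexp (expmx M)^T w 0 k0) ^+ D.
      by rewrite -prodrXl; apply: eq_bigr => l _; rewrite mnmE.
    by rewrite mulrBr mulrCA mulrA.
  have xiJ : ordge J xi.
    rewrite xiE; apply: ordgeMl.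
    have h3 := jet_num ba (cjP J k).
    have -> : a - mono G * b = b * (cj J k - mono G) - (b * cj J k - a) by ring.
    by apply: ordgeB => //; apply: ordgeMl.
  move=> t tj; rewrite -mcoeff_mono; apply: xiJ.
  rewrite ltnS; apply: leq_trans (mdeg_mcomb t) _.
  by rewrite leq_mul2r (ltnW tj) orbT.
have qc : gen (fun u : 'rV[K]_n => q.@[u 0] * c k (mexp A u) = r.@[u 0]).
  have MA : (expmx M)^T *m A = 1%:M := M_inv.
  apply: gen_and (gen_pull MA ba) (genI (gen_neq0 b'0) (gen_tor K n)) => u bau [b'u tu].
  have := congr1 (fun p : {mpoly K[n]} => p.@[u 0]) qr; rewrite /= !mevalM.
  rewrite ha; last by move=> l _; apply: tu.
  rewrite -bau mulrCA => e1.
  apply: (mulIf b'u); rewrite -e1 [in LHS]hb; last by move=> l _; apply: tu.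
  by ring.
(* The value at u = 0 is computed at w = 0, which maps to u = 0 because every M i is non-zero. *)
have c0 : r.@[(0 : 'rV[K]_n) 0] / q.@[(0 : 'rV[K]_n) 0] = 0.
  apply: regat_uniq (c_reg k); rewrite -!meval_at0 in q0 *.
  exists (mono r), (mono q).
  have M0 : mexp (expmx M)^T (0 : 'rV[K]_n) = 0.
    apply/rowP => i; rewrite mexpE mxE.
    case: (M_indec i) => _ Mi0 _.
    have [l hl] : exists l, M i l != 0%N.
      apply: contrapT => /forallNP h; move/eqP: Mi0; apply; apply/mnmP => l.
      by rewrite mnm0E; apply/eqP; apply: contrapT => /negP; apply: h.
    by rewrite (bigD1 l) //= !mxE exp0rz eqz_nat (negbTE hl) mul0r.
  rewrite !meval_mono M0; split => //.
    by rewrite mulrC divfK.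
  apply: gen_and (gen_pull AM qc) (gen_tor K n) => w.
  by rewrite !meval_mono => <- tw; rewrite mexpK.
exists r, q; rewrite meval_at0 q0; split => //.
have q0' : q.@[(0 : 'rV[K]_n) 0] != 0 by rewrite meval_at0.
by move/eqP: c0; rewrite mulf_eq0 invr_eq0 (negbTE q0') orbF => /eqP ->; rewrite mulr0.
Qed.

End Basis.

Theorem local_toric_coordinates : exists M : 'I_n -> 'X_{1..n},
  [/\ expmx M \in unitmx,
      forall i, exists P Q : {mpoly K[E]}, [/\ Q@_0 != 0, P@_0 = 0 &
        gen (fun w => Q^@w * ('X_[M i]).@[w 0] = P^@w)] &
      forall k, regat 0 (fun u => c k (mexp (invmx (expmx M))^T u)) 0].
Proof.
have [M [injM indM unitM decM]] := expo_basis.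
exists M; split => //; first exact: chart_mono.
exact: chart_coord.
Qed.

End LocalAlgebra.


(** * Unique factorization of polynomials *)

Section Factorial.
Variable A : idomainType.
Implicit Types a b c : A.

Definition dvd a b := exists c, b = c * a.

Definition prime_elt p := [/\ p != 0, p \isn't a GRing.unit &
  forall a b, dvd p (a * b) -> dvd p a \/ dvd p b].

Lemma dvd_mull a b c : dvd a b -> dvd a (c * b).
Proof. by move=> [d ->]; exists (c * d); rewrite mulrA. Qed.

Lemma prime_dvd_prod p (T : eqType) (s : seq T) (F : T -> A) : prime_elt p ->
  dvd p (\prod_(i <- s) F i) -> exists2 i, i \in s & dvd p (F i).
Proof.
move=> [p0 pu pp]; elim: s => [|i s IH].
  rewrite big_nil => -[c /esym e]; case/negP: pu; apply/unitrPr; exists c.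
  by rewrite mulrC e.
rewrite big_cons => /pp [h|/IH [j js h]]; first by exists i; rewrite ?mem_head.
by exists j; rewrite // inE js orbT.
Qed.

Lemma prime_dvd_unit p u : prime_elt p -> u \is a GRing.unit -> ~ dvd p u.
Proof.
move=> [_ pu _] uu [c e]; case/negP: pu; move: uu; rewrite e unitrM.
by case/andP.
Qed.

Lemma prime_dvd_prime p q : prime_elt p -> prime_elt q -> dvd p q ->
  exists2 u, u \is a GRing.unit & q = u * p.
Proof.
move=> [p0 pu pp] [q0 qu qp] [c e]; exists c => //.
have [[d ed]|[d ed]] : dvd q c \/ dvd q p by apply: qp; exists 1; rewrite mul1r.
  case/negP: pu; apply/unitrPr; exists d; rewrite [p * d]mulrC.
  suff -> : d * p = 1 by [].
  by apply: (mulIf q0); rewrite mul1r {2}e ed mulrAC.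
apply/unitrPr; exists d; rewrite [c * d]mulrC.
suff -> : d * c = 1 by [].
by apply: (mulIf p0); rewrite mul1r -mulrA -e -ed.
Qed.

Definition factorial_dom := forall a, a != 0 -> exists u (s : seq A),
  [/\ u \is a GRing.unit, forall p, p \in s -> prime_elt p & a = u * \prod_(p <- s) p].

Lemma nonunit_prime_dvd a : factorial_dom -> a != 0 -> a \isn't a GRing.unit ->
  exists2 p, prime_elt p & dvd p a.
Proof.
move=> fA a0 au; have [u [[|p s] [uu ps e]]] := fA a a0.
  by case/negP: au; rewrite e big_nil mulr1.
exists p; first by apply: ps; rewrite mem_head.
by exists (u * \prod_(q <- s) q); rewrite e big_cons; ring.
Qed.

End Factorial.

Section Gauss.
Variable A : idomainType.
Hypothesis fA : factorial_dom A.
Implicit Types (f g h : {poly A}) (a b p : A).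

Lemma dvd_polyC p f : (forall i, dvd p f`_i) -> dvd p%:P f.
Proof.
move=> /choice [q hq]; exists (\poly_(i < size f) q i).
apply/polyP => i; rewrite coefMC coef_poly; case: ltnP => hi; first exact: hq.
by rewrite mul0r nth_default.
Qed.

(** Gauss's lemma: if f_i and g_j are the first coefficients not divisible by p, then p does not
    divide the coefficient of index i + j of f g. *)
Lemma prime_polyC p : prime_elt p -> prime_elt p%:P.
Proof.
move=> pp; have [p0 pu pP] := pp; split.
- by rewrite polyC_eq0.
- by rewrite poly_unitE coefC eqxx size_polyC p0.
move=> f g [h e].
case: (pselect (dvd p%:P f)) => [|nf]; first by left.
case: (pselect (dvd p%:P g)) => [|ng]; first by right.
have min (q : {poly A}) : ~ dvd p%:P q ->
    exists i, ~ dvd p q`_i /\ forall j, (j < i)%N -> dvd p q`_j.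
  move=> nq; have ex : exists i, `[< ~ dvd p q`_i >].
    apply: contrapT => /forallNP H; apply: nq; apply: dvd_polyC => i.
    by apply: contrapT => h'; apply: (H i); apply/asboolP.
  case: (ex_minnP ex) => i /asboolP hi mi; exists i; split => // j ji.
  apply: contrapT => h'; have := mi j; rewrite leqNgt ji => H.
  by have := H (asboolT h').
have [i [nfi mi]] := min f nf; have [j [ngj mj]] := min g ng.
have : dvd p (f`_i * g`_j).
  have := congr1 (fun q : {poly A} => q`_(i + j)) e.
  rewrite coefM coefMC.
  have ij : (i < (i + j).+1)%N by rewrite ltnS leq_addr.
  rewrite (bigD1 (Ordinal ij)) //= addKn => E.
  have [c hc] : dvd p (\sum_(k < (i + j).+1 | k != Ordinal ij) f`_k * g`_(i + j - k)).
    elim/big_ind: _ => [|x y [c ->] [d ->]|k ki].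
    - by exists 0; rewrite mul0r.
    - by exists (c + d); rewrite mulrDl.
    case: (ltngtP k i) => [ki'|ki'|ki'].
    - by rewrite mulrC; apply: dvd_mull; apply: mi.
    - by apply: dvd_mull; apply: mj; have := ltn_ord k; lia.
    - by case/eqP: ki; apply: val_inj.
  exists (h`_(i + j) - c); rewrite mulrBl -hc -E.
  by rewrite addrK.
by case/pP.
Qed.

Definition primitive f := forall p, prime_elt p -> ~ dvd p%:P f.

(** The prime factors of a do not divide the primitive f, so they divide g and cancel one at a
    time. *)
Lemma strip_const f g h a : primitive f -> a != 0 -> a%:P * h = g * f ->
  exists g', h = g' * f.
Proof.
move=> pf a0; have [u [s [uu ps ->]]] := fA a0.
elim: s ps g h => [|p s IH] ps g h.
  rewrite big_nil mulr1 => e; exists (u^-1%:P * g).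
  by rewrite -mulrA -e mulrA -polyCM mulVr // mul1r.
rewrite big_cons => e.
have pp : prime_elt p by apply: ps; rewrite mem_head.
have [p0 _ pP] := prime_polyC pp.
have : dvd p%:P (g * f).
  by exists ((u * \prod_(q <- s) q)%:P * h); rewrite -e !polyCM; ring.
case/pP => [[g' e']|/(pf p pp) //].
apply: (IH _ g'); first by move=> q qs; apply: ps; rewrite inE qs orbT.
by apply: (mulIf p0); rewrite -[RHS]mulrAC -e' -e !polyCM; ring.
Qed.

(** A prime constant dividing f divides its leading coefficient, whose number of prime factors
    bounds how often this can be repeated. *)
Lemma primitive_part f : f != 0 -> exists a g,
  [/\ a != 0, primitive g & f = a%:P * g] /\
  exists u (s : seq A), [/\ u \is a GRing.unit, forall p, p \in s -> prime_elt p &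
     a = u * \prod_(p <- s) p].
Proof.
move=> f0; have l0 : lead_coef f != 0 by rewrite lead_coef_eq0.
have [u [s [uu ps e]]] := fA l0.
have [N] := ubnP (size s); elim: N u s uu ps f f0 l0 e => // N IH u s uu ps f f0 l0 e sN.
case: (pselect (primitive f)) => [pf|npf].
  exists 1, f; split; first by rewrite oner_eq0 mul1r.
  by exists 1, [::]; rewrite unitr1 big_nil mulr1.
have [p pp [g eg]] : exists2 p, prime_elt p & dvd p%:P f.
  apply: contrapT => h; apply: npf => p pp hp; apply: h.
  by exists p.
have [p0 pu pP] := pp.
have g0 : g != 0 by apply: contraNneq f0 => g0; rewrite eg g0 mul0r.
have lf : lead_coef f = lead_coef g * p by rewrite eg lead_coefM lead_coefC.
have : dvd p (u * \prod_(q <- s) q) by exists (lead_coef g); rewrite -e lf.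
case/pP => [/(prime_dvd_unit pp uu) //|/(prime_dvd_prod pp) [q qs pq]].
have [v vu ev] := prime_dvd_prime pp (ps q qs) pq.
have perm_s := perm_to_rem qs.
have lg : lead_coef g = (u * v) * \prod_(q <- rem q s) q.
  apply: (mulIf p0); rewrite -lf e (perm_big _ perm_s) /= big_cons ev.
  by ring.
have [||||a [g' [[a0 pg' eg'] [w [t [wu pt et]]]]]] := IH (u * v) (rem q s) _ _ g g0 _ lg.
- by rewrite unitrM uu.
- by move=> r /mem_rem; apply: ps.
- by rewrite lead_coef_eq0.
- by rewrite size_rem //; case: (s) qs sN.
exists (a * p), g'; split; first by rewrite mulf_neq0 // eg eg' polyCM; split=> //; ring.
exists w, (p :: t); split => //; last by rewrite et big_cons; ring.
by move=> r; rewrite inE => /orP[/eqP ->|/pt].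
Qed.

Lemma primitive_dvdl f g h : primitive f -> f = g * h -> primitive g.
Proof.
by move=> pf e p pp [c ec]; apply: (pf p pp); exists (c * h); rewrite e ec; ring.
Qed.

Lemma primitive_const f : primitive f -> f != 0 -> (size f <= 1)%N -> f \is a GRing.unit.
Proof.
move=> pf f0 /size1_polyC e; rewrite e; rewrite e polyC_eq0 in f0.
rewrite poly_unitE size_polyC f0 coefC eqxx /=.
apply: contrapT => /negP nu.
have [p pp [c ec]] := nonunit_prime_dvd fA f0 nu.
by apply: (pf p pp); exists c%:P; rewrite e ec polyCM.
Qed.

(** If f and g are coprime over the fraction field, f divides a constant multiple of h, and
    [strip_const] removes the constant. Otherwise the primitive part of their gcd divides f, hence
    is f up to a unit, and it divides g. *)
Lemma indecomposable_prime f : primitive f -> (1 < size f)%N ->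
  (forall g h, f = g * h -> (size g <= 1)%N \/ (size h <= 1)%N) -> prime_elt f.
Proof.
move=> pf sf indec; have f0 : f != 0 by rewrite -size_poly_gt0; lia.
split => //.
  by rewrite poly_unitE; case: eqP sf => // ->.
move=> g h [k e].
case: (boolP (coprimep f g)) => [cop|].
  right; have : dvdp f (g * h) by rewrite e Pdiv.Idomain.dvdp_mulIr.
  rewrite Pdiv.Idomain.Gauss_dvdpr // => /Pdiv.Idomain.dvdpP [[c q] /= c0 ec].
  by apply: (strip_const pf c0 (g := q)); rewrite mul_polyC.
set d := gcdp f g.
move=> ncop; left.
have d0 : d != 0 by rewrite gcdp_eq0 (negbTE f0).
have sd : (1 < size d)%N.
  by rewrite ltn_neqAle eq_sym size_poly_gt0 d0 andbT.
have [a [d' [[a0 pd' ed] _]]] := primitive_part d0.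
have sd' : size d' = size d by rewrite ed mul_polyC size_scale.
have strip q : dvdp d q -> exists r, q = r * d'.
  move/Pdiv.Idomain.dvdpP => [[c r] /= c0 ec].
  by apply: (strip_const pd' c0 (g := r * a%:P)); rewrite mul_polyC ec ed mulrA.
have [r er] := strip f (Pdiv.Idomain.dvdp_gcdl f g).
have [r' er'] := strip g (Pdiv.Idomain.dvdp_gcdr f g).
have [sr|] := indec _ _ er; last by rewrite sd'; lia.
have r0 : r != 0 by apply: contraNneq f0 => r0; rewrite er r0 mul0r.
have ru := primitive_const (primitive_dvdl pf er) r0 sr.
by exists (r' * r^-1); rewrite -mulrA er mulKr.
Qed.

Lemma primitive_factor f : primitive f -> f != 0 -> exists u (s : seq {poly A}),
  [/\ u \is a GRing.unit, forall q, q \in s -> prime_elt q & f = u * \prod_(q <- s) q].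
Proof.
have [N] := ubnP (size f); elim: N f => // N IH f fN pf f0.
case: (leqP (size f) 1) => sf.
  by exists f, [::]; rewrite big_nil mulr1; split => //; apply: primitive_const.
case: (pselect (exists g h, [/\ f = g * h, (1 < size g)%N & (1 < size h)%N])); last first.
  move=> H; exists 1, [:: f]; rewrite unitr1 big_seq1 mul1r; split => // p.
  rewrite inE => /eqP ->; apply: indecomposable_prime => // g h e.
  case: (leqP (size g) 1) => sg; first by left.
  case: (leqP (size h) 1) => sh; first by right.
  by case: H; exists g, h.
move=> [g [h [e sg sh]]].
have g0 : g != 0 by rewrite -size_poly_gt0; lia.
have h0 : h != 0 by rewrite -size_poly_gt0; lia.
have sgh : size f = (size g + size h).-1 by rewrite e size_mul.
have [|||u [s [uu ps es]]] := IH g; [lia|exact: primitive_dvdl e|by []|].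
have [|||v [t [vu pt et]]] := IH h; [lia|by apply: (primitive_dvdl (h := g) pf); rewrite e mulrC|by []|].
exists (u * v), (s ++ t); split; first by rewrite unitrM uu.
  by move=> p; rewrite mem_cat => /orP[/ps|/pt].
by rewrite e es et big_cat /=; ring.
Qed.

Lemma factorial_poly : factorial_dom {poly A}.
Proof.
move=> f f0; have [a [g [[a0 pg e] [u [s [uu ps es]]]]]] := primitive_part f0.
have g0 : g != 0 by apply: contraNneq f0 => g0; rewrite e g0 mulr0.
have [v [t [vu pt et]]] := primitive_factor pg g0.
exists (u%:P * v), ([seq p%:P | p <- s] ++ t); split.
- by rewrite unitrM vu andbT; apply: rmorph_unit.
- move=> p; rewrite mem_cat => /orP[/mapP [q qs ->]|/pt //].
  by apply/prime_polyC/ps.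
rewrite e es et big_cat big_map /= polyCM rmorph_prod; ring.
Qed.

End Gauss.

Lemma factorial_iso (A B : idomainType) (f : {rmorphism A -> B}) (g : {rmorphism B -> A}) :
  cancel f g -> cancel g f -> factorial_dom A -> factorial_dom B.
Proof.
move=> fg gf fA b b0.
have ga0 : g b != 0 by apply: contraNneq b0 => e; rewrite -[b]gf e rmorph0.
have [u [s [uu ps e]]] := fA _ ga0.
exists (f u), [seq f p | p <- s]; split; first exact: rmorph_unit.
  move=> _ /mapP [p /ps [p0 pu pp] ->]; split.
  - by apply: contraNneq p0 => e'; rewrite -[p]fg e' rmorph0.
  - by apply: contra pu => /(rmorph_unit g); rewrite fg.
  move=> x y [c ec].
  have [|[d ed]|[d ed]] := pp (g x) (g y).
  + by exists (g c); rewrite -rmorphM ec rmorphM fg.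
  + by left; exists (f d); rewrite -[x]gf ed rmorphM.
  + by right; exists (f d); rewrite -[y]gf ed rmorphM.
by rewrite -[b]gf e rmorphM rmorph_prod big_map.
Qed.

Section MpolyFactorial.
Variable K : numFieldType.

Lemma factorial_mpoly n : factorial_dom {mpoly K[n]}.
Proof.
elim: n => [|n IH].
  move=> p p0; exists p, [::]; rewrite big_nil mulr1; split => //.
  rewrite [p]nvar0_mpolyC; apply: rmorph_unit; rewrite unitfE.
  by apply: contraNneq p0 => e; rewrite [p]nvar0_mpolyC e mpolyC0.
exact: (factorial_iso (@join_lastK K n) (@split_lastK K n) (factorial_poly IH)).
Qed.

Lemma mpoly_unitP n (p : {mpoly K[n]}) : p \is a GRing.unit ->
  exists2 c, c != 0 & p = c%:MP.
Proof.
move=> /andP[/eqP e]; rewrite unitfE => c0.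
by exists p@_0.
Qed.

(** Leading coefficient 1 makes associated primes equal. *)
Definition mprime n (q : {mpoly K[n]}) := prime_elt q /\ mleadc q = 1.

Lemma mprime_dvd_eq n (p q : {mpoly K[n]}) : mprime p -> mprime q -> dvd p q -> p = q.
Proof.
move=> [pp lp] [pq lq] /(prime_dvd_prime pp pq) [u /mpoly_unitP [c c0 ->] e].
move: lq; rewrite e mul_mpolyC mleadZ // mcoeffZ lp mulr1 => ->.
by rewrite scale1r.
Qed.

Lemma mfactor n (p : {mpoly K[n]}) : p != 0 -> exists c (s : seq {mpoly K[n]}),
  [/\ c != 0, forall q, q \in s -> mprime q & p = c *: \prod_(q <- s) q].
Proof.
move=> p0; have [u [s [/mpoly_unitP [c c0 ->] ps ->]]] := factorial_mpoly p0.
suff [d [t [d0 pt ->]]] : exists d (t : seq {mpoly K[n]}),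
    [/\ d != 0, forall q, q \in t -> mprime q & \prod_(q <- s) q = d *: \prod_(q <- t) q].
  by exists (c * d), t; rewrite mulf_neq0 // mul_mpolyC scalerA.
elim: s ps => [|q s IH] ps; first by exists 1, [::]; rewrite !big_nil scale1r oner_eq0.
have [|d [t [d0 pt e]]] := IH; first by move=> r rs; apply: ps; rewrite inE rs orbT.
have [q0 qu qp] := ps q (mem_head _ _).
have l0 : mleadc q != 0 by rewrite mleadc_eq0.
exists (mleadc q * d), ((mleadc q)^-1 *: q :: t); split; first by rewrite mulf_neq0.
  move=> r; rewrite inE => /orP[/eqP ->|/pt //].
  split; last by rewrite mleadZ ?invr_eq0 // mcoeffZ mulVf.
  have ass x : dvd ((mleadc q)^-1 *: q) x <-> dvd q x.
    split=> -[y ->].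
      by exists ((mleadc q)^-1 *: y); rewrite -scalerAr scalerAl.
    by exists (mleadc q *: y); rewrite -scalerAr -scalerAl scalerA mulVf ?scale1r.
  split.
  - by rewrite scaler_eq0 invr_eq0 (negbTE l0).
  - by rewrite -mul_mpolyC unitrM negb_and qu orbT.
  by move=> x y /ass /qp [] h; [left|right]; apply/ass.
by rewrite !big_cons e -scalerAr -scalerAl scalerA mulrAC mulfV // mul1r.
Qed.

End MpolyFactorial.


(** * Cones and unimodular bases *)

Definition dot n (x y : 'rV[int]_n) : int := \sum_j x 0 j * y 0 j.

Section Dot.
Variable n : nat.
Implicit Types x y z : 'rV[int]_n.

Lemma dotC x y : dot x y = dot y x.
Proof. by apply: eq_bigr => j _; rewrite mulrC. Qed.

Lemma dotDl x y z : dot (x + y) z = dot x z + dot y z.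
Proof. by rewrite /dot -big_split; apply: eq_bigr => j _; rewrite mxE mulrDl. Qed.

Lemma dotZl a x y : dot (a *: x) y = a * dot x y.
Proof. by rewrite /dot mulr_sumr; apply: eq_bigr => j _; rewrite mxE mulrA. Qed.

Lemma dotDr x y z : dot x (y + z) = dot x y + dot x z.
Proof. by rewrite !(dotC x) dotDl. Qed.

Lemma dotZr a x y : dot x (a *: y) = a * dot x y.
Proof. by rewrite !(dotC x) dotZl. Qed.

Lemma dot_ge0 x : 0 <= dot x x.
Proof. by apply: sumr_ge0 => j _; rewrite -expr2 sqr_ge0. Qed.

Lemma dot_gt0 x : x != 0 -> 0 < dot x x.
Proof.
move=> x0; rewrite lt_neqAle dot_ge0 andbT eq_sym; apply: contra x0.
rewrite psumr_eq0 => [/allP h|j _]; last by rewrite -expr2 sqr_ge0.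
apply/eqP/rowP => j; have := h j (mem_index_enum j).
by rewrite mxE /= mulf_eq0 orbb => /eqP.
Qed.

Lemma dot_suml (I : Type) (r : seq I) (P : pred I) (F : I -> 'rV[int]_n) y :
  dot (\sum_(i <- r | P i) F i) y = \sum_(i <- r | P i) dot (F i) y.
Proof.
apply: (big_morph (fun x => dot x y)) => [u v|]; first exact: dotDl.
by rewrite /dot big1 // => j _; rewrite mxE mul0r.
Qed.

End Dot.

(** Gordan's theorem, by elimination of the last vector b_M. Suppose l is positive on the other
    vectors, b_M . l <= 0, and put c = - b_M . l. A relation between the vectors c b_i + (b_i . l)
    b_M unfolds to one between the b_i. If instead l' is positive on them and c is non-zero, then c
    l' + (b_M . l') l is positive on the b_i and zero on b_M, as is l itself when c = 0. A large
    multiple of such a form plus b_M is positive on all vectors, unless b_M = 0, which is itself a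
    relation. *)
Lemma gordan n (b : nat -> 'rV[int]_n) M :
  (exists l, forall i, (i < M)%N -> 0 < dot (b i) l) \/
  (exists r : nat -> nat, (exists2 i, (i < M)%N & r i != 0%N) /\
     \sum_(i < M) (r i)%:Z *: b i = 0).
Proof.
elim: M b => [|M IH] b; first by left; exists 0.
case: (IH b) => [[l hl]|[r [[i iM ri] e]]]; last first.
  right; exists (fun i => if (i < M)%N then r i else 0%N); split.
    by exists i; [exact: ltnW|rewrite iM].
  rewrite big_ord_recr /= ltnn scale0r addr0 -{}[RHS]e.
  by apply: eq_bigr => j _; rewrite ltn_ord.
case: (ltrP 0 (dot (b M) l)) => [hM|hM].
  left; exists l => j; rewrite ltnS leq_eqVlt => /orP[/eqP ->//|]; exact: hl.
pose c := - dot (b M) l; have c0 : 0 <= c by rewrite oppr_ge0.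
have [[l' hl']|[r [[i iM ri] e]]] := IH (fun i => c *: b i + dot (b i) l *: b M); last first.
  right; exists (fun i => if (i < M)%N then (absz c * r i)%N else
     (\sum_(i < M) r i * absz (dot (b i) l))%N); split.
    exists M => //; rewrite ltnn (bigD1 (Ordinal iM)) //= -lt0n.
    by rewrite ltn_addr // muln_gt0 lt0n ri absz_gt0 gt_eqF // hl.
  have S : (\sum_(i < M) r i * absz (dot (b i) l))%N%:Z =
      \sum_(i < M) (r i)%:Z * dot (b i) l.
    rewrite -natz natr_sum; apply: eq_bigr => j _.
    by rewrite natz PoszM gez0_abs // ltW // hl.
  rewrite big_ord_recr /= ltnn S scaler_suml -big_split -[RHS]e.
  apply: eq_bigr => j _ /=; rewrite ltn_ord PoszM gez0_abs // scalerDr !scalerA.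
  by rewrite [c * _]mulrC.
have [l2 [h2 hM2]] : exists l2, (forall i, (i < M)%N -> 0 < dot (b i) l2) /\ dot (b M) l2 = 0.
  case: (eqVneq c 0) => [c00|c00].
    by exists l; split=> //; apply/eqP; rewrite -oppr_eq0 -/c c00.
  exists (c *: l' + dot (b M) l' *: l); split=> [j jM|].
    have := hl' j jM; rewrite dotDl !dotZl dotDr !dotZr.
    by rewrite [dot (b M) l' * _]mulrC.
  by rewrite dotDr !dotZr -/c mulrC /c mulrN addNr.
case: (eqVneq (b M) 0) => [bM0|bM0].
  right; exists (fun i => (i == M) : nat); split; first by exists M; rewrite ?eqxx.
  rewrite big1 // => j _; case: eqP => [->|_]; last by rewrite scale0r.
  by rewrite bM0 scaler0.
left; pose N := \sum_(i < M) `|dot (b i) (b M)| + 1.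
exists (N *: l2 + b M) => j; rewrite ltnS leq_eqVlt dotDr dotZr => /orP[/eqP ->|jM].
  by rewrite hM2 mulr0 add0r dot_gt0.
have h := h2 j jM.
have hN : `|dot (b j) (b M)| + 1 <= N.
  rewrite /N lerD2r (bigD1 (Ordinal jM)) //= lerDl.
  by apply: sumr_ge0.
have := ler_norm (- dot (b j) (b M)); rewrite normrN => hn.
nia.
Qed.

(** No form in B changes sign on the cone spanned by the rows of L. *)
Definition coherent n (B : seq 'rV[int]_n) (L : 'M[int]_n) :=
  forall b, b \in B -> (forall k, 0 <= dot b (row k L)) \/ (forall k, dot b (row k L) <= 0).

(** Smith normal form of a single row: l is a multiple of a vector that extends to a basis. *)
Lemma primitive_basis n (l : 'rV[int]_n.+1) :
  exists U : 'M[int]_n.+1, U \in unitmx /\ exists2 d, 0 <= d & l = d *: row 0 U.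
Proof.
have [L _ [R unitR [d _ e]]] := int_Smith_normal_form l.
have [c ec] : exists c, l = c *: row 0 R.
  exists (L 0 0 * d`_0); rewrite e; apply/rowP => j; rewrite !mxE (bigD1 0) //= !mxE.
  rewrite big_ord1 mxE /= mulr1n big1 ?addr0 // => k k0.
  rewrite !mxE big_ord1 mxE /= -val_eqE /= eq_sym in k0 *.
  by rewrite (negbTE k0) mulr0 mul0r.
case: (lerP 0 c) => c0; first by exists R; split => //; exists c.
exists (- R); split.
  by rewrite -scaleN1r unitmxZ // unitrN1.
exists (- c); first by rewrite oppr_ge0 ltW.
by rewrite ec; apply/rowP => j; rewrite !mxE mulrNN.
Qed.

(* Adding a large multiple of the previous vectors to the next one makes the  *)
(* sign of a linear form on the basis that of its first nonzero value.        *)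
Lemma coherent_refine n (B : seq 'rV[int]_n) (U : 'M[int]_n) : U \in unitmx ->
  exists L : 'M[int]_n, [/\ L \in unitmx, coherent B L &
    forall k : 'I_n, k = 0%N :> nat -> row k L = row k U].
Proof.
move=> unitU.
(* N exceeds every |b . u_k| by at least 2. The values x_k of b on the new basis satisfy x_(k+1) = N
   x_k + b . u_(k+1), so once x_k is non-zero its sign persists. *)
pose N : int := \sum_(b <- B) \sum_k `|dot b (row k U)| + 2.
pose T : 'M[int]_n := \matrix_(k, l) (if (l <= k)%N then N ^+ (k - l) else 0).
have detT : \det T = 1.
  rewrite det_trig; last by apply/is_trig_mxP => i j ij; rewrite mxE leqNgt ij.
  by rewrite big1 // => i _; rewrite mxE leqnn subnn expr0.
exists (T *m U); split.
- by rewrite unitmxE det_mulmx detT mul1r -unitmxE.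
- move=> b bB.
  have dE k : dot b (row k (T *m U)) = \sum_(l < n) T k l * dot b (row l U).
    rewrite row_mul mulmx_sum_row dotC dot_suml; apply: eq_bigr => l _.
    by rewrite dotZl dotC !mxE.
  have bd k : `|dot b (row k U)| + 2 <= N.
    rewrite lerD2r (big_rem b) //= -[leLHS]addr0 lerD //; last first.
      by apply: sumr_ge0 => c _; apply: sumr_ge0.
    by rewrite (bigD1 k) //= -[leLHS]addr0 lerD // sumr_ge0.
  have rec (k : nat) (k1 : (k.+1 < n)%N) (k0 : (k < n)%N) :
     dot b (row (Ordinal k1) (T *m U)) =
       N * dot b (row (Ordinal k0) (T *m U)) + dot b (row (Ordinal k1) U).
    rewrite !dE mulr_sumr.
    rewrite (bigD1 (Ordinal k1)) //= [T _ _]mxE leqnn subnn expr0 mul1r addrC; congr (_ + _).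
    rewrite [RHS](bigD1 (Ordinal k1)) //= [T _ (Ordinal k1)]mxE /= ltnn mul0r mulr0 add0r.
    apply: eq_bigr => l; rewrite -val_eqE /= => lk; rewrite !mxE /=.
    case: (ltngtP l k.+1) lk => // lk _; rewrite ?ltnS in lk.
      by rewrite lk mulrA -exprS subSn.
    by rewrite leqNgt (ltnW lk) /= mul0r mulr0.
  have N2 : 2 <= N.
    by rewrite lerDr; apply: sumr_ge0 => c _; apply: sumr_ge0.
  have sgn (k : nat) (kn : (k < n)%N) :
     [\/ forall (l : nat) (ln : (l < n)%N), (l <= k)%N -> dot b (row (Ordinal ln) (T *m U)) = 0,
         (1 <= dot b (row (Ordinal kn) (T *m U)) /\
          forall (l : nat) (ln : (l < n)%N), (l <= k)%N -> 0 <= dot b (row (Ordinal ln) (T *m U)))|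
         (dot b (row (Ordinal kn) (T *m U)) <= -1 /\
          forall (l : nat) (ln : (l < n)%N), (l <= k)%N -> dot b (row (Ordinal ln) (T *m U)) <= 0)].
    elim: k kn => [|k IH] kn.
      have all (P : int -> Prop) : P (dot b (row (Ordinal kn) (T *m U))) ->
         forall (l : nat) (ln : (l < n)%N), (l <= 0)%N -> P (dot b (row (Ordinal ln) (T *m U))).
        move=> h l ln; rewrite leqn0 => /eqP l0; subst l.
        by rewrite (bool_irrelevance ln kn).
      case: (ltrgtP 0 (dot b (row (Ordinal kn) (T *m U)))) => h.
      + by apply: Or32; split; [lia|apply: (all (fun x => 0 <= x)); apply: ltW].
      + by apply: Or33; split; [lia|apply: (all (fun x => x <= 0)); apply: ltW].
      + by apply: Or31; apply: (all (fun x => x = 0)).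
    have k0 := ltnW kn; have := rec k kn k0; have := bd (Ordinal kn).
    have all (P : int -> Prop) : P (dot b (row (Ordinal kn) (T *m U))) ->
         (forall (l : nat) (ln : (l < n)%N), (l <= k)%N -> P (dot b (row (Ordinal ln) (T *m U)))) ->
         forall (l : nat) (ln : (l < n)%N), (l <= k.+1)%N -> P (dot b (row (Ordinal ln) (T *m U))).
      move=> h h' l ln; rewrite leq_eqVlt => /orP[/eqP l0|]; last exact: h'.
      by subst l; rewrite (bool_irrelevance ln kn).
    case: (IH k0) => [h|[h h']|[h h']] hb E.
    + rewrite (h k k0) // mulr0 add0r in E.
      case: (ltrgtP 0 (dot b (row (Ordinal kn) (T *m U)))) => h1.
      * apply: Or32; split; [lia|apply: (all (fun x => 0 <= x)); first exact: ltW].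
        by move=> l ln lk; rewrite h.
      * apply: Or33; split; [lia|apply: (all (fun x => x <= 0)); first exact: ltW].
        by move=> l ln lk; rewrite h.
      * by apply: Or31; apply: (all (fun x => x = 0)).
    + apply: Or32; have h1 : 1 <= dot b (row (Ordinal kn) (T *m U)) by rewrite E; nia.
      by split => //; apply: (all (fun x => 0 <= x)) => //; lia.
    + apply: Or33; have h1 : dot b (row (Ordinal kn) (T *m U)) <= -1 by rewrite E; nia.
      by split => //; apply: (all (fun x => x <= 0)) => //; lia.
  case: (posnP n) => [n0|n0]; first by left=> k; have := ltn_ord k; rewrite {2}n0.
  have lk (k : 'I_n) : (k <= n.-1)%N by have := ltn_ord k; lia.
  have oE (k : 'I_n) : Ordinal (ltn_ord k) = k by apply: val_inj.
  have nn : (n.-1 < n)%N by rewrite prednK.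
  case: (sgn n.-1 nn) => [h|[_ h]|[_ h]]; [left|left|right] => k; rewrite -(oE k).
  + by rewrite h // lk.
  + exact/h/lk.
  + exact/h/lk.
- move=> k k0; apply/rowP => j; rewrite !mxE (bigD1 k) //= mxE leqnn subnn expr0 mul1r.
  rewrite big1 ?addr0 // => i; rewrite -val_eqE /= k0 => i0.
  by rewrite mxE k0 leqn0 (negbTE i0) mul0r.
Qed.

(** Refine a basis whose first vector spans the ray of l; the refinement keeps this vector. *)
Lemma coherent_cone n (B : seq 'rV[int]_n) (l : 'rV[int]_n) :
  exists L : 'M[int]_n, [/\ L \in unitmx, coherent B L &
    exists2 x : 'rV[int]_n, forall k, 0 <= x 0 k & l = x *m L].
Proof.
case: n B l => [|n] B l.
  have [L [uL cL _]] := coherent_refine B (unitmx1 _ 0).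
  exists L; split => //; exists 0; first by case.
  by apply/rowP; case.
have [U [uU [d d0 e]]] := primitive_basis l.
have [L [uL cL rL]] := coherent_refine B uU.
exists L; split => //; exists (d *: delta_mx 0 0).
  by move=> k; rewrite !mxE mulr_ge0.
by rewrite -scalemxAl -rowE rL.
Qed.

(* If two unimodular cones are such that C expresses the rays of the first   *)
(* through those of the second, then, on the faces Z and Z', the rays agree.  *)
Lemma ray_match n (L L' : 'M[int]_n) (Z Z' : pred 'I_n) :
  L \in unitmx -> L' \in unitmx ->
  (forall k l, Z k -> 0 <= (L *m invmx L') k l) ->
  (forall k l, Z k -> ~~ Z' l -> (L *m invmx L') k l = 0) ->
  (forall k l, Z' l -> 0 <= (L' *m invmx L) l k) ->
  (forall k l, Z' l -> ~~ Z k -> (L' *m invmx L) l k = 0) ->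
  forall k, Z k -> exists2 l, Z' l & row k L = row l L'.
Proof.
move=> uL uL' C0 CZ C'0 CZ' k Zk.
set C := L *m invmx L' in C0 CZ; set C' := L' *m invmx L in C'0 CZ'.
have CC' : C *m C' = 1%:M.
  by rewrite /C /C' mulmxA -[_ *m _ *m L']mulmxA mulVmx // mulmx1 mulmxV.
have C'L : C' *m L = L' by rewrite /C' -mulmxA mulVmx // mulmx1.
have pos l k' : 0 <= C k l * C' l k'.
  case: (boolP (Z' l)) => Zl; last by rewrite CZ // mul0r.
  by rewrite mulr_ge0 ?C0 ?C'0.
have sumE k' : \sum_l C k l * C' l k' = (k == k')%:R.
  by have := congr1 (fun A : 'M_n => A k k') CC'; rewrite mxE mxE.
have [l hl] : exists l, C k l * C' l k != 0.
  apply: contrapT => /forallNP h; have := sumE k; rewrite eqxx big1 // => l _.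
  by apply/eqP; apply: contrapT => /negP; apply: h.
have Zl : Z' l by apply: contraNT hl => Zl; rewrite CZ // mul0r.
exists l => //.
have C'l k' : k' != k -> C' l k' = 0.
  move=> kk; have := sumE k'; rewrite eq_sym (negbTE kk) (bigD1 l) //= => /eqP.
  rewrite paddr_eq0 ?sumr_ge0 // mulf_eq0 => /andP[/orP[/eqP h|/eqP //] _].
  by move: hl; rewrite h mul0r eqxx.
have C'k : C' l k = 1.
  have h1 := sumE k; rewrite eqxx (bigD1 l) //= in h1.
  have h2 : 0 <= \sum_(i < n | i != l) C k i * C' i k by apply: sumr_ge0.
  have h3 : 0 <= C k l := C0 k l Zk; have h4 : 0 <= C' l k := C'0 k l Zl.
  move/eqP: hl; move: h1 h2 h3 h4; rewrite mulr1n.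
  move: (C k l) (C' l k) (\sum_(i < n | i != l) _) => x y S h1 h2 h3 h4 h5.
  have y0 : y <> 0 by move=> e; rewrite e mulr0 in h5.
  have x0 : x <> 0 by move=> e; rewrite e mul0r in h5.
  have : y <= x * y by rewrite ler_peMl //; lia.
  by lia.
apply/rowP => j; rewrite -{1}C'L !mxE (bigD1 k) //= C'k mul1r big1 ?addr0 // => i ik.
by rewrite C'l // mul0r.
Qed.


(** * Places of the field of rational functions *)

Lemma poly_ideal_root (K : closedFieldType) (I : {poly K} -> Prop) :
  I 0 -> (forall p q, I p -> I q -> I (p + q)) -> (forall r p, I p -> I (r * p)) ->
  (exists v, forall p, I p -> root p v) \/ I 1.
Proof.
move=> I0 ID IM; case: (pselect (exists p, I p /\ p != 0)) => [[p [Ip p0]]|H]; last first.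
  left; exists 0 => p Ip; suff -> : p = 0 by rewrite root0.
  by apply/eqP; apply: contrapT => /negP p0; apply: H; exists p.
have ex : exists d, `[< exists q, [/\ I q, q != 0 & size q = d] >].
  by exists (size p); apply/asboolP; exists p.
case: (ex_minnP ex) => d /asboolP [q [Iq q0 <-]] min.
have dv r : I r -> q %| r.
  move=> Ir; apply/eqP; apply: contrapT => /eqP m0.
  have Im : I (r %% q).
    have -> : r %% q = r + (- (r %/ q)) * q by rewrite {2}(divp_eq r q) mulNr addrC addKr.
    by apply: ID => //; apply: IM.
  have := min (size (r %% q)); rewrite leqNgt ltn_modp q0 /=.
  by move=> h; have := h (asboolT (ex_intro _ _ (And3 Im m0 erefl))).
case: (eqVneq (size q) 1%N) => [s1|s1].
  right; have [c c0 e] : exists2 c, c != 0 & q = c%:P by apply/size_poly1P; rewrite s1.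
  have -> : 1 = (c^-1)%:P * q by rewrite e -polyCM mulVf.
  exact: IM.
left; have [v rv] := closed_rootP q s1; exists v => r /dv.
by move/dvdpP => [s ->]; rewrite rootM rv orbT.
Qed.

Section Places.
Variables (K : numClosedFieldType) (n : nat).
Local Notation F := ('rV[K]_n -> K).
Implicit Types (f g b : F) (A : F -> Prop) (phi : F -> K).

(* A place defined on the subring A of the field of rational functions;      *)
(* functions count up to generic equality.                                    *)
Definition place A phi :=
  [/\ forall c, A (fun=> c) /\ phi (fun=> c) = c,
      forall f g, A f -> A g -> A (fun w => f w + g w) /\
        phi (fun w => f w + g w) = phi f + phi g,
      forall f g, A f -> A g -> A (fun w => f w * g w) /\
        phi (fun w => f w * g w) = phi f * phi g &
      forall f g, gen (fun w => f w = g w) -> A f -> A g /\ phi g = phi f].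

Section Extend.
Variables (A : F -> Prop) (phi : F -> K).
Hypothesis pA : place A phi.

Let Ac c : A (fun=> c). Proof. by case: pA => /(_ c) []. Qed.
Let phic c : phi (fun=> c) = c. Proof. by case: pA => /(_ c) []. Qed.

Lemma place_sum d (f : 'I_d -> F) : (forall i, A (f i)) ->
  A (fun w => \sum_i f i w) /\ phi (fun w => \sum_i f i w) = \sum_i phi (f i).
Proof.
have [_ hD _ hE] := pA.
elim: d f => [|d IH] f hf.
  have [h1 h2] : A (fun w : 'rV[K]_n => \sum_(i < 0) f i w) /\
      phi (fun w => \sum_(i < 0) f i w) = phi (fun=> 0).
    by apply: hE (Ac 0); apply: gen_true => w; rewrite big_ord0.
  by rewrite big_ord0 h2 phic.
have [h1 h2] := IH (fun i => f (lift ord0 i)) (fun i => hf _).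
have [h3 h4] := hD _ _ (hf ord0) h1.
have [h5 h6] : A (fun w => \sum_(i < d.+1) f i w) /\
      phi (fun w => \sum_(i < d.+1) f i w) =
      phi (fun w => f ord0 w + \sum_i f (lift ord0 i) w).
  by apply: hE h3; apply: gen_true => w; rewrite big_ord_recl.
by split => //; rewrite h6 h4 h2 big_ord_recl.
Qed.

Variable b : F.

(* f is a polynomial in b over A that reduces to P over the residue field.    *)
Definition red f (P : {poly K}) := exists (p : 'rV[K]_n -> {poly K}) d,
  [/\ forall w, (size (p w) <= d)%N,
      forall i, A (fun w => (p w)`_i) /\ phi (fun w => (p w)`_i) = P`_i &
      gen (fun w => f w = (p w).[b w])].

Lemma red_base f : A f -> red f (phi f)%:P.
Proof.
move=> Af; exists (fun w => (f w)%:P), 1%N; split.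
- by move=> w; apply: size_polyC_leq1.
- move=> i; rewrite coefC; have [_ _ _ hE] := pA; case: eqP => [->|/eqP i0].
    by apply: hE Af; apply: gen_true => w; rewrite coefC.
  rewrite -[in X in _ = X](phic 0).
  by apply: hE (Ac 0); apply: gen_true => w; rewrite coefC (negbTE i0).
- by apply: gen_true => w; rewrite hornerC.
Qed.

Lemma red_var : red b 'X.
Proof.
exists (fun=> 'X), 2%N; split => [w|i|]; first by rewrite size_polyX.
  by split; [apply: Ac|rewrite phic].
by apply: gen_true => w; rewrite hornerX.
Qed.

Lemma redD f g P Q : red f P -> red g Q -> red (fun w => f w + g w) (P + Q).
Proof.
move=> [p [d [h1 h2 h3]]] [q [e [g1 g2 g3]]].
exists (fun w => p w + q w), (maxn d e); split.
- by move=> w; apply: leq_trans (size_polyD _ _) _; rewrite geq_max !leq_max h1 g1 orbT.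
- move=> i; have [_ hD _ hE] := pA; have [a1 a2] := h2 i; have [b1 b2] := g2 i.
  rewrite coefD -a2 -b2; have [c1 c2] := hD _ _ a1 b1; rewrite -c2.
  by apply: hE c1; apply: gen_true => w; rewrite coefD.
- by apply: gen_and h3 g3 => w -> ->; rewrite hornerD.
Qed.

Lemma redM f g P Q : red f P -> red g Q -> red (fun w => f w * g w) (P * Q).
Proof.
move=> [p [d [h1 h2 h3]]] [q [e [g1 g2 g3]]].
exists (fun w => p w * q w), (d + e)%N; split.
- move=> w; apply: leq_trans (size_polyMleq _ _) _.
  by apply: leq_trans (leq_pred _) _; rewrite leq_add.
- move=> i; have [_ hD hM hE] := pA.
  have hs (j : 'I_i.+1) : A (fun w => (p w)`_j * (q w)`_(i - j)) /\
     phi (fun w => (p w)`_j * (q w)`_(i - j)) = P`_j * Q`_(i - j).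
    have [a1 a2] := h2 j; have [b1 b2] := g2 (i - j)%N.
    by rewrite -a2 -b2; apply: hM.
  have [c1 c2] := place_sum (fun j => (hs j).1).
  rewrite coefM -(eq_bigr _ (fun j _ => (hs j).2)) -c2.
  by apply: hE c1; apply: gen_true => w; rewrite coefM.
- by apply: gen_and h3 g3 => w -> ->; rewrite hornerM.
Qed.

Lemma red_ext f g P : gen (fun w => f w = g w) -> red f P -> red g P.
Proof.
move=> fg [p [d [h1 h2 h3]]]; exists p, d; split => //.
by apply: gen_and fg h3 => w <-.
Qed.

Lemma red_poly P : exists g, red g P.
Proof.
elim/poly_ind: P => [|P c [g hg]].
  exists (fun=> 0); have := red_base (Ac 0); by rewrite phic.
exists (fun w => g w * b w + c); apply: redD; first exact: redM red_var.
by rewrite -{2}(phic c); apply: red_base.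
Qed.

Lemma redB f g P Q : red f P -> red g Q -> red (fun w => f w - g w) (P - Q).
Proof.
move=> hf hg; have := redD hf (redM (red_base (Ac (-1))) hg).
rewrite phic polyCN polyC1 mulN1r; apply: red_ext.
by apply: gen_true => w; rewrite mulN1r.
Qed.

(** The extension sends b to v; the hypothesis makes this independent of the way an element is
    written as a polynomial in b. *)
Lemma place_adjoin v : (forall P, red (fun=> 0) P -> root P v) ->
  exists A' phi', [/\ place A' phi', forall f, A f -> A' f /\ phi' f = phi f & A' b].
Proof.
move=> hv; pose A' f := exists P, red f P.
pose phi' f := if pselect (A' f) is left h then (projT1 (cid h)).[v] else 0.
have uniq f P Q : red f P -> red f Q -> P.[v] = Q.[v].
  move=> hP hQ; apply/eqP; rewrite -subr_eq0 -hornerN -hornerD; apply: hv.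
  by apply: red_ext (redB hP hQ); apply: gen_true => w; rewrite subrr.
have phiE f P : red f P -> A' f /\ phi' f = P.[v].
  move=> h; split; first by exists P.
  rewrite /phi'; case: pselect => [h'|[]]; last by exists P.
  exact: uniq (projT2 (cid h')) h.
have phiA f : A f -> A' f /\ phi' f = phi f.
  by move=> /red_base /phiE; rewrite hornerC.
exists A', phi'; split => //; last by have [] := phiE _ _ red_var.
split.
- by move=> c; have := phiA _ (Ac c); rewrite phic.
- move=> f g [P hP] [Q hQ]; have [_ ->] := phiE _ _ hP; have [_ ->] := phiE _ _ hQ.
  by have := phiE _ _ (redD hP hQ); rewrite hornerD.
- move=> f g [P hP] [Q hQ]; have [_ ->] := phiE _ _ hP; have [_ ->] := phiE _ _ hQ.
  by have := phiE _ _ (redM hP hQ); rewrite hornerM.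
- move=> f g fg [P hP]; have [_ ->] := phiE _ _ hP.
  exact: phiE (red_ext fg hP).
Qed.

(** The reductions of the relations satisfied by b form an ideal of K[X]. A common root is a
    possible value of b; without one, the ideal contains 1. *)
Lemma place_adjoin_or : (exists A' phi',
    [/\ place A' phi', forall f, A f -> A' f /\ phi' f = phi f & A' b]) \/
  red (fun=> 0) 1.
Proof.
have [|||[v hv]|h] := @poly_ideal_root K (red (fun=> 0)).
- by have := red_base (Ac 0); rewrite phic.
- move=> p q hp hq; apply: red_ext (redD hp hq).
  by apply: gen_true => w; rewrite addr0.
- move=> r p hp; have [g hg] := red_poly r; apply: red_ext (redM hg hp).
  by apply: gen_true => w; rewrite mulr0.
- by left; apply: place_adjoin hv.
- by right.
Qed.

End Extend.

Section Valuative.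
Variables (A : F -> Prop) (phi : F -> K).
Hypothesis pA : place A phi.

(** A relation of degree at most d for b whose reduction is the constant 1: the obstruction to
    giving b a finite value. *)
Definition low b d := exists p : 'rV[K]_n -> {poly K},
  [/\ forall w, (size (p w) <= d.+1)%N, forall i, A (fun w => (p w)`_i),
      forall i, phi (fun w => (p w)`_i) = (i == 0%N)%:R &
      gen (fun w => (p w).[b w] = 0)].

Lemma low0 b : ~ low b 0.
Proof.
move=> [p [sp Ap ph h]]; have [hc _ _ hE] := pA.
have [_ e] : A (fun=> 0) /\ phi (fun=> 0) = phi (fun w => (p w)`_0).
  apply: hE (Ap 0%N); apply: genW h => w.
  by rewrite [p w]size1_polyC // hornerC coefC.
by have := hc 0; rewrite e ph => -[_ /eqP]; rewrite oner_eq0.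
Qed.

Lemma low_red b : red A phi b (fun=> 0) 1 -> exists d, low b d.
Proof.
move=> [p [d [sp hp h]]]; exists d, p; split.
- by move=> w; apply: leq_trans (sp w) _.
- by move=> i; case: (hp i).
- by move=> i; case: (hp i) => _ ->; rewrite coef1.
- by apply: genW h => w <-.
Qed.

(** Chevalley's argument. Let p and q be the relations of b and of 1/b, p having the larger degree
    d.+1. The combination of p with the multiple by b^(d+1) of q, weighted by q_0 and by the top
    coefficient of p, has no term of degree d.+1 and still reduces to 1. Thus the total degree
    drops. *)
Lemma low_inverse N b d b' d' : (d + d' < N)%N -> gen (fun w => b w * b' w = 1) ->
  low b d -> low b' d' -> False.
Proof.
elim: N b d b' d' => // N IH b d b' d'.
wlog dd : b d b' d' / (d' <= d)%N => [W|].
  case: (leqP d' d) => dd; first exact: W.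
  move=> dN bb l l'; apply: (W b' d' b d) => //; [exact: ltnW|by rewrite addnC|].
  by apply: genW bb => w; rewrite mulrC.
case: d' dd => [|d'] dd dN bb l l'; first exact: low0 l'.
case: d dd dN l => // d dd dN l.
have lt : (d + d'.+1 < N)%N by lia.
apply: (IH b d b' d'.+1 lt bb _ l').
have [hc hD hM hE] := pA.
have [p [sp Ap ph h]] := l; have [q [sq Aq qh h']] := l'.
pose r k w := (q w)`_0 * (p w)`_k + (-1 * (p w)`_d.+1) * (q w)`_(d.+1 - k).
have hr k : A (r k) /\ phi (r k) = (k == 0%N)%:R - (d.+1 == 0)%:R * ((d.+1 - k)%N == 0%N)%:R.
  have [a1 a2] := hM _ _ (Aq 0%N) (Ap k).
  have [b1 b2] := hM _ _ (hc (-1)).1 (Ap d.+1).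
  have [c1 c2] := hM _ _ b1 (Aq (d.+1 - k)%N).
  have [d1 d2] := hD _ _ a1 c1; split => //.
  rewrite /r d2 a2 c2 b2 (hc (-1)).2 !ph !qh eqxx mul1r /=.
  by rewrite !mulr0 !mul0r subr0 addr0.
exists (fun w => \poly_(k < d.+1) r k w); split.
- by move=> w; apply: size_poly.
- move=> k; case: (ltnP k d.+1) => kd.
    have [|//] := hE (r k) (fun w => (\poly_(k < d.+1) r k w)`_k) _ (hr k).1.
    by apply: gen_true => w; rewrite coef_poly kd.
  have [|//] := hE (fun=> 0) (fun w => (\poly_(k < d.+1) r k w)`_k) _ (hc 0).1.
  by apply: gen_true => w; rewrite coef_poly ltnNge kd.
- move=> k; case: (ltnP k d.+1) => kd.
    have [|_ ->] := hE (r k) (fun w => (\poly_(k < d.+1) r k w)`_k) _ (hr k).1.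
      by apply: gen_true => w; rewrite coef_poly kd.
    by rewrite (hr k).2 mul0r subr0.
  have [|_ ->] := hE (fun=> 0) (fun w => (\poly_(k < d.+1) r k w)`_k) _ (hc 0).1.
    by apply: gen_true => w; rewrite coef_poly ltnNge kd.
  by rewrite (hc 0).2; case: k kd.
apply: gen_and h (genI h' bb) => w pw [qw bw].
have b0 : b w != 0 by apply: contraTneq isT => b0; move/eqP: bw; rewrite b0 mul0r eq_sym oner_eq0.
have b'E : b' w = (b w)^-1 by apply: (mulfI b0); rewrite bw mulfV.
rewrite horner_poly.
have -> : \sum_(i < d.+1) r i w * b w ^+ i = \sum_(i < d.+2) r i w * b w ^+ i.
  rewrite [RHS]big_ord_recr /= /r subnn.
  by rewrite mulN1r [X in X * b w ^+ _](_ : _ = 0) ?mul0r ?addr0 //; ring.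
transitivity ((q w)`_0 * (p w).[b w] - (p w)`_d.+1 * b w ^+ d.+1 * (q w).[b' w]); last first.
  by rewrite pw qw !mulr0 subr0.
rewrite (horner_coef_wide _ (sp w)) (@horner_coef_wide _ d.+2); last first.
  by apply: leq_trans (sq w) _.
rewrite [in X in _ - X](reindex_inj rev_ord_inj) /= mulr_sumr mulr_sumr -sumrB.
apply: eq_bigr => i _; rewrite /r subSS b'E.
have i2 : (i <= d.+1)%N by rewrite -ltnS.
have -> : b w ^+ d.+1 = b w ^+ i * b w ^+ (d.+1 - i) by rewrite -exprD subnKC.
have bi : b w ^+ (d.+1 - i) != 0 by rewrite expf_neq0.
by rewrite exprVn; field.
Qed.

End Valuative.

Lemma place_valuative A phi b : place A phi -> gen (fun w => b w != 0) ->
  exists A' phi', [/\ place A' phi', forall f, A f -> A' f /\ phi' f = phi f &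
    A' b \/ A' (fun w => (b w)^-1)].
Proof.
move=> pA b0.
case: (place_adjoin_or pA b) => [[A' [phi' [h1 h2 h3]]]|h].
  by exists A', phi'; split => //; left.
case: (place_adjoin_or pA (fun w => (b w)^-1)) => [[A' [phi' [h1 h2 h3]]]|h'].
  by exists A', phi'; split => //; right.
have [d l] := low_red h; have [d' l'] := low_red h'.
case: (low_inverse pA (ltnSn (d + d')) _ l l').
by apply: genW b0 => w bw; rewrite mulfV.
Qed.

Lemma place_exp A phi f m : place A phi -> A f ->
  A (fun w => f w ^+ m) /\ phi (fun w => f w ^+ m) = phi f ^+ m.
Proof.
move=> [hC hD hM hE] Af; elim: m => [|m [Am em]].
  have [A1 e1] := hC 1; have [|A0 e0] := hE _ (fun w => f w ^+ 0) _ A1.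
    by apply: gen_true => w; rewrite expr0.
  by rewrite e0 e1 expr0.
have [A1 e1] := hM _ _ Af Am; have [|A0 e0] := hE _ (fun w => f w ^+ m.+1) _ A1.
  by apply: gen_true => w; rewrite exprS.
by rewrite e0 e1 em exprS.
Qed.

Lemma place_meval A phi k (f : 'I_k -> F) (P : {mpoly K[k]}) : place A phi ->
  (forall i, A (f i)) -> A (fun w => P.@[fun i => f i w]) /\
    phi (fun w => P.@[fun i => f i w]) = P.@[fun i => phi (f i)].
Proof.
move=> [hC hD hM hE] Af; elim/mpoly_rind: P => [c|i|p q [Ap ep] [Aq eq]|p q [Ap ep] [Aq eq]].
- have [A1 e1] := hC c; rewrite mevalC.
  have [|A0 e0] := hE _ (fun w => c%:MP.@[fun i => f i w]) _ A1; last by rewrite e0.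
  by apply: gen_true => w; rewrite mevalC.
- rewrite mevalXU; have [|A0 e0] := hE _ (fun w => ('X_i).@[fun i => f i w]) _ (Af i).
    by apply: gen_true => w; rewrite mevalXU.
  by rewrite e0.
- have [A1 e1] := hD _ _ Ap Aq.
  have [|A0 e0] := hE _ (fun w => (p + q).@[fun i => f i w]) _ A1.
    by apply: gen_true => w; rewrite mevalD.
  by rewrite e0 e1 ep eq mevalD.
- have [A1 e1] := hM _ _ Ap Aq.
  have [|A0 e0] := hE _ (fun w => (p * q).@[fun i => f i w]) _ A1.
    by apply: gen_true => w; rewrite mevalM.
  by rewrite e0 e1 ep eq mevalM.
Qed.

Lemma place_localize A phi u : place A phi -> A u -> phi u != 0 ->
  gen (fun w => u w != 0) ->
  exists A' phi', [/\ place A' phi', forall f, A f -> A' f /\ phi' f = phi f &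
    A' (fun w => (u w)^-1)].
Proof.
move=> pA Au u0 gu; have [hC hD hM hE] := pA.
pose rep f m := A (fun w => f w * u w ^+ m).
pose A' f := exists m, rep f m.
have um m : A (fun w => u w ^+ m) /\ phi (fun w => u w ^+ m) = phi u ^+ m by apply: place_exp.
have shift f m m' : rep f m -> (m <= m')%N -> rep f m' /\
    phi (fun w => f w * u w ^+ m') = phi (fun w => f w * u w ^+ m) * phi u ^+ (m' - m).
  move=> r mm; have [Au1 eu1] := um (m' - m)%N; have [A1 e1] := hM _ _ r Au1.
  have [|A2 e2] := hE _ (fun w => f w * u w ^+ m') _ A1.
    by apply: gen_true => w; rewrite -mulrA -exprD subnKC.
  by split => //; rewrite e2 e1 eu1.
pose phi' f := if pselect (A' f) is left h then
  phi (fun w => f w * u w ^+ projT1 (cid h)) / phi u ^+ projT1 (cid h) else 0.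
have phiE f m : rep f m -> phi' f = phi (fun w => f w * u w ^+ m) / phi u ^+ m.
  move=> r; rewrite /phi'; case: pselect => [h|[]]; last by exists m.
  case: (cid h) => m1 r1 /=.
  have [_ e1] := shift _ _ _ r1 (leq_addr m m1); have [_ e2] := shift _ _ _ r (leq_addl m1 m).
  apply/eqP; rewrite eqr_div ?expf_neq0 //; apply/eqP.
  by move: e1; rewrite e2 addKn addnK => ->.
exists A', phi'; split.
- split.
  + move=> c; have r : rep (fun=> c) 0%N.
      have [Ac ec] := hC c; rewrite /rep; apply: (proj1 (hE _ _ _ Ac)).
      by apply: gen_true => w; rewrite expr0 mulr1.
    split; first by exists 0%N.
    rewrite (phiE _ _ r) expr0 divr1; have [Ac ec] := hC c.
    rewrite -[RHS]ec; apply: (proj2 (hE _ _ _ Ac)).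
    by apply: gen_true => w; rewrite expr0 mulr1.
  + move=> f g [m r] [m' r'].
    have [r1 e1] := shift _ _ _ r (leq_addr m' m); have [r2 e2] := shift _ _ _ r' (leq_addl m m').
    have [A3 e3] := hD _ _ r1 r2.
    have [|r3 e4] := hE _ (fun w => (f w + g w) * u w ^+ (m + m')) _ A3.
      by apply: gen_true => w; rewrite mulrDl.
    split; first by exists (m + m')%N.
    by rewrite (phiE _ _ r1) (phiE _ _ r2) (@phiE _ (m + m')%N r3) e4 e3 mulrDl.
  + move=> f g [m r] [m' r'].
    have [A3 e3] := hM _ _ r r'.
    have [|r3 e4] := hE _ (fun w => (f w * g w) * u w ^+ (m + m')) _ A3.
      by apply: gen_true => w; rewrite exprD mulrACA.
    split; first by exists (m + m')%N.
    by rewrite (phiE _ _ r) (phiE _ _ r') (@phiE _ (m + m')%N r3) e4 e3 exprD invfM mulrACA.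
  + move=> f g fg [m r].
    have [|r1 e1] := hE _ (fun w => g w * u w ^+ m) _ r; first by apply: genW fg => w ->.
    by split; [exists m|rewrite (phiE _ _ r) (phiE _ m r1) e1].
- move=> f Af.
  have [|r e1] := hE _ (fun w => f w * u w ^+ 0) _ Af.
    by apply: gen_true => w; rewrite expr0 mulr1.
  by split; [exists 0%N|rewrite (phiE _ 0%N r) e1 expr0 divr1].
- exists 1%N; have [A1 _] := hC 1; apply: (proj1 (hE _ _ _ A1)).
  by apply: genW gu => w uw; rewrite expr1 mulVf.
Qed.

(** When 1/b receives a non-zero value, [place_localize] makes b finite; so in the second
    alternative the value can be taken to be 0. *)
Lemma place_valuative_seq (T : eqType) (s : seq T) (b : T -> F) A phi :
  place A phi -> (forall i, gen (fun w => b i w != 0)) ->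
  exists A' phi', [/\ place A' phi', forall f, A f -> A' f /\ phi' f = phi f &
    forall i, i \in s -> A' (b i) \/
      A' (fun w => (b i w)^-1) /\ phi' (fun w => (b i w)^-1) = 0].
Proof.
move=> pA b0; elim: s => [|i s [A1 [phi1 [p1 h1 g1]]]].
  by exists A, phi; split.
suff [A2 [phi2 [p2 h2 g2]]] : exists A2 phi2,
    [/\ place A2 phi2, forall f, A1 f -> A2 f /\ phi2 f = phi1 f &
     A2 (b i) \/ A2 (fun w => (b i w)^-1) /\ phi2 (fun w => (b i w)^-1) = 0].
  exists A2, phi2; split => //.
    by move=> f /h1 [/h2 [a1 a2] a3]; split => //; rewrite a2.
  move=> j; rewrite inE => /orP[/eqP -> //|/g1 [h|[h e]]]; [left|right].
    by have [] := h2 _ h.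
  by have [? ->] := h2 _ h.
have [A2 [phi2 [p2 h2 [g2|g2]]]] := place_valuative p1 (b0 i).
  by exists A2, phi2; split => //; left.
case: (eqVneq (phi2 (fun w => (b i w)^-1)) 0) => [e0|ne].
  by exists A2, phi2; split => //; right.
have [|A3 [phi3 [p3 h3 g3]]] := place_localize p2 g2 ne.
  by apply: genW (b0 i) => w; rewrite invr_eq0.
exists A3, phi3; split => //.
  by move=> f /h2 [/h3 [a1 a2] a3]; split => //; rewrite a2.
left; have [_ _ _ hE] := p3; apply: (proj1 (hE _ _ _ g3)).
by apply: gen_true => w; rewrite invrK.
Qed.

End Places.


(** * The Zariski topology *)

Section Zariski.
Variable R : realType.
Local Notation K := (R[i]).
Implicit Types X Y : atlas R.

Lemma zopenP X (U : set X) : zopen U <->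
  forall (i : index X) x, U x -> dom i x ->
    exists P : {mpoly K[edim i]}, P.@[chart i x 0] != 0 /\
      forall y, dom i y -> P.@[chart i y 0] != 0 -> U y.
Proof.
split=> [H i x Ux dx|H i].
  have [A [S ->] hA] := H i.
  have : ~ (~` U) x by [].
  move=> /(contra_not (proj2 (hA x dx))) /existsNP [P /not_implyP [SP /eqP Px]].
  exists P; split => // y dy Py; apply: contrapT => Uy.
  by have /(_ _ SP) /eqP := proj1 (hA y dy) Uy; rewrite (negbTE Py).
exists [set v | forall P : {mpoly K[edim i]},
  (forall y, dom i y -> ~ U y -> P.@[chart i y 0] = 0) -> P.@[v 0] = 0].
  by exists [set P : {mpoly K[edim i]} | forall y, dom i y -> ~ U y -> P.@[chart i y 0] = 0].
move=> x dx; split=> [nUx P|h Ux]; first exact.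
have [P [Px hP]] := H i x Ux dx; move/eqP: Px; apply; apply: h => y dy nUy.
by apply/eqP; apply: contrapT => /negP Py; apply: nUy; apply: hP.
Qed.

Lemma zopenT X : zopen ([set: X]).
Proof. by apply/zopenP => i x _ _; exists 1; rewrite meval1 oner_eq0. Qed.

Lemma zopenI X (U W : set X) : zopen U -> zopen W -> zopen (U `&` W).
Proof.
move=> /zopenP hU /zopenP hW; apply/zopenP => i x [Ux Wx] dx.
have [P [Px hP]] := hU i x Ux dx; have [Q [Qx hQ]] := hW i x Wx dx.
exists (P * Q); rewrite mevalM mulf_neq0 //; split => // y dy.
by rewrite mevalM mulf_eq0 negb_or => /andP[Py Qy]; split; [apply: hP|apply: hQ].
Qed.

Lemma zopen_local X (U : set X) :
  (forall x, U x -> exists W, [/\ zopen W, W x & W `<=` U]) -> zopen U.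
Proof.
move=> H; apply/zopenP => i x Ux dx.
have [W [/zopenP hW Wx WU]] := H x Ux.
have [P [Px hP]] := hW i x Wx dx; exists P; split => // y dy Py.
exact/WU/hP.
Qed.

Lemma zopen_all X (I : finType) (U : I -> set X) :
  (forall i, zopen (U i)) -> zopen [set x | forall i, U i x].
Proof.
move=> H; apply/zopenP => j x Ux dx.
have /choice [P hP] i : exists P : {mpoly K[edim j]}, P.@[chart j x 0] != 0 /\
    forall y, dom j y -> P.@[chart j y 0] != 0 -> U i y.
  by have /zopenP := H i; apply.
exists (\prod_i P i); split.
  by rewrite rmorph_prod; apply/prodf_neq0 => i _; case: (hP i).
move=> y dy; rewrite rmorph_prod => /prodf_neq0 h i.
by case: (hP i) => _; apply => //; apply: h.
Qed.

Section Regular.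
Variables (X : atlas R) (U : set X).
Implicit Types f g : X -> K.

Lemma reg_sub (W : set X) f : zopen W -> W `<=` U -> regular_on U f -> regular_on W f.
Proof.
move=> oW WU [oU H]; split => // i x Wx dx.
have [p [q [qx h]]] := H i x (WU _ Wx) dx; exists p, q; split => // y Wy.
exact/h/WU.
Qed.

Lemma reg_eq f g : (forall x, U x -> f x = g x) -> regular_on U f -> regular_on U g.
Proof.
move=> e [oU H]; split => // i x Ux dx.
have [p [q [qx h]]] := H i x Ux dx; exists p, q; split => // y Uy dy qy.
by rewrite -e // h.
Qed.

Lemma reg_const c : zopen U -> regular_on U (fun=> c).
Proof.
move=> oU; split => // i x Ux dx; exists c%:MP, 1; rewrite meval1 oner_eq0.
by split => // y _ _ _; rewrite mevalC meval1 divr1.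
Qed.

Lemma regD f g : regular_on U f -> regular_on U g -> regular_on U (fun x => f x + g x).
Proof.
move=> [oU H] [_ H']; split => // i x Ux dx.
have [p [q [qx h]]] := H i x Ux dx; have [p' [q' [qx' h']]] := H' i x Ux dx.
exists (p * q' + p' * q), (q * q'); rewrite mevalM mulf_neq0 //; split => // y Uy dy.
rewrite mevalM mulf_eq0 negb_or => /andP[qy qy'].
by rewrite h // h' // addf_div // mevalD !mevalM.
Qed.

Lemma regM f g : regular_on U f -> regular_on U g -> regular_on U (fun x => f x * g x).
Proof.
move=> [oU H] [_ H']; split => // i x Ux dx.
have [p [q [qx h]]] := H i x Ux dx; have [p' [q' [qx' h']]] := H' i x Ux dx.
exists (p * p'), (q * q'); rewrite mevalM mulf_neq0 //; split => // y Uy dy.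
rewrite mevalM mulf_eq0 negb_or => /andP[qy qy'].
by rewrite h // h' // mulf_div !mevalM.
Qed.

Lemma reg_nz_open f : regular_on U f -> zopen (U `&` [set x | f x != 0]).
Proof.
move=> [/zopenP oU H]; apply/zopenP => i x [Ux fx] dx.
have [P [Px hP]] := oU i x Ux dx; have [p [q [qx h]]] := H i x Ux dx.
exists (P * (p * q)); split.
  rewrite !mevalM !mulf_neq0 //; move: fx; rewrite /= h // mulf_eq0 negb_or.
  by case/andP.
move=> y dy; rewrite !mevalM !mulf_eq0 !negb_or => /andP[Py /andP[py qy]].
have Uy := hP y dy Py; split => //=.
by rewrite h // mulf_neq0 // invr_eq0.
Qed.

Lemma regV f : (forall x, U x -> f x != 0) -> regular_on U f ->
  regular_on U (fun x => (f x)^-1).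
Proof.
move=> f0 [oU H]; split => // i x Ux dx.
have [p [q [qx h]]] := H i x Ux dx.
have px : p.@[chart i x 0] != 0.
  by have := f0 x Ux; rewrite h // mulf_eq0 negb_or => /andP[].
exists (q * q), (p * q); rewrite mevalM mulf_neq0 //; split => // y Uy dy.
rewrite mevalM mulf_eq0 negb_or => /andP[py qy].
by rewrite h // invf_div !mevalM -mulf_div divff // mulr1.
Qed.

Lemma reg_local f : (forall x, U x -> exists W, [/\ W x, W `<=` U & regular_on W f]) ->
  regular_on U f.
Proof.
move=> H; split.
  by apply: zopen_local => x /H [W [Wx WU [oW _]]]; exists W.
move=> i x Ux dx; have [W [Wx WU [/zopenP oW h]]] := H x Ux.
have [P [Px hP]] := oW i x Wx dx; have [p [q [qx hq]]] := h i x Wx dx.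
exists (P * p), (P * q); rewrite mevalM mulf_neq0 //; split => // y Uy dy.
rewrite mevalM mulf_eq0 negb_or => /andP[Py qy].
have Wy := hP y dy Py; by rewrite hq // !mevalM -mulf_div divff // mul1r.
Qed.

Lemma reg_meval k (f : 'I_k -> X -> K) (P : {mpoly K[k]}) : zopen U ->
  (forall j, regular_on U (f j)) -> regular_on U (fun x => P.@[fun j => f j x]).
Proof.
move=> oU H; elim/mpoly_rind: P => [c|i|p q hp hq|p q hp hq].
- by apply: reg_eq (reg_const c oU) => x _; rewrite mevalC.
- by apply: reg_eq (H i) => x _; rewrite mevalXU.
- by apply: reg_eq (regD hp hq) => x _; rewrite mevalD.
- by apply: reg_eq (regM hp hq) => x _; rewrite mevalM.
Qed.

End Regular.

Section Variety.
Variable X : variety R.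

Lemma open_meet (U W : set X) : zopen U -> zopen W -> U !=set0 -> W !=set0 ->
  (U `&` W) !=set0.
Proof.
move=> oU oW [x Ux] [y Wy]; apply: contrapT => /forallNP H.
have [_ irr] := variety_irreducible X.
have [|h|h] := irr (~` U) (~` W) oU oW.
- move=> z _; apply: contrapT => /not_orP [/contrapT Uz /contrapT Wz].
  by apply: (H z).
- exact: (h x I Ux).
- exact: (h y I Wy).
Qed.

(** Openness of a chart domain is derived from the regularity of its coordinates, so it is not
    granted for a chart into a space of dimension 0. *)
Definition good (i : index X) := zopen (dom i : set X).

(** If all charts at x have dimension 0, the set {x} is open and closed, so X = {x} by
    irreducibility and every domain containing x is open. *)
Lemma good_chart (x : X) : exists i, good i /\ dom i x.
Proof.
have [cov inj _ reg] := variety_prevariety X.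
case: (pselect (exists i : index X, dom i x /\ (0 < edim i)%N)) => [[i [dx e0]]|H].
  by exists i; split => //; case: (reg i (Ordinal e0)).
have [i dx] := cov x; exists i; split => //.
have H0 j y : dom j x -> dom j y -> y = x :> X.
  move=> jx jy; apply: (inj j) => //; apply/rowP => k.
  by case: H; exists j; split => //; apply: leq_ltn_trans (ltn_ord k).
have o1 : zopen ([set x] : set X).
  apply/zopenP => j y -> jx; exists 1; rewrite meval1 oner_eq0; split => // z jz _.
  exact: H0 jx jz.
have o2 : zopen (~` [set x] : set X).
  apply/zopenP => j y yx jy; exists 1; rewrite meval1 oner_eq0; split => // z jz _ zx.
  by apply: yx; apply: H0 jy; rewrite -zx.
have [_ irr] := variety_irreducible X.
have : [set: X] `<=` [set x].
  have [||h|h] := irr [set x] (~` [set x]) _ o1.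
  - by rewrite /zopen setCK in o2.
  - by move=> y _; case: (pselect (y = x)); [left|right].
  - by [].
  - by case: (h x I).
move=> all; apply: zopen_local => y dy; exists setT; split => //.
  exact: zopenT.
by move=> z _; rewrite (all z I).
Qed.

Lemma reg_chart (i : index X) k : regular_on (dom i : set X) (fun x => chart i x 0 k).
Proof. by case: (variety_prevariety X). Qed.

Lemma reg_eq_dense (U W : set X) f g : regular_on U f -> regular_on U g ->
  zopen W -> W !=set0 -> (forall x, U x -> W x -> f x = g x) ->
  forall x, U x -> f x = g x.
Proof.
move=> rf rg oW W0 e x Ux; apply/eqP; rewrite -subr_eq0; apply: contrapT => /negP fg.
have rfg : regular_on U (fun x => f x + -1 * g x).
  by apply: regD => //; apply: regM => //; apply: reg_const; case: rf.
have [|y [[Uy /= hy] Wy]] := open_meet (reg_nz_open rfg) oW _ W0.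
  by exists x; split => //=; rewrite mulN1r.
by move: hy; rewrite mulN1r e // subrr eqxx.
Qed.

End Variety.
End Zariski.


(** * Centers of monomial maps *)

Lemma gen_neq_regat (K : numFieldType) n (w0 : 'rV[K]_n) f v :
  regat w0 f v -> v != 0 -> gen (fun w => f w != 0).
Proof.
move=> [a [b [b0 e H]]] v0.
have a0 : a != 0 by apply: (@meval_neq0 _ _ w0); rewrite -e mulf_neq0.
by apply: gen_and H (gen_neq0 a0) => w <-; rewrite mulf_eq0 negb_or => /andP[].
Qed.

Lemma regat_eval (K : numFieldType) n (w0 : 'rV[K]_n) f v (a b : {mpoly K[n]}) :
  regat w0 f v -> gen (fun w : 'rV[K]_n => b.@[w 0] * f w = a.@[w 0]) ->
  b.@[w0 0] * v = a.@[w0 0].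
Proof.
move=> hf hg; apply: (@regat_uniq _ _ w0 (fun w => b.@[w 0] * f w)).
  exact: regatM (regat_mevalM w0 b) hf.
apply: regat_ext (regat_mevalM w0 a); apply: genW hg => w -> //.
Qed.

Lemma clear_denom (K : numFieldType) n k (a b : 'I_k -> {mpoly K[n]}) (P : {mpoly K[k]}) :
  exists D0, forall D, (D0 <= D)%N -> exists P' : {mpoly K[n]}, forall w : 'rV[K]_n,
    (forall i, (b i).@[w 0] != 0) ->
    P'.@[w 0] = (\prod_i (b i).@[w 0]) ^+ D * P.@[fun i => (a i).@[w 0] / (b i).@[w 0]].
Proof.
elim/mpoly_rind: P => [c|i|p q [D1 H1] [D2 H2]|p q [D1 H1] [D2 H2]].
- exists 0%N => D _; exists ((\prod_i b i) ^+ D * c%:MP) => w _.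
  by rewrite mevalM !mevalC rmorphXn rmorph_prod.
- exists 1%N => -[//|D] _.
  exists ((\prod_i b i) ^+ D * ((\prod_(j | j != i) b j) * a i)) => w hw.
  rewrite mevalXU !mevalM rmorphXn !rmorph_prod /= exprSr -!mulrA; congr (_ * _).
  rewrite [in RHS](bigD1 i) //=; move: (\prod_(j | j != i) _) (hw i) => p h.
  by field.
- exists (D1 + D2)%N => D HD.
  have [|r1 E1] := H1 D; first by lia.
  have [|r2 E2] := H2 D; first by lia.
  by exists (r1 + r2) => w Hw; rewrite !mevalD E1 // E2 // mulrDr.
- exists (D1 + D2)%N => D HD.
  have [//|r1 E1] := H1 D1 _.
  have [|r2 E2] := H2 (D - D1)%N; first by lia.
  exists (r1 * r2) => w Hw; rewrite !mevalM E1 // E2 //.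
  by rewrite mulrACA -exprD subnKC //; lia.
Qed.

Lemma scale_pull (K : numFieldType) q (t : 'rV[K]_q) (p : {mpoly K[q]}) :
  exists p' : {mpoly K[q]}, forall w : 'rV[K]_q, p'.@[w 0] = p.@[(map2_mx *%R t w) 0].
Proof. by exists (rescale t p) => w; apply: meval_rescale. Qed.

Record toric_structure (R : realType) (X : variety R) n (e : 'rV[R[i]]_n -> X)
  (a : 'rV[R[i]]_n * X -> X) (V : set X) (e' : X -> 'rV[R[i]]_n) : Prop := ToricStructure {
  ts_open : zopen V;
  ts_e : @morphism_on R (affine_space R n) X (@torus R n) e;
  ts_e' : @morphism_on R X (affine_space R n) V e';
  ts_eK : forall z, tor z -> V (e z) /\ e' (e z) = z;
  ts_e'K : forall x, V x -> tor (e' x) /\ e (e' x) = x;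
  ts_a : @morphism_on R (atlas_prod (affine_space R n) X) X
    [set tx | torus tx.1] a;
  ts_a1 : forall x, a (const_mx 1, x) = x;
  ts_aA : forall s t x, tor s -> tor t -> a (s, a (t, x)) = a (map2_mx *%R s t, x);
  ts_aE : forall s t, tor s -> tor t -> a (s, e t) = e (map2_mx *%R s t) }.

Section ToricCenters.
Variables (R : realType) (X : variety R) (n : nat).
Local Notation K := (R[i]).
Variables (e : 'rV[K]_n -> X) (a : 'rV[K]_n * X -> X) (V : set X) (e' : X -> 'rV[K]_n).
Hypothesis TS : toric_structure e a V e'.

Let oV : zopen V. Proof. by case: TS. Qed.
Let eM : @morphism_on R (affine_space R n) X (@torus R n) e.
Proof. by case: TS. Qed.
Let e'M : @morphism_on R X (affine_space R n) V e'. Proof. by case: TS. Qed.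
Let eK z : tor z -> V (e z) /\ e' (e z) = z. Proof. by case: TS => _ _ _ /(_ z). Qed.
Let e'K x : V x -> tor (e' x) /\ e (e' x) = x.
Proof. by case: TS => _ _ _ _ /(_ x). Qed.
Let aM : @morphism_on R (atlas_prod (affine_space R n) X) X
  [set tx | torus tx.1] a. Proof. by case: TS. Qed.
Let aE s t : tor s -> tor t -> a (s, e t) = e (map2_mx *%R s t).
Proof. by case: TS => _ _ _ _ _ _ _ _ /(_ s t). Qed.

Lemma meet_V (W : set X) : zopen W -> W !=set0 -> exists z, tor z /\ W (e z).
Proof.
move=> oW W0; have [|x [Vx Wx]] := open_meet oV oW _ W0.
  have t1 : tor (const_mx 1 : 'rV[K]_n) by move=> k; rewrite mxE oner_eq0.
  by exists (e (const_mx 1)); case: (eK t1).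
by have [tx ex] := e'K Vx; exists (e' x); rewrite ex.
Qed.

Lemma e_open (W : set X) z : zopen W -> tor z -> W (e z) ->
  exists Q : {mpoly K[n]}, Q.@[z 0] != 0 /\ forall z' : 'rV[K]_n, Q.@[z' 0] != 0 -> tor z' /\ W (e z').
Proof.
move=> oW tz Wz; have /zopenP := eM.1 W oW.
move=> /(_ tt z (conj tz Wz) I) [Q [Qz h]]; exists Q; split => // z' Qz'.
by have [] := h z' I Qz'.
Qed.

Lemma e_gen (W : set X) : zopen W -> W !=set0 -> gen (fun z => tor z /\ W (e z)).
Proof.
move=> oW W0; have [z [tz Wz]] := meet_V oW W0.
have [Q [Qz h]] := e_open oW tz Wz; exists Q => //.
exact: meval_neq0 Qz.
Qed.

Lemma e_regat (W : set X) f z : regular_on W f -> tor z -> W (e z) ->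
  regat z (f \o e) (f (e z)).
Proof.
move=> rf tz Wz; have oW := rf.1.
have [_ /(_ tt z (conj tz Wz) I) [p [q [qz h]]]] := eM.2 W f rf.
have E z' : tor z' -> W (e z') -> q.@[z' 0] != 0 -> q.@[z' 0] * f (e z') = p.@[z' 0].
  by move=> tz' Wz' qz'; have /= -> := h z' (conj tz' Wz') I qz'; rewrite mulrC divfK.
exists p, q; split => //; first exact: E.
have W0 : W !=set0 by exists (e z).
apply: gen_and (e_gen oW W0) (gen_neq0 (meval_neq0 qz)) => z' [tz' Wz'] qz'.
exact: E.
Qed.

Lemma e_rat (W : set X) f z : regular_on W f -> tor z -> W (e z) ->
  exists p q : {mpoly K[n]}, q.@[z 0] != 0 /\
    forall z' : 'rV[K]_n, tor z' -> W (e z') -> q.@[z' 0] * f (e z') = p.@[z' 0].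
Proof.
move=> rf tz Wz; have [p [q [qz _ hg]]] := e_regat rf tz Wz.
exists p, q; split => // z' tz' Wz'.
exact: regat_eval (e_regat rf tz' Wz') hg.
Qed.

Lemma e'_coord j : regular_on V (fun x => e' x 0 j).
Proof.
have h : @regular_on R (affine_space R n) setT (fun z => z 0 j).
  split; first exact: zopenT.
  move=> i z _ _; exists 'X_j, 1; rewrite meval1 oner_eq0; split => // y _ _ _.
  by rewrite mevalXU meval1 divr1.
have := e'M.2 _ _ h; apply: reg_sub => // x Vx; by split.
Qed.

Lemma prod_eval k (t : 'rV[K]_n) (P : {mpoly K[n + k]}) :
  exists Q : {mpoly K[k]}, forall v : 'rV[K]_k, Q.@[v 0] = P.@[(row_mx t v) 0].
Proof.
exists (mmap (@mpolyC k K) (fun i => match split i with inl j => (t 0 j)%:MP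
   | inr j => 'X_j end) P) => v.
rewrite meval_mmap; apply: meval_eq => i; rewrite mxE.
by case: (split i) => j; rewrite ?mevalC ?mevalXU.
Qed.

Lemma act_open t (W : set X) : tor t -> zopen W -> zopen [set x | W (a (t, x))].
Proof.
move=> tt0 oW; have /zopenP H := aM.1 W oW.
apply/zopenP => i x Wx dx.
have [P [Px hP]] := H (tt, i) (t, x) (conj tt0 Wx) (conj I dx).
have [Q hQ] := prod_eval t P; exists Q; rewrite hQ; split => // y dy.
by rewrite hQ => Py; have [] := hP (t, y) (conj I dy) Py.
Qed.

Lemma act_reg t (W : set X) f : tor t -> regular_on W f ->
  regular_on [set x | W (a (t, x))] (fun x => f (a (t, x))).
Proof.
move=> tt0 rf; split; first exact: act_open (rf.1).
have [_ H] := aM.2 W f rf => i x Wx dx.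
have [p [q [qx h]]] := H (tt, i) (t, x) (conj tt0 Wx) (conj I dx).
have [p' hp] := prod_eval t p; have [q' hq] := prod_eval t q.
exists p', q'; rewrite hq; split => // y Wy dy; rewrite hp hq => qy.
exact: h (t, y) (conj tt0 Wy) (conj I dy) qy.
Qed.

Definition monomial_map q (A : 'M[int]_(q, n)) (w : 'rV[K]_q) := e (mexp A w).

(* The rational map e(w^A) is defined at w0, where it takes the value x.      *)
Definition center q (A : 'M[int]_(q, n)) (w0 : 'rV[K]_q) (x : X) :=
  (forall W : set X, zopen W -> W x -> exists Q : {mpoly K[q]}, Q.@[w0 0] != 0 /\
     forall w : 'rV[K]_q, tor w -> Q.@[w 0] != 0 -> W (monomial_map A w)) /\
  (forall (W : set X) f, regular_on W f -> W x -> exists p b : {mpoly K[q]},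
     [/\ b.@[w0 0] != 0, b.@[w0 0] * f x = p.@[w0 0] &
      forall w : 'rV[K]_q, tor w -> W (monomial_map A w) -> b.@[w 0] * f (monomial_map A w) = p.@[w 0]]).

Section Center.
Variables (q : nat) (A : 'M[int]_(q, n)).

Lemma center_gen w0 x (W : set X) : center A w0 x -> zopen W -> W x ->
  gen (fun w => tor w /\ W (monomial_map A w)).
Proof.
move=> [c0 _] oW Wx; have [Q [Q0 h]] := c0 W oW Wx.
apply: gen_and (gen_tor K q) (gen_neq0 (meval_neq0 Q0)) => w tw Qw.
by split => //; apply: h.
Qed.

Lemma center_regat w0 x (W : set X) f : center A w0 x -> regular_on W f -> W x ->
  regat w0 (f \o monomial_map A) (f x).
Proof.
move=> cx rf Wx; have [p [b [b0 h1 h2]]] := cx.2 W f rf Wx.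
exists p, b; split => //; apply: genW (center_gen cx rf.1 Wx) => w [tw Ww].
exact: h2.
Qed.

(** An equation of the diagonal vanishes generically along the pairs (e(w^A), e(w^A)), hence at the
    pair of limits (x, y). *)
Lemma sep_uniq (w0 : 'rV[K]_q) (x y : X) (i j : index X) : dom i x -> dom j y ->
  gen (fun w => dom i (monomial_map A w) /\ dom j (monomial_map A w)) ->
  (forall k, regat w0 (fun w => chart i (monomial_map A w) 0 k) (chart i x 0 k)) ->
  (forall k, regat w0 (fun w => chart j (monomial_map A w) 0 k) (chart j y 0 k)) -> x = y.
Proof.
move=> dx dy gd hi hj.
have [B [S ->] hB] := variety_separated (i, j).
suff : [set xy : X * X | xy.1 = xy.2] (x, y) by [].
apply/(proj2 (hB (x, y) (conj dx dy))) => P SP.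
apply: (@regat_eq0 _ _ w0 (fun w => P.@[(row_mx (chart i (monomial_map A w)) (chart j (monomial_map A w))) 0])).
  apply: genW gd => w [di dj].
  exact: (proj1 (hB (monomial_map A w, monomial_map A w) (conj di dj)) erefl P SP).
apply: (@regat_meval _ _ _ _ (fun m w => row_mx (chart i (monomial_map A w)) (chart j (monomial_map A w)) 0 m)) => m.
rewrite /= -[m]splitK; case: (split m) => k /=.
  by rewrite row_mxEl; apply: regat_ext (hi k); apply: gen_true => w; rewrite row_mxEl.
by rewrite row_mxEr; apply: regat_ext (hj k); apply: gen_true => w; rewrite row_mxEr.
Qed.

Lemma center_uniq w0 x y : center A w0 x -> center A w0 y -> x = y.
Proof.
move=> cx cy; have [i [gi dx]] := good_chart x; have [j [gj dy]] := good_chart y.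
apply: (sep_uniq (w0 := w0) dx dy).
- by apply: gen_and (center_gen cx gi dx) (center_gen cy gj dy) => w [_ ?] [_ ?].
- by move=> k; have := center_regat cx (reg_chart k) dx.
- by move=> k; have := center_regat cy (reg_chart k) dy.
Qed.

Lemma center_scale w0 x t : tor t -> center A w0 x ->
  center A (map2_mx *%R t w0) (a (mexp A t, x)).
Proof.
move=> tt0 [c0 c1]; have tAt := mexp_tor A tt0.
pose ti : 'rV[K]_q := \row_k (t 0 k)^-1.
have tti : tor ti by move=> k; rewrite mxE invr_eq0.
have tiK (w : 'rV[K]_q) : map2_mx *%R ti (map2_mx *%R t w) = w.
  by apply/rowP => k; rewrite !mxE mulKf.
have tiK' (w : 'rV[K]_q) : map2_mx *%R t (map2_mx *%R ti w) = w.
  by apply/rowP => k; rewrite !mxE mulVKf.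
have eAt w : tor w -> monomial_map A w = a (mexp A t, monomial_map A (map2_mx *%R ti w)).
  move=> tw; rewrite /monomial_map (aE tAt (mexp_tor A (tor_map2 tti tw))).
  by rewrite -mexp_map2 tiK'.
split=> [W oW Wx|W f rf Wx].
  have [Q [Q0 h]] := c0 _ (act_open tAt oW) Wx.
  have [Q' hQ] := scale_pull ti Q.
  exists Q'; rewrite hQ tiK; split => // w tw.
  by rewrite hQ eAt // => /h; apply; apply: tor_map2.
have [p [b [b0 h1 h2]]] := c1 _ _ (act_reg tAt rf) Wx.
have [p' hp] := scale_pull ti p; have [b' hb] := scale_pull ti b.
have e1 : b'.@[(map2_mx *%R t w0) 0] = b.@[w0 0] by rewrite hb tiK.
have e2 : p'.@[(map2_mx *%R t w0) 0] = p.@[w0 0] by rewrite hp tiK.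
exists p', b'; split; rewrite ?e1 ?e2 //.
move=> w tw h; rewrite hb hp; move: h; rewrite (eAt w tw) => h.
exact: h2 (tor_map2 tti tw) h.
Qed.

(** Polynomials in w = v^B acquire denominators only in the coordinates that do not vanish at v0, so
    regularity at w0 pulls back to v0. *)
Lemma center_comp q' (B : 'M[int]_(q', q)) w0 (v0 : 'rV[K]_q') x : center A w0 x ->
  (forall k j, v0 0 k = 0 -> 0 <= B k j) -> mexp B v0 = w0 -> center (B *m A) v0 x.
Proof.
move=> [c0 c1] hB e0; pose Z k := v0 0 k == 0.
have hZ k j : Z k -> 0 <= B k j by move=> /eqP; apply: hB.
have v0Z k : ~~ Z k -> v0 0 k != 0 by [].
have eBA v : tor v -> monomial_map (B *m A) v = monomial_map A (mexp B v).
  by move=> tv; rewrite /monomial_map mexp_mulmx.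
have hD0 D : (\prod_(k | ~~ Z k) v0 0 k) ^+ D != 0.
  by rewrite expf_neq0 //; apply/prodf_neq0.
split=> [W oW Wx|W f rf Wx].
  have [Q [Q0 h]] := c0 W oW Wx.
  have [D /(_ D (leqnn D)) [Q' hQ]] := mexp_pull hZ Q.
  exists Q'; rewrite hQ // e0 mulf_neq0 //; split => // v tv Qv.
  rewrite eBA //; apply: h; first exact: mexp_tor.
  by move: Qv; rewrite hQ // mulf_eq0 negb_or => /andP[].
have [p [b [b0 h1 h2]]] := c1 W f rf Wx.
have [D1 hD1] := mexp_pull hZ p; have [D2 hD2] := mexp_pull hZ b.
have [p' hp] := hD1 (maxn D1 D2) (leq_maxl _ _).
have [b' hb] := hD2 (maxn D1 D2) (leq_maxr _ _).
exists p', b'; rewrite hb // hp // e0; split.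
- by rewrite mulf_neq0.
- by rewrite -mulrA h1.
move=> v tv; rewrite eBA // => /(h2 _ (mexp_tor B tv)) h3.
by rewrite hb // hp // -h3 mulrA.
Qed.

End Center.

Lemma center_e z : tor z -> center 1%:M z (e z).
Proof.
move=> tz; have eE w : monomial_map 1%:M w = e w by rewrite /monomial_map mexp1.
split=> [W oW Wz|W f rf Wz].
  have [Q [Qz h]] := e_open oW tz Wz; exists Q; split => // w tw.
  by rewrite eE => /h [].
have [p [b [b0 h]]] := e_rat rf tz Wz; exists p, b; split => //; first exact: h.
by move=> w tw; rewrite eE; apply: h.
Qed.

Lemma center_eA q (A : 'M[int]_(q, n)) w : tor w -> center A w (monomial_map A w).
Proof.
move=> tw; rewrite -{1}[A]mulmx1.
apply: (center_comp (center_e (mexp_tor A tw))) => //.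
by move=> k j wk; have := tw k; rewrite wk eqxx.
Qed.

End ToricCenters.


(** * Monomial coordinates near a point of X *)

Section ToricCharts.
Variables (R : realType) (X : variety R) (n : nat).
Local Notation K := (R[i]).
Variables (e : 'rV[K]_n -> X) (a : 'rV[K]_n * X -> X) (V : set X) (e' : X -> 'rV[K]_n).
Hypothesis TS : toric_structure e a V e'.
Local Notation eA := (monomial_map e).
Local Notation center := (center e).

Section Chart.
Variables (q : nat) (A : 'M[int]_(q, n)).

Lemma generic_regular_value w (W : set X) f (g : 'rV[K]_q -> K) v : tor w ->
  regular_on W f -> W (eA A w) -> gen (fun w => f (eA A w) = g w) ->
  regat w g v -> f (eA A w) = v.
Proof.
move=> tw rf Ww fg hv; apply: (regat_uniq _ hv).
exact: (regat_ext fg (center_regat (center_eA TS A tw) rf Ww)).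
Qed.

(** The image of a chart is closed: an equation of it, cleared of denominators, holds for the
    generic values of the coordinates, hence at every w where the denominators do not vanish. *)
Lemma chart_points (i : index X) (c d : 'I_(edim i) -> {mpoly K[q]}) :
  gen (fun w => dom i (eA A w)) ->
  (forall k, gen (fun w => (d k).@[w 0] * chart i (eA A w) 0 k = (c k).@[w 0])) ->
  forall w : 'rV[K]_q, (forall k, (d k).@[w 0] != 0) -> exists x, dom i x /\
    forall k, chart i x 0 k = (c k).@[w 0] / (d k).@[w 0].
Proof.
move=> gd h w hw; have [_ _ alg _] := variety_prevariety X.
have [S hS] := alg i.
suff [x dx ex] : (chart i @` dom i) (\row_k ((c k).@[w 0] / (d k).@[w 0])).
  by exists x; split => // k; rewrite ex mxE.
rewrite hS => P SP; have [D /(_ D (leqnn D)) [P' hP']] := clear_denom c d P.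
have : P' = 0.
  have gk := gen_all (fun k => genI (h k) (gen_neq0 (meval_neq0 (hw k)))).
  apply: gen_eq0; apply: gen_and gd gk => u du hu.
  rewrite hP'; last by move=> k; case: (hu k).
  have : (chart i @` dom i) (chart i (eA A u)) by exists (eA A u).
  rewrite hS => /(_ P SP) E; rewrite -[RHS](mulr0 ((\prod_k (d k).@[u 0]) ^+ D)) -E.
  congr (_ * _); apply: meval_eq => k.
  by have [<- d0] := hu k; rewrite mulrAC divff // mul1r.
move=> P'0; have := hP' w hw; rewrite P'0 meval0 => /esym/eqP.
rewrite mulf_eq0 expf_eq0 => /orP[/andP[_ /prodf_eq0 [k _]]|/eqP E].
  by rewrite (negbTE (hw k)).
by rewrite -[RHS]E; apply: meval_eq => k; rewrite mxE.
Qed.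

(** Convergence of the coordinates in one open chart suffices. By [chart_points] the chart contains
    a point with the coordinates computed at w, and by [sep_uniq] it is e(w^A); functions regular at
    x are then rational in these coordinates. *)
Lemma center_chart (i : index X) w0 x : good i -> dom i x ->
  gen (fun w => dom i (eA A w)) ->
  (forall k, regat w0 (fun w => chart i (eA A w) 0 k) (chart i x 0 k)) ->
  center A w0 x.
Proof.
move=> gi dx gd H; have /choice [c /choice [d h]] := H.
have hc k : gen (fun w => (d k).@[w 0] * chart i (eA A w) 0 k = (c k).@[w 0]).
  by case: (h k).
have d0 k : (d k).@[w0 0] != 0 by case: (h k).
have prodd (w : 'rV[K]_q) : (forall k, (d k).@[w 0] != 0) -> \prod_k (d k).@[w 0] != 0.
  by move=> hw; apply/prodf_neq0 => k _.
have pts w : tor w -> (forall k, (d k).@[w 0] != 0) -> dom i (eA A w) /\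
    forall k, chart i (eA A w) 0 k = (c k).@[w 0] / (d k).@[w 0].
  move=> tw hw; have [y [dy ey]] := chart_points gd hc hw.
  suff -> : eA A w = y by [].
  have [j [gj dj]] := good_chart (eA A w).
  have cw := center_eA TS A tw.
  apply/esym; apply: (sep_uniq (w0 := w) dy dj).
  - by apply: gen_and gd (center_gen cw gj dj) => u du [_ du']; split; [exact: du|exact: du'].
  - move=> k; by exists (c k), (d k); split => //; rewrite ey mulrC divfK.
  - by move=> k; have := center_regat cw (reg_chart k) dj.
have c0 (W : set X) : zopen W -> W x -> exists Q : {mpoly K[q]}, Q.@[w0 0] != 0 /\
     forall w : 'rV[K]_q, tor w -> Q.@[w 0] != 0 -> W (eA A w).
  move=> /zopenP oW Wx; have [P [Px hP]] := oW i x Wx dx.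
  have [D /(_ D (leqnn D)) [P' hP']] := clear_denom c d P.
  exists (P' * \prod_k d k); rewrite mevalM rmorph_prod; split.
    apply: mulf_neq0; last exact: prodd.
    rewrite (hP' _ d0); apply: mulf_neq0; first exact/expf_neq0/prodd.
    suff -> : P.@[fun k => (c k).@[w0 0] / (d k).@[w0 0]] = P.@[chart i x 0] by [].
    apply: meval_eq => k; have [dk0 <- _] := h k.
    by rewrite mulrC mulKf.
  move=> w tw; rewrite mevalM rmorph_prod mulf_eq0 negb_or => /andP[Pw /prodf_neq0 dw].
  have dw' k : (d k).@[w 0] != 0 by apply: dw.
  have [dw0 cw] := pts w tw dw'; apply: hP => //.
  move: Pw; rewrite (hP' _ dw') mulf_eq0 negb_or => /andP[_].
  suff -> : P.@[fun k => (c k).@[w 0] / (d k).@[w 0]] = P.@[chart i (eA A w) 0] by [].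
  by apply: meval_eq => k; rewrite cw.
split=> // W f rf Wx.
have oW := rf.1; have [_ /(_ i x Wx dx) [r [s [sx hrs]]]] := rf.
have [Q [Q0 hQ]] := c0 W oW Wx.
have gW : gen (fun w => W (eA A w)).
  by apply: gen_and (gen_tor K q) (gen_neq0 (meval_neq0 Q0)) => w tw; apply: hQ.
have rr := @regat_meval _ _ w0 _ (fun k w => chart i (eA A w) 0 k) _ r H.
have rs := @regat_meval _ _ w0 _ (fun k w => chart i (eA A w) 0 k) _ s H.
have rF : regat w0 (f \o eA A) (f x).
  rewrite (hrs x Wx dx sx).
  have gs : gen (fun w => s.@[chart i (eA A w) 0] != 0) := gen_neq_regat rs sx.
  apply: regat_ext (regatM rr (regatV sx rs)).
  apply: gen_and (genI gd gW) gs => w [dw Ww] sw.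
  exact/esym/(hrs _ Ww dw sw).
have [p [b [b0 e0 hg]]] := rF; exists p, b; split => // w tw Ww.
exact: regat_eval (center_regat (center_eA TS A tw) rf Ww) hg.
Qed.

(* The monomials w_k are regular functions near x.                            *)
Definition chartat (w0 : 'rV[K]_q) x := center A w0 x /\
  forall k, exists (W : set X) f, [/\ regular_on W f, W x, f x = w0 0 k &
    forall w, tor w -> W (eA A w) -> f (eA A w) = w 0 k].

Lemma chartatI w0 x : center A w0 x ->
  (forall k, exists (W : set X) f, [/\ regular_on W f, W x &
    gen (fun w => f (eA A w) = w 0 k)]) -> chartat w0 x.
Proof.
move=> cx H; split => // k; have [W [f [rf Wx hf]]] := H k.
have hX (w : 'rV[K]_q) : regat w (fun u => u 0 k) (w 0 k).
  have := regat_mevalM w ('X_k); rewrite mevalXU; apply: regat_ext.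
  by apply: gen_true => u; rewrite mevalXU.
exists W, f; split => //.
  exact: (regat_uniq (regat_ext hf (center_regat cx rf Wx)) (hX w0)).
by move=> w tw Ww; exact: (@generic_regular_value w W f _ _ tw rf Ww hf (hX w)).
Qed.

Lemma chartat_scale w0 x t : tor t -> chartat w0 x ->
  chartat (map2_mx *%R t w0) (a (mexp A t, x)).
Proof.
move=> tt0 [cx H]; apply: chartatI; first exact: (center_scale TS).
move=> k; have [W [f [rf Wx fx fw]]] := H k.
pose ti : 'rV[K]_q := \row_k (t 0 k)^-1.
have tti : tor ti by move=> l; rewrite mxE invr_eq0.
have tAti := mexp_tor A tti; have tAt := mexp_tor A tt0.
have tiE : map2_mx *%R ti t = const_mx 1.
  by apply/rowP => l; rewrite !mxE mulVf.
have aK : a (mexp A ti, a (mexp A t, x)) = x.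
  rewrite (ts_aA TS) // -mexp_map2 tiE -[RHS](ts_a1 TS x); congr (a (_, _)).
  by apply/rowP => l; rewrite mexpE mxE big1 // => m _; rewrite mxE exp1rz.
exists [set y | W (a (mexp A ti, y))], (fun y => t 0 k * f (a (mexp A ti, y))); split.
- apply: regM; first exact/reg_const/(act_open TS tAti)/rf.1.
  exact: (act_reg TS).
- by rewrite /= aK.
have gW := center_gen (center_scale TS tt0 cx) (act_open TS tAti rf.1).
rewrite /= aK in gW; apply: gen_and (gen_tor K q) (gW Wx) => w tw [_ Ww].
have E : a (mexp A ti, eA A w) = eA A (map2_mx *%R ti w).
  by rewrite /monomial_map (ts_aE TS tAti (mexp_tor A tw)) -mexp_map2.
rewrite E in Ww *; rewrite fw //; last exact: tor_map2.
by rewrite !mxE mulVKf.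
Qed.

(** The w_k remain coordinates on a neighbourhood Q != 0 of the origin. For any w0 the polynomial t
    |-> Q(t w0) is non-zero at t = 0, so some t in the torus moves w0 into this neighbourhood, and
    [chartat_scale] moves the chart back by the inverse of t. *)
Lemma chartat_all p : chartat 0 p -> forall w0, exists x, chartat w0 x.
Proof.
move=> [cp H] w0; have [i [gi dp]] := good_chart p.
have gdi : gen (fun w => dom i (eA A w)) by apply: genW (center_gen cp gi dp) => w [].
have /choice [c /choice [d h]] : forall k, regat 0 (fun w => chart i (eA A w) 0 k) (chart i p 0 k).
  by move=> k; apply: (center_regat cp (reg_chart k) dp).
have d0 k : (d k).@[(0 : 'rV[K]_q) 0] != 0 by case: (h k).
have hc k : gen (fun w => (d k).@[w 0] * chart i (eA A w) 0 k = (c k).@[w 0]).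
  by case: (h k).
have /choice [W /choice [f hf]] := H.
have /choice [P hP] k : exists P : {mpoly K[edim i]}, P.@[chart i p 0] != 0 /\
      forall y, dom i y -> P.@[chart i y 0] != 0 -> W k y.
  by have [[/zopenP oW _] Wp _ _] := hf k; apply: oW.
have /choice [P' hP'] k : exists P' : {mpoly K[q]}, exists D, forall w : 'rV[K]_q,
    (forall l, (d l).@[w 0] != 0) ->
    P'.@[w 0] = (\prod_l (d l).@[w 0]) ^+ D * (P k).@[fun l => (c l).@[w 0] / (d l).@[w 0]].
  have [D /(_ D (leqnn D)) [P' ?]] := clear_denom c d (P k); by exists P', D.
pose Q := (\prod_k d k) * \prod_k P' k.
have Q0 : Q.@[(0 : 'rV[K]_q) 0] != 0.
  rewrite /Q mevalM !rmorph_prod; apply: mulf_neq0; first by apply/prodf_neq0 => k _; apply: d0.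
  apply/prodf_neq0 => k _; have [D E] := hP' k.
  change ((P' k).@[(0 : 'rV[K]_q) 0] != 0); rewrite (E _ d0).
  apply: mulf_neq0; first by apply/expf_neq0/prodf_neq0 => l _; apply: d0.
  have [Pp _] := hP k.
  suff -> : (P k).@[fun l => (c l).@[(0 : 'rV[K]_q) 0] / (d l).@[(0 : 'rV[K]_q) 0]]
    = (P k).@[chart i p 0] by [].
  apply: meval_eq => l; have [dl0 <- _] := h l.
  by rewrite mulrC mulKf.
have nb (v0 : 'rV[K]_q) : Q.@[v0 0] != 0 -> exists x, chartat v0 x.
  rewrite /Q mevalM !rmorph_prod mulf_eq0 negb_or => /andP[/prodf_neq0 dv /prodf_neq0 Pv].
  have dv' k : (d k).@[v0 0] != 0 by apply: dv.
  have [x [dx ex]] := chart_points gdi hc dv'.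
  exists x; apply: chartatI.
    apply: (center_chart gi dx gdi) => k; exists (c k), (d k); split => //.
    by rewrite ex mulrC divfK.
  move=> k; have [rf Wp fp fw] := hf k; exists (W k), (f k); split => //.
    case: (hP k) => _; apply => //.
    have [D E] := hP' k; have Pvk : (P' k).@[v0 0] != 0 := Pv k isT.
    move: Pvk; rewrite (E _ dv') mulf_eq0 negb_or => /andP[_].
    suff -> : (P k).@[fun l => (c l).@[v0 0] / (d l).@[v0 0]] = (P k).@[chart i x 0] by [].
    by apply: meval_eq => l; rewrite ex.
  by apply: genW (center_gen cp rf.1 Wp) => w [tw Ww]; apply: fw.
have [Q' hQ'] := scale_pull w0 Q.
have : Q' != 0.
  apply: (@meval_neq0 _ _ 0); rewrite hQ'.
  have -> : map2_mx *%R w0 0 = 0 :> 'rV[K]_q by apply/rowP => k; rewrite !mxE mulr0.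
  exact: Q0.
move=> /gen_neq0 gQ; have [t [Qt tt0]] := gen_ex (genI gQ (gen_tor K q)).
have [|x hx] := nb (map2_mx *%R t w0).
  have -> : map2_mx *%R t w0 = map2_mx *%R w0 t by apply/rowP => k; rewrite !mxE mulrC.
  by rewrite -hQ'.
pose ti : 'rV[K]_q := \row_k (t 0 k)^-1.
have tti : tor ti by move=> l; rewrite mxE invr_eq0.
exists (a (mexp A ti, x)); have := chartat_scale tti hx.
by congr (chartat _ _); apply/rowP => l; rewrite !mxE mulKf.
Qed.

End Chart.
End ToricCharts.


(** * Limits in a complete variety *)

Section Products.
Variables (R : realType) (X Y : atlas R).
Local Notation K := (R[i]).

Lemma pull_fst m k (P : {mpoly K[m]}) : exists P' : {mpoly K[m + k]},
  forall (v : 'rV[K]_m) (w : 'rV[K]_k), P'.@[(row_mx v w) 0] = P.@[v 0].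
Proof.
exists (mmap (@mpolyC _ K) (fun j => 'X_(lshift k j)) P) => v w.
rewrite meval_mmap; apply: meval_eq => j.
by rewrite mevalXU row_mxEl.
Qed.

Lemma pull_snd m k (P : {mpoly K[k]}) : exists P' : {mpoly K[m + k]},
  forall (v : 'rV[K]_m) (w : 'rV[K]_k), P'.@[(row_mx v w) 0] = P.@[w 0].
Proof.
exists (mmap (@mpolyC _ K) (fun j => 'X_(rshift m j)) P) => v w.
rewrite meval_mmap; apply: meval_eq => j.
by rewrite mevalXU row_mxEr.
Qed.

Lemma reg_fst (W : set X) f : regular_on W f ->
  @regular_on R (atlas_prod X Y) [set z | W z.1] (fun z => f z.1).
Proof.
move=> [/zopenP oW rf]; split.
  apply/zopenP => -[i j] [x y] Wx [dx dy]; have [P [Px hP]] := oW i x Wx dx.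
  have [P' hP'] := pull_fst (edim j) P; exists P'; rewrite hP'; split => //.
  by move=> [x' y'] [dx' dy']; rewrite hP' => /(hP _ dx').
move=> [i j] [x y] Wx [dx dy]; have [p [q [qx h]]] := rf i x Wx dx.
have [p' hp] := pull_fst (edim j) p; have [q' hq] := pull_fst (edim j) q.
exists p', q'; rewrite hq; split => // -[x' y'] Wx' [dx' dy'].
by rewrite hp hq => /(h _ Wx' dx').
Qed.

Lemma reg_snd (W : set Y) f : regular_on W f ->
  @regular_on R (atlas_prod X Y) [set z | W z.2] (fun z => f z.2).
Proof.
move=> [/zopenP oW rf]; split.
  apply/zopenP => -[i j] [x y] Wy [dx dy]; have [P [Px hP]] := oW j y Wy dy.
  have [P' hP'] := pull_snd (edim i) P; exists P'; rewrite hP'; split => //.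
  by move=> [x' y'] [dx' dy']; rewrite hP' => /(hP _ dy').
move=> [i j] [x y] Wy [dx dy]; have [p [q [qx h]]] := rf j y Wy dy.
have [p' hp] := pull_snd (edim i) p; have [q' hq] := pull_snd (edim i) q.
exists p', q'; rewrite hq; split => // -[x' y'] Wy' [dx' dy'].
by rewrite hp hq => /(h _ Wy' dy').
Qed.

End Products.

Section Affine.
Variables (R : realType) (n : nat).
Local Notation K := (R[i]).
Local Notation An := (affine_space R n).

Lemma affine_regular (P : {mpoly K[n]}) :
  @regular_on R An setT (fun w : 'rV[K]_n => P.@[w 0]).
Proof.
split; first exact: zopenT.
move=> i w _ _; exists P, 1; rewrite meval1 oner_eq0; split => // y _ _ _.
by rewrite meval1 divr1.
Qed.

Lemma affine_prevariety : prevariety_axiom An.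
Proof.
split=> [w|i v w _ _ //|i|i k]; first by exists tt.
  exists set0; apply/seteqP; split=> [v _ p //|v _]; by exists v.
apply: reg_eq (affine_regular 'X_k) => w _; exact: mevalXU.
Qed.

Lemma affine_separated : separated An.
Proof.
move=> [[] []].
exists [set v | forall p : {mpoly K[n + n]}, (exists k,
    p = 'X_(lshift n k) - 'X_(rshift n k)) -> p.@[v 0] = 0].
  by exists [set p : {mpoly K[n + n]} | exists k, p = 'X_(lshift n k) - 'X_(rshift n k)].
move=> [v w] _ /=; split=> [-> p [k ->]|h].
  by rewrite mevalB !mevalXU row_mxEl row_mxEr subrr.
apply/rowP => k; have := h _ (ex_intro _ k erefl).
by rewrite mevalB !mevalXU row_mxEl row_mxEr => /eqP; rewrite subr_eq0 => /eqP.
Qed.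

Lemma affine_irreducible : zirreducible [set: An].
Proof.
split; first by exists (0 : 'rV[K]_n).
move=> A B /(_ tt) [A' [S ->] hA] /(_ tt) [B' [S' ->] hB] cov.
apply: contrapT => /not_orP [/existsNP [v /not_implyP [_ nA]] /existsNP [w /not_implyP [_ nB]]].
have /existsNP [p /not_implyP [Sp /eqP pv]] := contra_not (proj2 (hA v I)) nA.
have /existsNP [q /not_implyP [Sq /eqP qw]] := contra_not (proj2 (hB w I)) nB.
have /mpoly_nonzero [u] : p * q != 0 by rewrite mulf_neq0 // (meval_neq0 pv, meval_neq0 qw).
rewrite mevalM mulf_eq0 negb_or => /andP[/eqP pu /eqP qu].
by have [/(proj1 (hA u I))/(_ _ Sp)|/(proj1 (hB u I))/(_ _ Sq)] := cov u I.
Qed.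

Definition affine_variety : variety R :=
  Variety affine_prevariety affine_separated affine_irreducible.

End Affine.

Section Limits.
Variables (R : realType) (X : variety R) (n : nat).
Local Notation K := (R[i]).
Variables (e : 'rV[K]_n -> X) (a : 'rV[K]_n * X -> X) (V : set X) (e' : X -> 'rV[K]_n).
Hypothesis TS : toric_structure e a V e'.
Hypothesis X_complete : complete_variety X.
Local Notation eA := (monomial_map e).

(** Z is the closure in X x K^q of the graph of w |-> e(w^A) over the torus. By completeness its
    image in K^q is closed; it contains the torus, hence the origin. Any point of Z over the origin
    satisfies the equations that hold along the graph. *)
Lemma limit_exists q (A : 'M[int]_(q, n)) : exists x : X,
  forall i : index X, good i -> dom i x -> forall k (c d : {mpoly K[q]}),
    gen (fun w : 'rV[K]_q => d.@[w 0] * chart i (eA A w) 0 k = c.@[w 0]) ->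
    d.@[(0 : 'rV[K]_q) 0] * chart i x 0 k = c.@[(0 : 'rV[K]_q) 0].
Proof.
pose Y := affine_variety R q.
pose Z : set (atlas_prod X Y) := [set z | forall O : set (atlas_prod X Y),
  zopen O -> O z -> exists w : 'rV[K]_q, tor w /\ O (eA A w, w)].
have cZ : zclosed Z.
  rewrite -[Z]setCK; apply: zopen_local => z.
  move=> /existsNP [O /not_implyP [oO /not_implyP [Oz nO]]].
  by exists O; split => // z' Oz' /(_ O oO Oz').
have [B [S ->] hB] := X_complete cZ tt.
have hS p : S p -> p = 0.
  move=> Sp; apply: gen_eq0; apply: genW (gen_tor K q) => w tw.
  apply: (proj1 (hB w I)) Sp; exists (eA A w) => O oO Ow; by exists w.
have [|x hx] := proj2 (hB (0 : 'rV[K]_q) I).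
  by move=> p /hS ->; rewrite meval0.
exists x => i gi dx k c d h; apply/eqP; rewrite -subr_eq0; apply: contrapT => /negP ne.
have rc : regular_on [set z : atlas_prod X Y | dom i z.1] (fun z => chart i z.1 0 k).
  exact: (reg_fst _ (reg_chart k)).
have rW (P : {mpoly K[q]}) :
    @regular_on R (atlas_prod X Y) [set z : atlas_prod X Y | dom i z.1] (fun z => P.@[(z.2 : 'rV[K]_q) 0]).
  by apply: reg_sub (rc.1) _ (reg_snd X (affine_regular P)).
have rF := regD (regM (rW d) rc) (regM (reg_const (-1) rc.1) (rW c)).
have [|w [tw [/= dw]]] := hx _ (reg_nz_open rF).
  by split => //=; rewrite mulN1r.
rewrite mulN1r subr_eq0 => /eqP; apply.
exact: regat_eval (center_regat (center_eA TS A tw) (reg_chart k) dw) h.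
Qed.

End Limits.


(** * Leading monomials along a cone *)

Section Coherent.
Variables (K : numFieldType) (n : nat).
Implicit Types (L : 'M[int]_n) (p : {mpoly K[n]}) (m : 'X_{1..n}).

(** After substitution of w^L, the monomial of exponent m divides that of exponent m'. *)
Definition mle L m m' := forall k, 0 <= dot (rowz m' - rowz m) (row k L).

Lemma meval_mexp L m (w : 'rV[K]_n) : tor w ->
  ('X_[m]).@[mexp L w 0] = \prod_k w 0 k ^ dot (rowz m) (row k L).
Proof.
move=> tw; rewrite mevalX.
transitivity (\prod_j \prod_k w 0 k ^ (L k j * (m j)%:Z)).
  by apply: eq_bigr => j _; rewrite mexpE -[LHS]/(_ ^ (m j : int)) exprz_prod; apply: eq_bigr => k _; rewrite exprz_exp.
rewrite exchange_big; apply: eq_bigr => k _ /=; rewrite /dot exprz_sum //.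
by apply: eq_bigr => j _; rewrite !mxE mulrC.
Qed.

Lemma dot_row_inj L m m' : L \in unitmx ->
  (forall k, dot (rowz m - rowz m') (row k L) = 0) -> m = m'.
Proof.
move=> uL h; apply: rowz_inj; apply/eqP; rewrite -subr_eq0; apply/eqP.
have E : L *m (rowz m - rowz m')^T = 0.
  apply/colP => k; rewrite [RHS]mxE -(h k) [LHS]mxE.
  by apply: eq_bigr => j _; rewrite !mxE mulrC.
have := mulKmx uL (rowz m - rowz m')^T; rewrite E mulmx0 => E'.
by apply: trmx_inj; rewrite -E' trmx0.
Qed.

(** The least monomial m0 is factored out of p(w^L). As L is unimodular, the other monomials leave
    non-constant quotients, so the constant term of p' is the coefficient of m0. *)
Lemma leading_form L m0 p : L \in unitmx -> (forall m, m \in msupp p -> mle L m0 m) ->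
  exists p' : {mpoly K[n]}, p'.@[(0 : 'rV[K]_n) 0] = p@_m0 /\
    forall w : 'rV[K]_n, tor w -> p'.@[w 0] * ('X_[m0]).@[mexp L w 0] = p.@[mexp L w 0].
Proof.
move=> uL h.
pose D m : 'X_{1..n} := [multinom absz (dot (rowz m - rowz m0) (row k L)) | k < n].
exists (\sum_(m <- msupp p) p@_m *: 'X_[D m]); split.
  rewrite meval_at0 raddf_sum /=.
  have E m : m \in msupp p -> (p@_m *: 'X_[D m])@_0 = (m == m0)%:R * p@_m0.
    move=> mp; rewrite mcoeffZ mcoeffX.
    case: (eqVneq m m0) => [->|mm0].
      suff -> : D m0 = 0%MM by rewrite eqxx mulr1 mul1r.
      apply/mnmP => k; rewrite mnmE mnm0E subrr /dot big1 // => j _.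
      by rewrite mxE mul0r.
    case: eqP => [e|]; rewrite ?mulr0 ?mul0r //; case/eqP: mm0.
    apply: (dot_row_inj uL) => k; have /mnmP/(_ k) := e.
    by rewrite mnmE mnm0E; lia.
  rewrite (eq_big_seq _ E).
  case: (boolP (m0 \in msupp p)) => [m0p|m0p].
    rewrite (bigD1_seq m0) //= ?msupp_uniq // eqxx mul1r big1 ?addr0 //.
    by move=> m /negbTE ->; rewrite mul0r.
  by rewrite (memN_msupp_eq0 m0p) big1 // => m _; rewrite mulr0.
move=> w tw; rewrite [RHS]mevalE rmorph_sum mulr_suml.
apply: eq_big_seq => m mp.
transitivity (p@_m * (('X_[D m]).@[w 0] * ('X_[m0]).@[mexp L w 0])).
  by rewrite mulrA; congr (_ * _); apply: mevalZ.
rewrite -mevalX; congr (_ * _).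
rewrite [in X in X * _]mevalX !meval_mexp // -big_split; apply: eq_bigr => k _ /=.
rewrite mnmE exprnP -expfzDr //; congr (_ ^ _).
have -> : dot (rowz m) (row k L) = dot (rowz m - rowz m0) (row k L) + dot (rowz m0) (row k L).
  by rewrite -dotDl subrK.
by rewrite (gez0_abs (h m mp k)).
Qed.

Lemma mle_min L (s : seq 'X_{1..n}) :
  (forall m m', m \in s -> m' \in s -> mle L m m' \/ mle L m' m) -> s != [::] ->
  exists2 m0, m0 \in s & forall m, m \in s -> mle L m0 m.
Proof.
have mle_refl m : mle L m m.
  by move=> k; rewrite subrr /dot big1 // => j _; rewrite mxE mul0r.
have mle_trans m m' m'' : mle L m m' -> mle L m' m'' -> mle L m m''.
  move=> h1 h2 k; rewrite -[rowz m''](subrK (rowz m')) -addrA dotDl.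
  exact: addr_ge0.
elim: s => // m s IH h _; case: (eqVneq s [::]) => [->|s0].
  exists m; rewrite ?mem_head // => m'; rewrite inE => /eqP ->; exact: mle_refl.
have [||m0 m0s hm0] := IH => //.
  by move=> m1 m2 h1 h2; apply: h; rewrite inE ?h1 ?h2 orbT.
have [||hm|hm] := h m m0; rewrite ?mem_head // ?inE ?m0s ?orbT //.
  exists m; rewrite ?mem_head // => m'; rewrite inE => /orP[/eqP ->|/hm0]; first exact: mle_refl.
  exact: mle_trans.
exists m0; rewrite ?inE ?m0s ?orbT // => m'; rewrite inE => /orP[/eqP -> //|]; exact: hm0.
Qed.

End Coherent.

Definition mdiffs n (M : seq 'X_{1..n}) : seq 'rV[int]_n :=
  [seq rowz m - rowz m' | m <- M, m' <- M].

Lemma mem_mdiffs n (M : seq 'X_{1..n}) m m' : m \in M -> m' \in M ->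
  rowz m - rowz m' \in mdiffs M.
Proof. by move=> h h'; apply: allpairs_f. Qed.

Lemma coherent_mle n (M : seq 'X_{1..n}) L m m' : coherent (mdiffs M) L ->
  m \in M -> m' \in M -> mle L m m' \/ mle L m' m.
Proof.
move=> c h h'; have [d|d] := c _ (mem_mdiffs h' h); first by left.
right=> k; have := d k; rewrite -opprB /dot -oppr_ge0 -sumrN.
by congr (_ <= _); apply: eq_bigr => j _; rewrite !mxE mulNr opprK.
Qed.

Section CoherentLimits.
Variables (R : realType) (X : variety R) (n : nat).
Local Notation K := (R[i]).
Variables (e : 'rV[K]_n -> X) (a : 'rV[K]_n * X -> X) (V : set X) (e' : X -> 'rV[K]_n).
Hypothesis TS : toric_structure e a V e'.
Hypothesis X_complete : complete_variety X.
Local Notation eA := (monomial_map e).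

Lemma chart_generic : gen (fun z => forall i : index X, good i -> dom i !=set0 -> dom i (e z)).
Proof.
apply: gen_all => i; case: (pselect (good i /\ dom i !=set0 :> Prop)) => [[gi i0]|h].
  by apply: genW (e_gen TS gi i0) => z [_ dz] _ _.
by apply: gen_true => z gi i0; case: h.
Qed.

Lemma chart_rational : exists M : seq 'X_{1..n}, forall i : index X, good i ->
  dom i !=set0 -> forall k, exists al be : {mpoly K[n]},
  [/\ be != 0, {subset msupp al <= M}, {subset msupp be <= M} &
   gen (fun z => be.@[z 0] * chart i (e z) 0 k = al.@[z 0])].
Proof.
have h i : exists M : seq 'X_{1..n}, good i -> dom i !=set0 -> forall k,
    exists al be : {mpoly K[n]},
    [/\ be != 0, {subset msupp al <= M}, {subset msupp be <= M} &
    gen (fun z => be.@[z 0] * chart i (e z) 0 k = al.@[z 0])].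
  case: (pselect (good i /\ dom i !=set0 :> Prop)) => [[gi i0]|h]; last first.
    by exists [::] => gi i0; case: h.
  have [z [tz dz]] := meet_V TS gi i0.
  have /choice [al /choice [be hab]] k :
      regat z (fun z => chart i (e z) 0 k) (chart i (e z) 0 k).
    exact: (e_regat TS (reg_chart k) tz dz).
  exists (flatten [seq msupp (al k) ++ msupp (be k) | k <- enum 'I_(edim i)]).
  move=> _ _ k; exists (al k), (be k); have [b0 _ g] := hab k; split => //.
  - exact: meval_neq0 b0.
  - move=> m hm; apply/flattenP; exists (msupp (al k) ++ msupp (be k)).
      by apply: map_f; rewrite mem_enum.
    by rewrite mem_cat hm.
  - move=> m hm; apply/flattenP; exists (msupp (al k) ++ msupp (be k)).
      by apply: map_f; rewrite mem_enum.
    by rewrite mem_cat hm orbT.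
have /choice [M hM] := h.
exists (flatten [seq M i | i <- enum (index X)]) => i gi i0 k.
have [al [be [b0 h1 h2 g]]] := hM i gi i0 k.
have sM : {subset M i <= flatten [seq M i | i <- enum (index X)]}.
  by move=> m hm; apply/flattenP; exists (M i) => //; apply: map_f; rewrite mem_enum.
by exists al, be; split => // m; [move/h1/sM|move/h2/sM].
Qed.

(** B consists of the differences of the exponents in the coordinates of X, written as quotients al
    / be. If no difference changes sign on the cone of L, numerator and denominator each have a
    least monomial, and these determine the limits of the coordinates. The comparisons depend only
    on the signs, so the same x serves every L' with the signs of L. *)
Lemma coherent_limit : exists B : seq 'rV[int]_n, forall L, L \in unitmx -> coherent B L ->
  exists x, forall L', L' \in unitmx -> coherent B L' ->
    (forall b, b \in B -> (forall k, 0 <= dot b (row k L)) <-> (forall k, 0 <= dot b (row k L'))) ->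
  center e L' 0 x.
Proof.
have [M hM] := chart_rational; exists (mdiffs M) => L uL cL.
have [x hx] := limit_exists TS X_complete L.
exists x => L' uL' cL' eL; have [i [gi dx]] := good_chart x.
have i0 : dom i !=set0 by exists x.
have pull (P : 'rV[K]_n -> Prop) L1 : L1 \in unitmx -> gen P -> gen (fun w => P (mexp L1 w)).
  by move=> uL1; apply: (@gen_pull _ _ _ L1 (invmx L1)); apply: mulVmx.
apply: (center_chart TS gi dx); first by apply: (pull (fun z => dom i (e z)) L' uL'); apply: genW chart_generic => z; apply.
move=> k; have [al [be [b0 sa sb g]]] := hM i gi i0 k.
have cm (L1 : 'M[int]_n) : coherent (mdiffs M) L1 -> forall p : {mpoly K[n]}, {subset msupp p <= M} -> forall m m',
    m \in msupp p -> m' \in msupp p -> mle L1 m m' \/ mle L1 m' m.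
  by move=> cL1 p sp m m' h h'; apply: coherent_mle cL1 _ _; apply: sp.
have eM m m' : m \in M -> m' \in M -> mle L m m' -> mle L' m m'.
  by move=> h h'; apply: (proj1 (eL _ (mem_mdiffs h' h))).
have [|m0 m0b hm0] := mle_min (cm L cL be sb); first by rewrite msupp_eq0.
case: (pselect (forall m, m \in msupp al -> mle L m0 m)) => ha.
  have val L1 : L1 \in unitmx -> (forall m, m \in M -> mle L m0 m -> mle L1 m0 m) ->
      exists c d : {mpoly K[n]}, [/\ d.@[(0 : 'rV[K]_n) 0] = be@_m0, c.@[(0 : 'rV[K]_n) 0] = al@_m0 &
      gen (fun w => d.@[w 0] * chart i (eA L1 w) 0 k = c.@[w 0])].
    move=> uL1 h1.
    have [c [c0 hc]] := leading_form uL1 (fun m hm => h1 m (sa m hm) (ha m hm)).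
    have [d [d0 hd]] := leading_form uL1 (fun m hm => h1 m (sb m hm) (hm0 m hm)).
    exists c, d; split => //; apply: gen_and (gen_tor K n) (pull _ L1 uL1 g) => w tw E.
    apply: (@mulIf _ ('X_[m0]).@[mexp L1 w 0]).
      by rewrite mevalX; apply/prodf_neq0 => j _; apply/expf_neq0/mexp_tor.
    by rewrite mulrAC hd // hc.
  have bm0 : be@_m0 != 0 by rewrite mcoeff_eq0 negbK.
  have [c [d [d0 c0 /(hx i gi dx)]]] := val L uL (fun m _ => id).
  rewrite d0 c0 => E.
  have [c' [d' [d0' c0' h']]] := val L' uL' (fun m hm => eM _ _ (sb _ m0b) hm).
  by exists c', d'; rewrite d0' c0' E.
(* The least exponent m1 of [al] is now strictly below the least exponent m0 of [be]: the coordinate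
   would have a pole, whereas it is finite at x. *)
have /existsNP [m /not_implyP [ma nm]] := ha.
have sal : msupp al != [::] by case: (msupp al) ma.
have [m1 m1a hm1] := mle_min (cm L cL al sa) sal.
have n1 : ~ mle L m0 m1.
  move=> h; apply: nm => k'; have := hm1 m ma k'; have := h k'.
  move=> h2 h3; rewrite -[rowz m](subrK (rowz m1)) -addrA dotDl; exact: addr_ge0.
have h10 : mle L m1 m0 by have [] := coherent_mle cL (sb _ m0b) (sa _ m1a).
have h1b m' : m' \in msupp be -> mle L m1 m'.
  move=> /hm0 h2 k'; rewrite -[rowz m'](subrK (rowz m0)) -addrA dotDl; exact: addr_ge0.
have [c [c0 hc]] := leading_form uL hm1.
have [d [d0 hd]] := leading_form uL h1b.
have : gen (fun w => d.@[w 0] * chart i (eA L w) 0 k = c.@[w 0]).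
  apply: gen_and (gen_tor K n) (pull _ L uL g) => w tw E.
  apply: (@mulIf _ ('X_[m1]).@[mexp L w 0]).
    by rewrite mevalX; apply/prodf_neq0 => j _; apply/expf_neq0/mexp_tor.
  by rewrite mulrAC hd // hc.
move=> /(hx i gi dx); rewrite d0 c0 (_ : be@_m1 = 0).
  by rewrite mul0r => /esym/eqP; rewrite mcoeff_eq0 m1a.
by apply/eqP; rewrite mcoeff_eq0; apply/negP => /hm0.
Qed.

End CoherentLimits.


(** * Tangent spaces *)

Lemma mderivXU (K : comNzRingType) E (j k : 'I_E) :
  ('X_j)^`M(k) = (j == k)%:R :> {mpoly K[E]}.
Proof.
rewrite mderivX mnm1E; case: eqP => [->|_]; last by rewrite scale0r.
rewrite scale1r -mpolyX0; congr 'X_[_]; apply/mnmP => l.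
by rewrite mnmBE subnn mnm0E.
Qed.

Lemma mcoeff_lin (K : nzRingType) E (p : {mpoly K[E]}) k : p@_U_(k) = (p^`M(k))@_0.
Proof. by rewrite mcoeff_deriv mnm0E mulr1n add0m. Qed.

Section Derivation.
Variables (K : numFieldType) (E : nat) (c v : 'rV[K]_E).

Definition ddir (p : {mpoly K[E]}) := \sum_(k < E) (p^`M(k)).@[c 0] * v 0 k.

Lemma ddirC x : ddir x%:MP = 0.
Proof. by rewrite /ddir big1 // => k _; rewrite mderivC meval0 mul0r. Qed.

Lemma ddirX j : ddir 'X_j = v 0 j.
Proof.
rewrite /ddir (bigD1 j) //= big1 => [|k kj]; rewrite mderivXU.
  by rewrite eqxx meval1 mul1r addr0.
by rewrite eq_sym (negbTE kj) meval0 mul0r.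
Qed.

Lemma ddirD p q : ddir (p + q) = ddir p + ddir q.
Proof.
by rewrite /ddir -big_split; apply: eq_bigr => k _; rewrite mderivD mevalD mulrDl.
Qed.

Lemma ddirM p q : ddir (p * q) = p.@[c 0] * ddir q + q.@[c 0] * ddir p.
Proof.
rewrite /ddir !mulr_sumr -big_split; apply: eq_bigr => k _ /=.
by rewrite mderivM mevalD !mevalM; ring.
Qed.

Lemma ddirN p : ddir (- p) = - ddir p.
Proof. by rewrite -mulN1r -mpolyC1 -mpolyCN ddirM ddirC mulr0 addr0 mevalC mulN1r. Qed.

(* A vector killing [A j - z j B j] does not see the difference between       *)
(* substituting [A j / B j] and substituting the constants [z j].             *)
Lemma ddir_clear n (A B : 'I_n -> {mpoly K[E]}) (z : 'I_n -> K) (al : {mpoly K[n]}) :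
  (forall j, (A j).@[c 0] = z j * (B j).@[c 0]) ->
  (forall j, ddir (A j) = z j * ddir (B j)) ->
  exists D0, forall D, (D0 <= D)%N -> exists al' : {mpoly K[E]},
    [/\ forall y : 'rV[K]_E, (forall j, (B j).@[y 0] != 0) ->
        al'.@[y 0] = (\prod_j (B j).@[y 0]) ^+ D * al.@[fun j => (A j).@[y 0] / (B j).@[y 0]],
        al'.@[c 0] = ((\prod_j B j) ^+ D).@[c 0] * al.@[z] &
        ddir al' = al.@[z] * ddir ((\prod_j B j) ^+ D)].
Proof.
move=> hz hv; elim/mpoly_rind: al => [x|j|p q [D1 H1] [D2 H2]|p q [D1 H1] [D2 H2]].
- exists 0%N => D _; exists ((\prod_j B j) ^+ D * x%:MP); split.
  + by move=> y _; rewrite mevalM !mevalC rmorphXn rmorph_prod.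
  + by rewrite mevalM !mevalC.
  + by rewrite ddirM ddirC mulr0 add0r !mevalC.
- exists 1%N => -[//|D] _; rewrite exprSr (bigD1 j) //=.
  have [p ep] : exists p, p = \prod_(l | l != j) B l by eexists.
  have [q eq] : exists q, q = (B j * p) ^+ D by eexists.
  rewrite -ep -eq; exists (q * (p * A j)); split.
  + move=> y hy; have -> : \prod_l (B l).@[y 0] = (B j).@[y 0] * p.@[y 0].
      by rewrite (bigD1 j) //= ep rmorph_prod.
    rewrite mevalXU !mevalM eq rmorphXn /= mevalM.
    by move: (hy j) => hj; rewrite exprSr; field.
  + by rewrite !mevalM hz mevalXU; ring.
  + by rewrite !ddirM !mevalM hz hv mevalXU; ring.
- exists (D1 + D2)%N => D HD.
  have [|r1 [E1 F1 G1]] := H1 D; first by lia.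
  have [|r2 [E2 F2 G2]] := H2 D; first by lia.
  exists (r1 + r2); split.
  + by move=> y hy; rewrite !mevalD E1 // E2 // mulrDr.
  + by rewrite !mevalD F1 F2 mulrDr.
  + by rewrite ddirD G1 G2 mevalD mulrDl.
- exists (D1 + D2)%N => D HD.
  have [//|r1 [E1 F1 G1]] := H1 D1 _.
  have [|r2 [E2 F2 G2]] := H2 (D - D1)%N; first by lia.
  have eD : D = (D1 + (D - D1))%N by lia.
  exists (r1 * r2); split.
  + by move=> y hy; rewrite !mevalM E1 // E2 // [in RHS]eD exprD; ring.
  + by rewrite !mevalM F1 F2 [in RHS]eD exprD mevalM; ring.
  + by rewrite !ddirM G1 G2 F1 F2 [in RHS]eD exprD ddirM !mevalM; ring.
Qed.

Lemma translate (p : {mpoly K[E]}) : exists p' : {mpoly K[E]},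
  [/\ forall u : 'I_E -> K, p'.@[u] = p.@[fun k => u k + c 0 k],
      p'@_0 = p.@[c 0] &
      forall k, p'@_U_(k) = (p^`M(k)).@[c 0]].
Proof.
elim/mpoly_rind: p => [x|j|p q [p' [h0 h1 h2]] [q' [g0 g1 g2]]|p q [p' [h0 h1 h2]] [q' [g0 g1 g2]]].
- exists x%:MP; split; first by move=> u; rewrite !mevalC.
    by rewrite mcoeffC eqxx mulr1 mevalC.
  by move=> k; rewrite mcoeff_lin mderivC mcoeff0 meval0.
- exists ('X_j + (c 0 j)%:MP); split.
  + by move=> u; rewrite mevalD !mevalXU mevalC.
  + by rewrite -meval_at0 mevalD !mevalXU mevalC mxE add0r.
  + move=> k; rewrite mcoeff_lin mderivD mderivC addr0 mderivXU.
    by rewrite -meval_at0; case: eqP => _; rewrite ?meval1 ?meval0.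
- exists (p' + q'); split.
  + by move=> u; rewrite !mevalD h0 g0.
  + by rewrite mcoeffD h1 g1 mevalD.
  + by move=> k; rewrite mcoeffD h2 g2 mderivD mevalD.
- exists (p' * q'); split.
  + by move=> u; rewrite !mevalM h0 g0.
  + by rewrite rmorphM /= h1 g1 mevalM.
  + move=> k; rewrite mcoeff_lin mderivM mcoeffD !rmorphM /= -!mcoeff_lin h1 h2 g1 g2.
    by rewrite mderivM mevalD !mevalM.
Qed.

End Derivation.


(** Take a family of largest size with independent forms; a form not vanishing on all of their
    common zeros could be added to it. *)
Lemma independent_forms (K : fieldType) E (I : {mpoly K[E]} -> Prop)
    (g : {mpoly K[E]} -> 'rV[K]_E) :
  exists r (H : 'I_r -> {mpoly K[E]}),
    [/\ forall i, I (H i), row_free (\matrix_i g (H i)) &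
    forall v : 'rV[K]_E, (forall i, \sum_k g (H i) 0 k * v 0 k = 0) ->
      forall p, I p -> \sum_k g p 0 k * v 0 k = 0].
Proof.
pose Pr r := `[< exists H : 'I_r -> {mpoly K[E]},
  (forall i, I (H i)) /\ row_free (\matrix_i g (H i)) >].
have P0 : exists r, Pr r.
  exists 0%N; apply/asboolP; exists (fun=> 0); split; first by case.
  by apply: inj_row_free => u _; apply/rowP; case.
have Pb r : Pr r -> (r <= E)%N.
  by move=> /asboolP [H [_ /eqP <-]]; apply: rank_leq_col.
case: (ex_maxnP P0 Pb) => r /asboolP [H [IH fH]] hmax; exists r, H; split => //.
move=> v hv p Ip; apply/eqP; apply: contrapT => /negP pv.
suff /hmax : Pr r.+1 by rewrite ltnn.
apply/asboolP; exists (fun i => if unlift ord0 i is Some j then H j else p); split.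
  by move=> i; case: unliftP.
apply: inj_row_free => u hu.
have hk k : u 0 ord0 * g p 0 k + \sum_i u 0 (lift ord0 i) * g (H i) 0 k = 0.
  have := congr1 (fun w : 'rV_E => w 0 k) hu; rewrite !mxE big_ord_recl.
  rewrite !mxE unlift_none => h; rewrite -[RHS]h; congr (_ + _); apply: eq_bigr => i _.
  by rewrite !mxE liftK.
have u0 : u 0 ord0 = 0.
  have : \sum_k (u 0 ord0 * g p 0 k + \sum_i u 0 (lift ord0 i) * g (H i) 0 k) * v 0 k = 0.
    by rewrite big1 // => k _; rewrite hk mul0r.
  under eq_bigr do rewrite mulrDl mulr_suml -mulrA.
  rewrite big_split -mulr_sumr exchange_big /= [X in _ + X]big1 => [|i _].
    by rewrite addr0 => /eqP; rewrite mulf_eq0 (negbTE pv) orbF => /eqP.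
  under eq_bigr do rewrite -mulrA.
  by rewrite -mulr_sumr hv mulr0.
have : (\row_i u 0 (lift ord0 i)) *m (\matrix_i g (H i)) = 0.
  apply/rowP => k; have h := hk k; rewrite u0 mul0r add0r in h.
  rewrite [RHS]mxE -[RHS]h [LHS]mxE; apply: eq_bigr => i _.
  by rewrite !mxE.
move=> /(congr1 (mulmxr (pinvmx (\matrix_i g (H i))))) /=.
rewrite mulmxKp // mul0mx => /rowP u'0.
apply/rowP => i; rewrite [RHS]mxE; case: (unliftP ord0 i) => [j ->|-> //].
by have := u'0 j; rewrite !mxE.
Qed.

Section LocalCoordinates.
Variables (R : realType) (X : variety R) (n : nat).
Local Notation K := (R[i]).
Variables (e : 'rV[K]_n -> X) (a : 'rV[K]_n * X -> X) (V : set X) (e' : X -> 'rV[K]_n).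
Hypothesis TS : toric_structure e a V e'.
Hypothesis X_nonsing : nonsingular X.
Local Notation eA := (monomial_map e).
Local Notation center := (center e).

Lemma e_const1 : V (e (const_mx 1)) /\ e' (e (const_mx 1)) = const_mx 1.
Proof. by apply: (ts_eK TS) => k; rewrite mxE oner_eq0. Qed.

(** Near the unit of the torus, the chart coordinates and the n torus coordinates are rational
    functions of each other. By [ddir_clear], a tangent vector killed by the differentials of the
    torus coordinates is zero. This bounds by n the dimension occurring in [nonsingular]. *)
Lemma tangent_le (i : index X) (U : {vspace 'rV[K]_(edim i)}) : good i ->
  dom i (e (const_mx 1)) ->
  (forall v, v \in U -> tangent_vector (e (const_mx 1)) v) -> (\dim U <= n)%N.
Proof.
set x := e _ => gi dx hU; set E := edim i in U hU *.
have t1 : tor (const_mx 1 : 'rV[K]_n) by move=> k; rewrite mxE oner_eq0.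
have [Vx ex] := e_const1.
pose c := chart i x.
have /choice [A /choice [B hAB]] j : exists A B : {mpoly K[E]}, B.@[c 0] != 0 /\
    forall y, V y -> dom i y -> B.@[chart i y 0] != 0 ->
    e' y 0 j = A.@[chart i y 0] / B.@[chart i y 0].
  by have [_ /(_ i x Vx dx)] := e'_coord TS j.
have /choice [al /choice [be hab]] k : exists al be : {mpoly K[n]}, be.@[(const_mx 1 : 'rV[K]_n) 0] != 0 /\
    forall z, tor z -> dom i (e z) -> be.@[z 0] * chart i (e z) 0 k = al.@[z 0].
  exact: (e_rat TS (reg_chart k) t1 dx).
pose z j : K := e' x 0 j.
have B0 j : (B j).@[c 0] != 0 by case: (hAB j).
have zA j : (A j).@[c 0] = z j * (B j).@[c 0].
  by have [_ h] := hAB j; rewrite /z (h x Vx dx (B0 j)) divfK.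
have zE : z = (const_mx 1 : 'rV[K]_n) 0 by apply/funext => j; rewrite /z ex.
pose Mx : 'M[K]_(E, n) := \matrix_(k, j)
  (((A j)^`M(k)).@[c 0] - z j * ((B j)^`M(k)).@[c 0]).
have keyv v : tangent_vector x v -> v *m Mx = 0 -> v = 0.
  move=> tv vM.
  have hv j : ddir c v (A j) = z j * ddir c v (B j).
    have := congr1 (fun w : 'rV_n => w 0 j) vM; rewrite !mxE => /eqP h.
    apply/eqP; rewrite -subr_eq0 -(eqP h) /ddir mulr_sumr -sumrB; apply/eqP.
    by apply: eq_bigr => k _; rewrite !mxE mulrBr [in RHS]mulrCA ![v 0 k * _]mulrC.
  apply/rowP => k; rewrite [RHS]mxE.
  have [b0 hk] := hab k.
  have [D1 H1] := ddir_clear (al k) zA hv; have [D2 H2] := ddir_clear (be k) zA hv.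
  have [al' [ha1 ha2 ha3]] := H1 _ (leq_maxl D1 D2).
  have [be' [hb1 hb2 hb3]] := H2 _ (leq_maxr D1 D2).
  move: (maxn D1 D2) ha1 ha2 ha3 hb1 hb2 hb3 => D ha1 ha2 ha3 hb1 hb2 hb3.
  have rel y : dom i y -> ('X_k * be' - al').@[chart i y 0] = 0.
    pose W := (dom i `&` [set y | (\prod_j B j).@[chart i y 0] != 0]) `&` V.
    have rc (p : {mpoly K[E]}) : regular_on (dom i : set X) (fun y => p.@[chart i y 0]).
      exact: (@reg_meval _ _ _ _ (fun k y => chart i y 0 k) p gi (fun k => reg_chart k)).
    apply: (reg_eq_dense (rc _) (reg_const 0 gi) (W := W)).
    - by apply: zopenI; [exact: reg_nz_open (rc _)|exact: (ts_open TS)].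
    - exists x; split => //; split => //=; rewrite rmorph_prod.
      by apply/prodf_neq0 => j _; apply: B0.
    move=> {}y dy [[_ /= By] Vy]; rewrite mevalB mevalM mevalXU.
    have By' j : (B j).@[chart i y 0] != 0.
      by move: By; rewrite rmorph_prod => /prodf_neq0/(_ j isT).
    have [ty ey] := ts_e'K TS Vy.
    rewrite ha1 // hb1 //.
    have zy : (fun j => (A j).@[chart i y 0] / (B j).@[chart i y 0]) = e' y 0.
      by apply/funext => j; have [_ ->] := hAB j.
    rewrite zy -hk //; last by rewrite ey.
    by rewrite ey; ring.
  have := tv _ rel; rewrite -/(ddir c v _) ddirD ddirN ddirM ha3 hb3 hb2 ddirX mevalXU.
  have := hk _ t1 dx; rewrite -/c -zE => <-.
  set b := (be k).@[z]; set P := (\prod_j B j) ^+ D; rewrite -/(c 0 k).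
  have -> : c 0 k * (b * ddir c v P) + P.@[c 0] * b * v 0 k - b * c 0 k * ddir c v P
    = P.@[c 0] * b * v 0 k by ring.
  move=> /eqP; rewrite mulf_eq0 => /orP[|/eqP //]; rewrite mulf_eq0 /b zE (negbTE b0) orbF.
  rewrite /P rmorphXn rmorph_prod expf_eq0 => /andP[_ /prodf_eq0 [j _]].
  by rewrite (negbTE (B0 j)).
pose f : 'Hom('rV[K]_E, 'rV[K]_n) := linfun (mulmxr Mx).
have : (U :&: lker f)%VS = 0%VS.
  apply/eqP; rewrite -subv0; apply/subvP => v; rewrite memv_cap memv_ker lfunE /= memv0.
  by move=> /andP[/hU tv /eqP vM]; rewrite (keyv v tv vM).
move=> U0; have := limg_ker_dim f U; rewrite U0 dimv0 add0n => <-.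
by apply: leq_trans (dimvS (subvf _)) _; rewrite dimvf dim_matrix mul1r.
Qed.

(** The tangent space at x has the same dimension d <= n as at the unit of the torus, and it is cut
    out by the differentials of a maximal independent family of relations, which thus has at least E
    - n members. *)
Lemma tangent_relations (i : index X) x : good i -> dom i x ->
  exists r (H : 'I_r -> {mpoly K[edim i]}),
    [/\ (edim i <= r + n)%N, forall l y, dom i y -> (H l).@[chart i y 0] = 0 &
    row_free (\matrix_l \row_k ((H l)^`M(k)).@[chart i x 0])].
Proof.
move=> gi dx; have [d _ hd] := X_nonsing.
have dn : (d <= n)%N.
  have [j [gj dj]] := good_chart (e (const_mx 1)).
  have [U hU <-] := hd j _ dj; apply: (tangent_le gj dj) => v; exact: (proj1 (hU v)).
have [r [H [h1 h2 h3]]] := @independent_forms K (edim i)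
   (fun p => forall y, dom i y -> p.@[chart i y 0] = 0)
   (fun p => \row_k (p^`M(k)).@[chart i x 0]).
exists r, H; split => //.
have [U hU dU] := hd i x dx.
pose Mx : 'M[K]_(edim i, r) := \matrix_(k, l) ((H l)^`M(k)).@[chart i x 0].
pose f : 'Hom('rV[K]_(edim i), 'rV[K]_r) := linfun (mulmxr Mx).
have kU : (lker f <= U)%VS.
  apply/subvP => v; rewrite memv_ker lfunE /= => /eqP vM; apply/(proj2 (hU v)) => p hp.
  transitivity (\sum_k (\row_k (p^`M(k)).@[chart i x 0]) 0 k * v 0 k).
    by apply: eq_bigr => k _; rewrite mxE.
  apply: h3 hp.
  move=> l; have := congr1 (fun w : 'rV_r => w 0 l) vM; rewrite !mxE => h'; rewrite -[RHS]h'.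
  by apply: eq_bigr => k _; rewrite !mxE mulrC.
have := limg_ker_dim f fullv; rewrite capfv dimvf dim_matrix mul1r => {1}<-.
rewrite addnC; apply: leq_add; last by apply: leq_trans (dimvS kU) _; rewrite dU.
by apply: leq_trans (dimvS (subvf _)) _; rewrite dimvf dim_matrix mul1r.
Qed.

End LocalCoordinates.


(** * Charts at the torus-fixed points *)

Lemma reg_mexp (R : realType) (X : atlas R) q k (T : set X) (F : X -> 'rV[R[i]]_q)
    (A : 'M[int]_(q, k)) j : zopen T -> (forall l, regular_on T (fun x => F x 0 l)) ->
  (forall x, T x -> tor (F x)) -> regular_on T (fun x => mexp A (F x) 0 j).
Proof.
move=> oT rF F0.
have rp l (z : int) : regular_on T (fun x => F x 0 l ^ z).
  have rn m : regular_on T (fun x => F x 0 l ^+ m).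
    elim: m => [|m IH]; first exact: reg_const.
    by apply: reg_eq (regM (rF l) IH) => x _; rewrite exprS.
  case: z => m; first exact: rn.
  by apply: regV (rn m.+1) => x Tx; apply/expf_neq0/F0.
have := reg_meval (f := fun l x => F x 0 l ^ A l j) (\prod_l 'X_l) oT (fun l => rp l _).
apply: reg_eq => x _; rewrite mexpE rmorph_prod; apply: eq_bigr => l _.
exact: mevalXU.
Qed.

Section FixedChart.
Variables (R : realType) (X : variety R) (n : nat).
Local Notation K := (R[i]).
Variables (e : 'rV[K]_n -> X) (a : 'rV[K]_n * X -> X) (V : set X) (e' : X -> 'rV[K]_n).
Hypothesis TS : toric_structure e a V e'.
Local Notation eA := (monomial_map e).
Local Notation center := (center e).
Local Notation chartat := (chartat e).

Lemma reg_rational (W : set X) f (i : index X) x : regular_on W f -> W x -> dom i x ->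
  exists p q : {mpoly K[edim i]}, q.@[chart i x 0] != 0 /\
    forall y, W y -> dom i y -> q.@[chart i y 0] * f y = p.@[chart i y 0].
Proof.
move=> rf Wx dx; have [_ /(_ i x Wx dx) [p [q [qx h]]]] := rf.
exists (p * q), (q * q); rewrite mevalM mulf_neq0 //; split => // y Wy dy.
rewrite !mevalM; case: (eqVneq q.@[chart i y 0] 0) => [->|q0]; first by rewrite mulr0 !(mul0r, mulr0).
by rewrite (h y Wy dy q0) -mulrA [_ * (_ / _)]mulrCA divff // mulr1 mulrC.
Qed.

(** Rescaling w does not move the origin, so it does not change the limit there. *)
Lemma fixed_center (L : 'M[int]_n) p s : L \in unitmx -> center L 0 p -> tor s -> a (s, p) = p.
Proof.
move=> uL cp ts; pose t := mexp (invmx L) s.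
have tt0 : tor t by apply: mexp_tor.
have tE : mexp L t = s by rewrite /t mexp_mulmx // mulVmx // mexp1.
have := center_scale TS tt0 cp; rewrite tE.
have -> : map2_mx *%R t 0 = 0 :> 'rV[K]_n by apply/rowP => k; rewrite !mxE mulr0.
by move=> cp'; apply: center_uniq cp' cp.
Qed.

Hypothesis X_nonsing : nonsingular X.

(** The hypotheses of [local_toric_coordinates] are checked for the coordinates of X at p. The
    resulting monomials u = w^M are new torus coordinates, which changes L into N L with N the
    transposed inverse of the exponent matrix. *)
Lemma center_chartat (L : 'M[int]_n) p : L \in unitmx -> center L 0 p ->
  exists L' : 'M[int]_n, L' \in unitmx /\ chartat L' 0 p.
Proof.
move=> uL cp; have [i [gi dp]] := good_chart p.
pose c0 := chart i p; set E := edim i in c0.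
pose c (k : 'I_E) (w : 'rV[K]_n) := chart i (eA L w) 0 k - c0 0 k.
have c_reg k : regat 0 (c k) 0.
  have h := regatB (center_regat cp (reg_chart k) dp) (regat_const 0 (c0 0 k)).
  by rewrite subrr in h.
have gdi : gen (fun w => dom i (eA L w)).
  by apply: genW (center_gen cp gi dp) => w [].
have cE w (P : {mpoly K[E]}) : P.@[fun k => c k w + c0 0 k] = P.@[chart i (eA L w) 0].
  by apply: meval_eq => k; rewrite /c subrK.
have c_tangent : exists r (H : 'I_r -> {mpoly K[E]}),
    [/\ (E <= r + n)%N, forall i, rel_ideal c (H i) &
        row_free (\matrix_(i < r, k < E) (H i)@_U_(k))].
  have [r [H [h1 h2 h3]]] := tangent_relations TS X_nonsing gi dp.
  have /choice [H' hH'] l := translate c0 (H l).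
  exists r, H'; split => //.
    move=> l; apply: genW gdi => w dw; have [-> _ _] := hH' l.
    by rewrite cE; apply: h2.
  move: h3; congr (row_free _); apply/matrixP => l k; rewrite !mxE.
  by have [_ _ ->] := hH' l.
have c_torus t : tor t -> forall k, exists P Q : {mpoly K[E]},
    Q@_0 != 0 /\ gen (fun w => Q.@[fun k => c k w] * c k (map2_mx *%R t w) = P.@[fun k => c k w]).
  move=> tt0 k; have tLt := mexp_tor L tt0.
  have rf := act_reg TS tLt (reg_chart k : regular_on (dom i : set X) _).
  (* The torus fixes p, so a translated coordinate is still regular at p. *)
  have Wp : dom i (a (mexp L t, p)) by rewrite (fixed_center uL cp tLt).
  have [P [Q [Q0 h]]] := reg_rational rf Wp dp.
  have [Q' [hQ1 hQ2 _]] := translate c0 Q.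
  have [P' [hP1 hP2 _]] := translate c0 (P - (c0 0 k)%:MP * Q).
  exists P', Q'; split; first by rewrite hQ2.
  have := center_gen cp rf.1 Wp.
  apply: gen_and gdi => w dw [tw Ww]; rewrite hQ1 hP1 !cE mevalB mevalM mevalC.
  rewrite -(h _ Ww dw) {1}/c mulrBr; congr (_ - _); last by rewrite mulrC.
  by rewrite /monomial_map (ts_aE TS tLt (mexp_tor L tw)) -mexp_map2.
have e'w w : tor w -> mexp (invmx L) (e' (eA L w)) = w.
  move=> tw; have [_ ->] := ts_eK TS (mexp_tor L tw).
  by rewrite mexp_mulmx // mulmxV // mexp1.
have c_birat j : exists P Q : {mpoly K[E]},
    ~ rel_ideal c Q /\ gen (fun w : 'rV[K]_n => w 0 j * Q.@[fun k => c k w] = P.@[fun k => c k w]).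
  have [w1 [dw1 tw1]] := gen_ex (genI gdi (gen_tor K n)).
  have rm : regular_on (V : set X) (fun x => mexp (invmx L) (e' x) 0 j).
    apply: (@reg_mexp R X n n V e' (invmx L) j (ts_open TS) (fun l => e'_coord TS l)) => x Vx.
    by have [] := ts_e'K TS Vx.
  have Vw w : tor w -> V (eA L w) by move=> tw; case: (ts_eK TS (mexp_tor L tw)).
  have [P [Q [Q0 h]]] := reg_rational rm (Vw w1 tw1) dw1.
  have [Q' [hQ1 hQ2 _]] := translate c0 Q.
  have [P' [hP1 hP2 _]] := translate c0 P.
  exists P', Q'; split.
    move=> rQ; have := center_regat (center_eA TS L tw1) (reg_chart _) dw1.
    move=> hc; have hr := @regat_meval _ _ w1 _ (fun k w => chart i (eA L w) 0 k) _ Q hc.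
    move/eqP: Q0; apply; apply: regat_eq0 hr.
    by apply: genW rQ => w; rewrite hQ1 cE.
  apply: gen_and gdi (gen_tor K n) => w dw tw; rewrite hQ1 hP1 !cE -h //; last exact: Vw.
  by rewrite e'w // mulrC.
have [M [uM hM hc]] := local_toric_coordinates c_reg c_tangent c_torus c_birat.
set N := (invmx (expmx M))^T in hc.
have uN : N \in unitmx by rewrite unitmx_tr unitmx_inv.
have eAN u : tor u -> eA (N *m L) u = eA L (mexp N u).
  by move=> tu; rewrite /monomial_map mexp_mulmx.
exists (N *m L); split; first by rewrite unitmx_mul uN.
have pull (P : 'rV[K]_n -> Prop) : gen P -> gen (fun u => P (mexp N u)).
  by apply: (@gen_pull _ _ _ N (invmx N)); apply: mulVmx.
have gdN : gen (fun u => dom i (eA (N *m L) u)).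
  by apply: gen_and (gen_tor K n) (pull _ gdi) => u tu; rewrite eAN.
apply: (chartatI TS).
  apply: (center_chart TS gi dp gdN) => k.
  have := regatD (hc k) (regat_const 0 (c0 0 k)); rewrite add0r.
  apply: regat_ext; apply: genW (gen_tor K n) => u tu.
  by rewrite /c subrK eAN.
move=> k; have [P [Q [Q0 P0 hg]]] := hM k.
have rc (T : {mpoly K[E]}) : regular_on (dom i : set X) (fun x => T.@[fun k => chart i x 0 k - c0 0 k]).
  apply: (@reg_meval _ _ _ _ (fun k x => chart i x 0 k - c0 0 k) T gi) => l.
  have := regD (reg_chart l : regular_on (dom i : set X) _) (reg_const (- c0 0 l) gi); exact.
have oW := reg_nz_open (rc Q).
exists (dom i `&` [set x | Q.@[fun k => chart i x 0 k - c0 0 k] != 0]),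
  (fun x => P.@[fun k => chart i x 0 k - c0 0 k] / Q.@[fun k => chart i x 0 k - c0 0 k]); split.
- have sW (T : {mpoly K[E]}) := reg_sub oW (@subIsetl _ _ _) (rc T).
  by apply: regM => //; apply: regV => // x [].
- split => //=; have -> : (fun k => chart i p 0 k - c0 0 k) = (0 : 'rV[K]_E) 0.
    by apply/funext => l; rewrite subrr mxE.
  by rewrite meval_at0.
have gQ : gen (fun w => Q.@[fun k => c k w] != 0).
  have hQ := @regat_meval _ _ 0 _ c (fun=> 0) Q c_reg.
  apply: gen_neq_regat hQ _; move: Q0; rewrite -meval_at0.
  by congr (_ != _); apply: meval_eq => l; rewrite mxE.
have := pull _ (genI hg gQ); apply: gen_and (gen_tor K n) => u tu [h1 h2].
rewrite eAN //; apply: (mulIf h2); rewrite divfK // -h1 mulrC; congr (_ * _).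
rewrite meval_mexp // (bigD1 k) //= big1 ?mulr1 => [|l lk].
  rewrite (_ : dot _ _ = (expmx M *m invmx (expmx M)) k k).
    by rewrite mulmxV // mxE eqxx.
  by rewrite mxE; apply: eq_bigr => l _; rewrite !mxE.
rewrite (_ : dot _ _ = (expmx M *m invmx (expmx M)) k l).
  by rewrite mulmxV // mxE eq_sym (negbTE lk).
by rewrite mxE; apply: eq_bigr => j _; rewrite !mxE.
Qed.

End FixedChart.


(** * The fan *)

Section Monomial.
Variables (K : numFieldType) (q : nat).
Implicit Types (w : 'rV[K]_q).

Lemma regat_coord w0 k : regat w0 (fun w : 'rV[K]_q => w 0 k) (w0 0 k).
Proof.
have := regat_mevalM w0 ('X_k); rewrite mevalXU; apply: regat_ext.
by apply: gen_true => w; rewrite mevalXU.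
Qed.

Lemma regat_prod (I : Type) (r : seq I) w0 (f : I -> 'rV[K]_q -> K) v :
  (forall i, regat w0 (f i) (v i)) ->
  regat w0 (fun w => \prod_(i <- r) f i w) (\prod_(i <- r) v i).
Proof.
move=> h; elim: r => [|i r IH].
  by rewrite big_nil; apply: regat_ext (regat_const _ 1); apply: gen_true => w; rewrite big_nil.
by rewrite big_cons; apply: regat_ext (regatM (h i) IH); apply: gen_true => w; rewrite big_cons.
Qed.

Lemma regat_exp w0 f v m : regat w0 f v -> regat w0 (fun w => f w ^+ m) (v ^+ m).
Proof.
move=> h; elim: m => [|m IH].
  by rewrite expr0; apply: regat_ext (regat_const _ 1); apply: gen_true => w; rewrite expr0.
by rewrite exprS; apply: regat_ext (regatM h IH); apply: gen_true => w; rewrite exprS.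
Qed.

Lemma regat_exprz w0 f v (z : int) : regat w0 f v -> (v = 0 -> 0 <= z) ->
  regat w0 (fun w => f w ^ z) (v ^ z).
Proof.
case: z => m h h0; first exact: regat_exp.
have v0 : v != 0 by apply/eqP => /h0.
by apply: regatV; [rewrite expf_neq0|exact: regat_exp].
Qed.

Lemma regat_mexp n (C : 'M[int]_(q, n)) w0 l :
  (forall k, w0 0 k = 0 -> 0 <= C k l) ->
  regat w0 (fun w => mexp C w 0 l) (mexp C w0 0 l).
Proof.
move=> h; rewrite mexpE.
apply: (@regat_ext _ _ _ (fun w => \prod_k w 0 k ^ C k l)).
  by apply: gen_true => w; rewrite mexpE.
by apply: regat_prod => k; apply: regat_exprz (regat_coord w0 k) (h k).
Qed.

(** A negative exponent of w_k would give a polynomial identity b pos = a neg in which X_k divides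
    neg but not pos. Setting X_k = 0 yields a contradiction, as b remains non-zero by its value at
    w0. *)
Lemma regat_mexp_ge0 n (C : 'M[int]_(q, n)) w0 l v :
  regat w0 (fun w => mexp C w 0 l) v -> forall k, w0 0 k = 0 -> 0 <= C k l.
Proof.
move=> [a [b [b0 _ h]]] k wk; rewrite leNgt; apply/negP => Ck.
pose pos : {mpoly K[q]} := \prod_j 'X_j ^+ (if 0 <= C j l then absz (C j l) else 0).
pose neg : {mpoly K[q]} := \prod_j 'X_j ^+ (if 0 <= C j l then 0 else absz (C j l)).
have E : b * pos = a * neg.
  apply: gen_eq; apply: gen_and (gen_tor K q) h => w tw; rewrite !mevalM => <-.
  rewrite -mulrA; congr (_ * _); rewrite mexpE !rmorph_prod -big_split.
  apply: eq_bigr => j _ /=; rewrite !rmorphXn /= mevalXU.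
  case: (ltP (C j l) 0) => hj; rewrite expr0 ?mul1r ?mulr1.
    by case: (C j l) hj => // m _; rewrite NegzE abszN /= -exprnN mulVf // expf_neq0.
  by case: (C j l) hj => // m _; rewrite absz_nat.
pose h0 (j : 'I_q) : {mpoly K[q]} := if j == k then 0 else 'X_j.
have hE (p : {mpoly K[q]}) (w : 'rV[K]_q) :
  (mmap (@mpolyC _ K) h0 p).@[w 0] = p.@[fun j => if j == k then 0 else w 0 j].
  by rewrite meval_mmap; apply: meval_eq => j; rewrite /h0; case: eqP; rewrite ?meval0 ?mevalXU.
have b1 : mmap (@mpolyC _ K) h0 b != 0.
  apply: (@meval_neq0 _ _ w0); rewrite hE; move: b0; congr (_ != _).
  by apply: meval_eq => j; case: eqP => // ->.
have [w [tw bw]] := gen_ex (genI (gen_tor K q) (gen_neq0 b1)).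
have := congr1 (meval (fun j => if j == k then 0 else w 0 j)) E.
rewrite !mevalM => /eqP.
have -> : neg.@[fun j => if j == k then 0 else w 0 j] = 0.
  rewrite rmorph_prod (bigD1 k) //= rmorphXn /= mevalXU eqxx leNgt Ck /=.
  by rewrite expr0n absz_eq0 lt_eqF // mul0r.
rewrite mulr0 mulf_eq0 -hE (negbTE bw) /= rmorph_prod => /prodf_eq0 [j _].
rewrite rmorphXn /= mevalXU expf_eq0; case: (eqVneq j k) => [->|jk].
  by rewrite leNgt Ck.
by rewrite (negbTE (tw j)) andbF.
Qed.

End Monomial.

Section Fan.
Variables (R : realType) (X : variety R) (n : nat).
Local Notation K := (R[i]).
Variables (e : 'rV[K]_n -> X) (a : 'rV[K]_n * X -> X) (V : set X) (e' : X -> 'rV[K]_n).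
Hypothesis TS : toric_structure e a V e'.
Local Notation eA := (monomial_map e).
Local Notation center := (center e).
Local Notation chartat := (chartat e).

Lemma eA_chart q (A : 'M[int]_(q, n)) (s : 'M[int]_n) w : s \in unitmx -> tor w ->
  eA A w = eA s (mexp (A *m invmx s) w).
Proof.
by move=> us tw; rewrite /monomial_map mexp_mulmx // -mulmxA mulVmx // mulmx1.
Qed.

Lemma chart_transition q (A : 'M[int]_(q, n)) w0 x s v0 : s \in unitmx ->
  center A w0 x -> chartat s v0 x ->
  (forall k l, w0 0 k = 0 -> 0 <= (A *m invmx s) k l) /\ mexp (A *m invmx s) w0 = v0.
Proof.
move=> us cx [_ H].
have h l : regat w0 (fun w => mexp (A *m invmx s) w 0 l) (v0 0 l).
  have [W [f [rf Wx <- fw]]] := H l.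
  apply: regat_ext (center_regat cx rf Wx).
  apply: genW (center_gen cx rf.1 Wx) => w [tw Ww] /=.
  by rewrite (eA_chart A us tw) in Ww *; rewrite fw //; apply: mexp_tor.
have pos k l : w0 0 k = 0 -> 0 <= (A *m invmx s) k l by apply: regat_mexp_ge0 (h l) k.
split=> //; apply/rowP => l; apply: regat_uniq (h l); apply: regat_mexp => k; exact: pos.
Qed.

Lemma center_chartat_comp q (A : 'M[int]_(q, n)) (w0 : 'rV[K]_q) x s : s \in unitmx ->
  (forall k l, w0 0 k = 0 -> 0 <= (A *m invmx s) k l) ->
  chartat s (mexp (A *m invmx s) w0) x -> center A w0 x.
Proof.
move=> us pos [cx _]; have := center_comp cx pos erefl.
by rewrite -mulmxA mulVmx // mulmx1.
Qed.

Hypothesis X_complete : complete_variety X.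
Hypothesis X_nonsing : nonsingular X.

(** The limit point depends only on the signs t of the forms in B, so one chart for each sign vector
    that occurs gives a finite list. Any l lies in some coherent cone L; the chart at its limit has
    non-negative transition exponents from L, so its cone contains l. *)
Lemma fan_exists : exists S : seq 'M[int]_n,
  (forall s, s \in S -> s \in unitmx /\ forall w0, exists x, chartat s w0 x) /\
  forall l : 'rV[int]_n, exists2 s, s \in S & forall k, 0 <= (l *m invmx s) 0 k.
Proof.
have [B hB] := coherent_limit TS X_complete.
pose ok (t : {ffun seq_sub B -> bool}) L := [/\ L \in unitmx, coherent B L &
  forall b, t b <-> (forall k, 0 <= dot (val b) (row k L))].
have /choice [sg hsg] t : exists s : 'M[int]_n, (exists L, ok t L) ->
    s \in unitmx /\ exists x, (forall L, ok t L -> center L 0 x) /\ chartat s 0 x.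
  case: (pselect (exists L, ok t L)) => [[L okL]|no]; last by exists 0 => /no.
  have [uL cL tL] := okL; have [x hx] := hB L uL cL.
  have cx L' : ok t L' -> center L' 0 x.
    move=> [uL' cL' tL']; apply: hx => // b bB.
    by rewrite -(tL (SeqSub bB)) (tL' (SeqSub bB)).
  have [s [us ch]] := center_chartat TS X_nonsing uL (cx _ okL).
  by exists s => _; split => //; exists x.
exists [seq sg t | t <- enum {ffun seq_sub B -> bool} & `[< exists L, ok t L >]]; split.
  move=> s /mapP [t]; rewrite mem_filter => /andP[/asboolP okt _] ->.
  have [us [x [_ ch]]] := hsg t okt; split => //.
  exact: (chartat_all TS ch).
move=> l; have [L [uL cL [y y0 ly]]] := coherent_cone B l.
pose t : {ffun seq_sub B -> bool} := [ffun b => `[< forall k, 0 <= dot (val b) (row k L) >]].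
have okL : ok t L by split => // b; rewrite ffunE; split => /asboolP.
have [us [x [cx ch]]] := hsg t (ex_intro _ L okL).
exists (sg t).
  by apply: map_f; rewrite mem_filter mem_enum andbT; apply/asboolP; exists L.
move=> k; have [pos _] := chart_transition us (cx L okL) ch.
rewrite ly -mulmxA mxE; apply: sumr_ge0 => j _; apply: mulr_ge0 => //.
by apply: pos; rewrite mxE.
Qed.

End Fan.


(** * The charts of the fan cover X *)

Section Cover.
Variables (R : realType) (X : variety R) (n : nat).
Local Notation K := (R[i]).
Variables (e : 'rV[K]_n -> X) (a : 'rV[K]_n * X -> X) (V : set X) (e' : X -> 'rV[K]_n).
Hypothesis TS : toric_structure e a V e'.
Local Notation eA := (monomial_map e).
Local Notation center := (center e).
Local Notation chartat := (chartat e).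

Lemma e_determines (W W' : set X) f g x : regular_on W f -> regular_on W' g ->
  W x -> W' x -> gen (fun z => f (e z) = g (e z)) -> f x = g x.
Proof.
move=> rf rg Wx W'x [Q Q0 hQ].
have oW := zopenI rf.1 rg.1.
have rf' := reg_sub oW (@subIsetl _ _ _) rf.
have rg' := reg_sub oW (@subIsetr _ _ _) rg.
have rQ := @reg_meval R X V n (fun l x => e' x 0 l) Q (ts_open TS) (fun l => e'_coord TS l).
apply: (reg_eq_dense rf' rg' (reg_nz_open rQ)) => //.
  have [z [Qz tz]] := gen_ex (genI (gen_neq0 Q0) (gen_tor K n)).
  have [Vz ez] := ts_eK TS tz; exists (e z); split; first exact: Vz.
  by move: Qz; rewrite -{1}ez.
move=> y _ [Vy /= Qy]; have [ty <-] := ts_e'K TS Vy; exact: hQ.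
Qed.

(** The local ring of x with evaluation at x, viewed inside the field of rational functions on the
    torus. *)
Lemma point_place x : exists A phi, place A phi /\
  forall (W : set X) f, regular_on W f -> W x -> A (f \o e) /\ phi (f \o e) = f x.
Proof.
pose rep (F : 'rV[K]_n -> K) (Wf : set X * (X -> K)) :=
  [/\ regular_on Wf.1 Wf.2, Wf.1 x & gen (fun z => F z = Wf.2 (e z))].
pose A F := exists Wf, rep F Wf.
pose phi F := if pselect (A F) is left h then (projT1 (cid h)).2 x else 0.
have phiE F Wf : rep F Wf -> phi F = Wf.2 x.
  move=> r; rewrite /phi; case: pselect => [h|[]]; last by exists Wf.
  case: (cid h) => Wf' [r1 w1 g1] /=; have [r2 w2 g2] := r.
  by apply: e_determines r1 r2 w1 w2 _; apply: gen_and g1 g2 => z -> ->.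
exists A, phi; split; last first.
  move=> W f rf Wx; have r : rep (f \o e) (W, f) by split => //; apply: gen_true.
  by split; [exists (W, f)|rewrite (phiE _ _ r)].
split.
- move=> c; have r : rep (fun=> c) (setT, fun=> c).
    by split => //=; [exact/reg_const/zopenT|apply: gen_true].
  by split; [exists (setT, fun=> c)|rewrite (phiE _ _ r)].
- move=> f g [[W f'] [rf Wx gf]] [[W' g'] [rg W'x gg]]; simpl in *.
  have oW := zopenI rf.1 rg.1.
  have r : rep (fun z => f z + g z) (W `&` W', fun y => f' y + g' y).
    split => //=; last by apply: gen_and gf gg => z -> ->.
    by apply: regD; [apply: reg_sub rf|apply: reg_sub rg] => // y [].
  split; first by exists (W `&` W', fun y => f' y + g' y).
  by rewrite (phiE _ _ r) (phiE f (W, f')) // (phiE g (W', g')).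
- move=> f g [[W f'] [rf Wx gf]] [[W' g'] [rg W'x gg]]; simpl in *.
  have oW := zopenI rf.1 rg.1.
  have r : rep (fun z => f z * g z) (W `&` W', fun y => f' y * g' y).
    split => //=; last by apply: gen_and gf gg => z -> ->.
    by apply: regM; [apply: reg_sub rf|apply: reg_sub rg] => // y [].
  split; first by exists (W `&` W', fun y => f' y * g' y).
  by rewrite (phiE _ _ r) (phiE f (W, f')) // (phiE g (W', g')).
- move=> f g fg [Wf r].
  have r' : rep g Wf by case: r => r1 r2 r3; split => //; apply: gen_and fg r3 => z -> ->.
  by split; [exists Wf|rewrite (phiE _ _ r) (phiE _ _ r')].
Qed.

Variable S : seq 'M[int]_n.
Hypothesis S_charts : forall s, s \in S -> s \in unitmx /\ forall w0, exists x, chartat s w0 x.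
Hypothesis S_complete : forall l : 'rV[int]_n, exists2 s, s \in S &
  forall k, 0 <= (l *m invmx s) 0 k.

Lemma place_center x s A phi : s \in unitmx -> place A phi ->
  (forall (W : set X) f, regular_on W f -> W x -> A (f \o e) /\ phi (f \o e) = f x) ->
  (forall l, A (fun z => mexp (invmx s) z 0 l)) ->
  forall x', chartat s (\row_l phi (fun z => mexp (invmx s) z 0 l)) x' -> x' = x.
Proof.
move=> us pA hx hs x'; set w0 := \row_l _ => -[cx' _].
have [i [gi dx]] := good_chart x; have [j [gj dx']] := good_chart x'.
have /choice [c /choice [d hcd]] k :
    regat w0 (fun w => chart j (eA s w) 0 k) (chart j x' 0 k).
  exact: (center_regat cx' (reg_chart k) dx').
have [B [Sp ->] hB] := variety_separated (i, j).
suff : [set xy : X * X | xy.1 = xy.2] (x, x') by move=> /= ->.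
apply/(proj2 (hB (x, x') (conj dx dx'))) => P SP /=.
pose m := (edim i + n)%N.
have /choice [c' hc'] k := pull_snd (edim i) (c k).
have /choice [d' hd'] k := pull_snd (edim i) (d k).
pose num (l : 'I_(edim i + edim j)) : {mpoly K[m]} :=
  match split l with inl k => 'X_(lshift n k) | inr k => c' k end.
pose den (l : 'I_(edim i + edim j)) : {mpoly K[m]} :=
  match split l with inl k => 1 | inr k => d' k end.
have [D /(_ D (leqnn D)) [P' hP']] := clear_denom num den P.
pose F (l : 'I_m) (z : 'rV[K]_n) : K :=
  row_mx (chart i (e z)) (mexp (invmx s) z) 0 l.
have hF l : A (F l) /\ phi (F l) = row_mx (chart i x) w0 0 l.
  have [_ _ _ hE] := pA; case: (splitP l) => k ek.
    have -> : l = lshift n k by apply/val_inj.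
    rewrite row_mxEl; have [Ak <-] := hx _ _ (reg_chart k) dx; apply: hE Ak.
    by apply: gen_true => z; rewrite /F row_mxEl.
  have -> : l = rshift (edim i) k by apply/val_inj.
  rewrite row_mxEr /w0 mxE; apply: hE (hs k).
  by apply: gen_true => z; rewrite /F row_mxEr.
have [_ eP] := place_meval P' pA (fun l => proj1 (hF l)).
have P'0 : P'.@[row_mx (chart i x) w0 0] = 0.
  rewrite (meval_eq (v2 := fun l => phi (F l))); last by move=> l; case: (hF l).
  rewrite -eP; have [hC _ _ hE] := pA; have [A0 <-] := hC 0; apply: (proj2 (hE _ _ _ A0)).
  have gw : gen (fun w => dom j (eA s w) /\ forall k, (d k).@[w 0] != 0 /\
      (d k).@[w 0] * chart j (eA s w) 0 k = (c k).@[w 0]).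
    apply: genI; first by apply: genW (center_gen cx' gj dx') => w [].
    apply: gen_all => k; have [d0 _ h] := hcd k.
    by apply: genI h; apply/gen_neq0/(meval_neq0 d0).
  have gz := gen_pull (mulmxV us) gw.
  have oi : dom i !=set0 by exists x.
  apply: gen_and gz (e_gen TS gi oi) => z [dj hz] [tz di].
  have ez : eA s (mexp (invmx s) z) = e z by rewrite /monomial_map mexp_mulmx // mulVmx // mexp1.
  rewrite ez in dj hz.
  have dn l : (den l).@[F^~ z] != 0.
    rewrite /den; case: (split l) => k; first by rewrite meval1 oner_eq0.
    by rewrite /F hd'; case: (hz k).
  apply/esym; rewrite -[LHS]/(P'.@[(row_mx (chart i (e z)) (mexp (invmx s) z)) 0]) hP' //.
  have := proj1 (hB (e z, e z) (conj di dj)) erefl P SP => /= E.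
  rewrite -[RHS](mulr0 ((\prod_l (den l).@[F^~ z]) ^+ D)) -E; congr (_ * _).
  apply: meval_eq => l; rewrite /num /den mxE; case: (split l) => k.
    by rewrite mevalXU meval1 divr1 row_mxEl.
  by rewrite hc' hd'; have [d0 <-] := hz k; rewrite mulrC mulKf.
have dn l : (den l).@[row_mx (chart i x) w0 0] != 0.
  rewrite /den; case: (split l) => k; first by rewrite meval1 oner_eq0.
  by rewrite hd'; case: (hcd k).
move: P'0; rewrite hP' // => /eqP; rewrite mulf_eq0 expf_eq0 => /orP[/andP[_ /prodf_eq0 [l _]]|/eqP E].
  by rewrite (negbTE (dn l)).
rewrite -[RHS]E; apply: meval_eq => l; rewrite /num /den mxE; case: (split l) => k.
  by rewrite mevalXU meval1 divr1 row_mxEl.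
by rewrite hc' hd'; have [d0 <- _] := hcd k; rewrite mulrC mulKf.
Qed.

(** Extend the place of x so that every chart monomial has a finite value or an inverse of value 0.
    If x were in no chart, each cone would have a monomial of the second kind. By [gordan], either
    some lattice vector has a negative coordinate in every cone, against completeness, or a
    non-trivial product of the inverses is the constant 1, although its value is 0. *)
Lemma charts_cover x : exists2 s, s \in S & exists w0, chartat s w0 x.
Proof.
have [A0 [phi0 [p0 h0]]] := point_place x.
pose T := ('M[int]_n * 'I_n)%type.
pose b (sl : T) z : K := mexp (invmx sl.1) z 0 sl.2.
have gb sl : gen (fun z => b sl z != 0).
  by apply: genW (gen_tor K n) => z tz; apply: mexp_tor.
have [A [phi [pA hA hb]]] := place_valuative_seq [seq (s, l) | s <- S, l <- enum 'I_n] p0 gb.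
have hx (W : set X) f : regular_on W f -> W x -> A (f \o e) /\ phi (f \o e) = f x.
  by move=> rf Wx; have [/hA [? ->] ?] := h0 W f rf Wx.
have inT (s : 'M[int]_n) (l : 'I_n) : s \in S -> (s, l) \in [seq (s, l) | s <- S, l <- enum 'I_n].
  by move=> sS; apply: allpairs_f => //; rewrite mem_enum.
case: (pselect (exists2 s, s \in S & forall l, A (b (s, l)))) => [[s sS As]|no].
  have [us /(_ (\row_l phi (b (s, l)))) [x' ch]] := S_charts sS.
  exists s => //; exists (\row_l phi (b (s, l))).
  by rewrite -(place_center us pA hx As ch).
pose N := size S.
have /choice [l hl] (i : nat) : exists l : option 'I_n, (i < N)%N ->
    exists2 l', l = Some l' & A (fun z => (b (nth 0 S i, l') z)^-1) /\
      phi (fun z => (b (nth 0 S i, l') z)^-1) = 0.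
  case: (ltnP i N) => iN; last by exists None.
  have sS := mem_nth 0 iN.
  have /existsNP [l' nA] : ~ forall l, A (b (nth 0 S i, l)) by move=> h; apply: no; exists (nth 0 S i).
  by exists (Some l') => _; exists l' => //; case: (hb _ (inT _ l' sS)).
pose bb i : 'rV[int]_n := if l i is Some l' then - (col l' (invmx (nth 0 S i)))^T else 0.
have [[lam hlam]|[r [[i0 i0N ri0] rel]]] := gordan bb N.
  have [s sS hs] := S_complete lam.
  have iN : (seq.index s S < N)%N by rewrite index_mem.
  have [l' el _] := hl _ iN; have := hlam _ iN; rewrite /bb el nth_index //.
  have := hs l'; rewrite mxE /dot => h; rewrite ltNge => /negP; case.
  rewrite -oppr_ge0 -sumrN; move: h; congr (_ <= _); apply: eq_bigr => j _.
  by rewrite !mxE; ring.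
pose u (i : 'I_N) z : K := if l i is Some l' then (b (nth 0 S i, l') z)^-1 else 0.
have Au i : A (u i) /\ phi (u i) = 0.
  by have [l' el h] := hl i (ltn_ord i); rewrite /u el.
have [hC _ _ hE] := pA.
have [A1 e1] := place_meval (\prod_i 'X_i ^+ r i) pA (fun i => proj1 (Au i)).
have [_ e2] := hC 1.
suff E : phi (fun w => (\prod_i 'X_i ^+ r i).@[u^~ w]) = phi (fun=> 1).
  have : (\prod_i 'X_i ^+ r i).@[fun i => phi (u i)] = 1 by rewrite -e1 E e2.
  rewrite rmorph_prod (bigD1 (Ordinal i0N)) //= rmorphXn /= mevalXU.
  have [_ ->] := Au (Ordinal i0N); rewrite /= expr0n (negbTE ri0) mul0r => /eqP.
  by rewrite eq_sym oner_eq0.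
apply: (proj2 (hE _ _ _ (proj1 (hC 1)))); apply: genW (gen_tor K n) => z tz.
rewrite rmorph_prod /=.
have uE i : u i z = \prod_k z 0 k ^ bb i 0 k.
  have [l' el _] := hl i (ltn_ord i); rewrite /u /bb el /b mexpE /= -prodfV.
  by apply: eq_bigr => k _; rewrite !mxE invr_expz.
apply/esym; transitivity (\prod_(i < N) \prod_k z 0 k ^ ((r i)%:Z * bb i 0 k)).
  by apply: eq_bigr => i _; rewrite rmorphXn /= mevalXU uE exprnP exprz_prod; apply: eq_bigr => k _; rewrite exprz_exp mulrC.
rewrite exchange_big big1 // => k _ /=; rewrite -exprz_sum //.
have -> : \sum_(i < N) (r i)%:Z * bb i 0 k = (\sum_(i < N) (r i)%:Z *: bb i) 0 k.
  by rewrite summxE; apply: eq_bigr => i _; rewrite mxE.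
by rewrite rel mxE expr0z.
Qed.

End Cover.


(** * Points of prime divisors *)

Section PrimePoint.

Lemma prime_pseudo_dvd (A : idomainType) (f g : {poly A}) : prime_elt f ->
  (1 < size f)%N -> (1 < size (gcdp f g))%N -> dvd f g.
Proof.
move=> [f0 fu pf] sf sh; set h := gcdp f g in sh.
have nconst c : c != 0 -> ~ dvd f c%:P.
  move=> c0 [k e]; have k0 : k != 0.
    by apply: contraNneq c0 => k0; rewrite -polyC_eq0 e k0 mul0r.
  have := congr1 (fun p : {poly A} => size p) e.
  rewrite size_polyC c0 size_mul // => /esym/eqP.
  by move: sf; rewrite -size_poly_gt0 in k0; move: (size f) (size k) k0 => x y; lia.
have /Pdiv.Idomain.dvdpP [[c k] /= c0 e] : h %| f by apply: Pdiv.CommonIdomain.dvdp_gcdl.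
have /Pdiv.Idomain.dvdpP [[d l] /= d0 e'] : h %| g by apply: Pdiv.CommonIdomain.dvdp_gcdr.
have : dvd f (k * h) by exists c%:P; rewrite -e mul_polyC.
move=> /pf [[m em]|[m em]].
  exfalso; have : c%:P = m * h.
    by apply: (mulIf f0); rewrite mul_polyC e em mulrAC.
  move=> E; have m0 : m != 0 by apply: contraNneq c0 => m0; rewrite -polyC_eq0 E m0 mul0r.
  have h0 : h != 0 by rewrite -size_poly_gt0; apply: ltnW.
  have := congr1 (fun p : {poly A} => size p) E; rewrite size_polyC c0 size_mul // => /esym/eqP.
  by rewrite -size_poly_gt0 in m0; move: (size m) (size h) m0 sh => x y; lia.
have : dvd f (d%:P * g) by exists (l * m); rewrite mul_polyC e' em mulrA.
by move=> /pf [/(nconst d d0)|].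
Qed.

Variable K : numClosedFieldType.

Lemma prime_dvd_iso (A B : idomainType) (f : {rmorphism A -> B}) (g : {rmorphism B -> A}) p :
  cancel f g -> cancel g f -> prime_elt p -> prime_elt (f p).
Proof.
move=> fg gf [p0 pu pp]; split.
- by apply: contraNneq p0 => e; rewrite -[p]fg e rmorph0.
- by apply: contra pu => /(rmorph_unit g); rewrite fg.
move=> a b [c e]; have : dvd p (g a * g b) by exists (g c); rewrite -rmorphM e rmorphM fg.
by move=> /pp [[d ed]|[d ed]]; [left|right]; exists (f d); rewrite -rmorphM -ed gf.
Qed.

Definition last_coord n (u : 'rV[K]_n) x : 'rV[K]_n.+1 :=
  \row_k if unlift ord_max k is Some j then u 0 j else x.

Lemma meval_last_coord n (p : {mpoly K[n.+1]}) u x :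
  p.@[last_coord u x 0] = (map_poly (meval (u 0)) (split_last p)).[x].
Proof.
rewrite meval_split_last mxE unlift_none; congr (_.[_]).
apply: eq_map_poly => q; apply: meval_eq => j /=; by rewrite mxE liftK.
Qed.

(** If f involves the last variable and g is not constant in it, their resultant is a non-zero
    polynomial in the other variables. Choose u where neither it nor the leading coefficient of f
    vanishes: a root of f(u, -) exists and is not a root of g(u, -). If f does not involve the last
    variable, apply the induction to a coefficient of g that f does not divide. *)
Lemma prime_point_step n (f g : {poly {mpoly K[n]}}) :
  (forall q p : {mpoly K[n]}, prime_elt q -> ~ dvd q p ->
    exists w : 'rV[K]_n, q.@[w 0] = 0 /\ p.@[w 0] != 0) ->
  prime_elt f -> ~ dvd f g ->
  exists u x, (map_poly (meval ((u : 'rV[K]_n) 0)) f).[x] = 0 /\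
    (map_poly (meval (u 0)) g).[x] != 0.
Proof.
move=> IH pf nfg; have [f0 fu _] := pf.
case: (leqP (size f) 1) => sf.
  have ef := size1_polyC sf; move: (f`_0) ef => c ef.
  have pc : prime_elt c.
    split.
    - by apply: contraNneq f0 => e; rewrite ef e polyC0.
    - by apply: contra fu; rewrite ef; apply: rmorph_unit.
    move=> a b [d e]; have [_ _ /(_ a%:P b%:P)] := pf.
    case; first by exists d%:P; rewrite -polyCM e polyCM ef.
      move=> [k ek]; left; exists k`_0; have := congr1 (fun p : {poly _} => p`_0) ek.
      by rewrite ef coefC eqxx coefMC.
    move=> [k ek]; right; exists k`_0; have := congr1 (fun p : {poly _} => p`_0) ek.
    by rewrite ef coefC eqxx coefMC.
  have /existsNP [i ni] : ~ forall i, dvd c g`_i by move=> h; apply: nfg; rewrite ef; apply: dvd_polyC.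
  have [u [cu gu]] := IH _ _ pc ni.
  have : map_poly (meval (u 0)) g != 0.
    by apply: contraNneq gu => e; rewrite -coef_map e coef0.
  move=> /poly_nonroot [x hx]; exists u, x; split => //.
  by rewrite ef map_polyC /= cu hornerC.
have key (r : {mpoly K[n]}) : r != 0 -> exists u : 'rV[K]_n, r.@[u 0] != 0 /\
    exists x, (map_poly (meval (u 0)) f).[x] = 0.
  move=> r0; have /mpoly_nonzero [u] : r * lead_coef f != 0 by rewrite mulf_neq0 ?lead_coef_eq0.
  rewrite mevalM mulf_eq0 negb_or => /andP[ru lu]; exists u; split => //.
  have : size (map_poly (meval (u 0)) f) != 1%N.
    rewrite size_map_poly_id0 //; by case: (size f) sf => [|[]].
  by move=> /closed_rootP [x /eqP]; exists x.
have g0 : g != 0 by apply/eqP => e; apply: nfg; exists 0; rewrite e mul0r.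
case: (leqP (size g) 1) => sg.
  have eg := size1_polyC sg; move: (g`_0) eg => c eg.
  have [|u [cu [x hx]]] := key c; first by apply: contraNneq g0 => e; rewrite eg e polyC0.
  by exists u, x; split => //; rewrite eg map_polyC /= hornerC.
have [[v w] /= _ E] := resultant_in_ideal sf sg.
have : resultant f g != 0.
  by rewrite resultant_eq0; apply/negP => /(prime_pseudo_dvd pf sf).
move=> /key [u [ru [x hx]]]; exists u, x; split => //.
have := congr1 (fun p => (map_poly (meval (u 0)) p).[x]) E.
rewrite map_polyC /= hornerC rmorphD !rmorphM hornerD !hornerM /= hx mulr0 add0r => e.
by move: ru; rewrite e mulf_eq0 negb_or => /andP[].
Qed.

Lemma prime_point n (q p : {mpoly K[n]}) : prime_elt q -> ~ dvd q p ->
  exists w : 'rV[K]_n, q.@[w 0] = 0 /\ p.@[w 0] != 0.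
Proof.
elim: n q p => [|n IH] q p pq npq.
  have [q0 qu _] := pq; case/negP: qu; rewrite [q]nvar0_mpolyC.
  apply: rmorph_unit; rewrite unitfE; apply: contraNneq q0 => e.
  by rewrite [q]nvar0_mpolyC e mpolyC0.
have pf := prime_dvd_iso (@split_lastK K n) (@join_lastK K n) pq.
have [|u [x [h1 h2]]] := prime_point_step IH pf (g := split_last p).
  move=> [c e]; apply: npq; exists (join_last c).
  have jM : join_last (c * split_last q) = join_last c * join_last (split_last q).
    exact: (rmorphM (@join_last K n)).
  rewrite -[LHS](split_lastK p) e.
  by move: jM; rewrite (split_lastK q).
by exists (last_coord u x); rewrite !meval_last_coord.
Qed.

End PrimePoint.


(** * Homogeneous coordinates *)

(* The rows of U are the rays of the fan formed by the cones s \in S, each of  *)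
(* which is spanned by the rows of the unimodular matrix s.                   *)
Record fan_structure (R : realType) (X : variety R) n (e : 'rV[R[i]]_n -> X)
  (S : seq 'M[int]_n) N (U : 'M[int]_(N, n)) : Prop := FanStructure {
  fan_unit : forall s, s \in S -> s \in unitmx;
  fan_charts : forall s, s \in S -> forall w0, exists x, chartat e s w0 x;
  fan_complete : forall l : 'rV[int]_n, exists2 s, s \in S &
    forall k, 0 <= (l *m invmx s) 0 k;
  fan_cover : forall x, exists2 s, s \in S & exists w0, chartat e s w0 x;
  fan_inj : injective (fun j => row j U);
  fan_rows : forall s k, s \in S -> exists j, row j U = row k s;
  fan_ray : forall j, exists2 s, s \in S & exists k, row j U = row k s }.

Section Rays.
Variables (R : realType) (X : variety R) (n : nat).
Local Notation K := (R[i]).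
Variables (e : 'rV[K]_n -> X) (a : 'rV[K]_n * X -> X) (V : set X) (e' : X -> 'rV[K]_n).
Hypothesis TS : toric_structure e a V e'.
Local Notation eA := (monomial_map e).
Local Notation center := (center e).
Local Notation chartat := (chartat e).

Variables (S : seq 'M[int]_n) (N : nat) (U : 'M[int]_(N, n)).
Hypothesis FS : fan_structure e S U.

Let S_unit s : s \in S -> s \in unitmx. Proof. by case: FS => /(_ s). Qed.
Let S_charts s : s \in S -> forall w0, exists x, chartat s w0 x.
Proof. by case: FS => _ /(_ s). Qed.
Let S_complete (l : 'rV[int]_n) : exists2 s, s \in S & forall k, 0 <= (l *m invmx s) 0 k.
Proof. by case: FS => _ _ /(_ l). Qed.
Let S_cover x : exists2 s, s \in S & exists w0, chartat s w0 x.
Proof. by case: FS => _ _ _ /(_ x). Qed.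
Let U_inj : injective (fun j => row j U). Proof. by case: FS. Qed.
Let U_rows s k : s \in S -> exists j, row j U = row k s.
Proof. by case: FS => _ _ _ _ _ /(_ s k). Qed.
Let U_ray j : exists2 s, s \in S & exists k, row j U = row k s.
Proof. by case: FS => _ _ _ _ _ _ /(_ j). Qed.

Definition ray (s : 'M[int]_n) j := [exists k, row j U == row k s].

Lemma rayP s j : reflect (exists k, row j U = row k s) (ray s j).
Proof. by apply: (iffP existsP) => -[k] => [/eqP|] h; exists k => //; apply/eqP. Qed.

Lemma row_chart s j k l : s \in unitmx -> row j U = row k s ->
  (U *m invmx s) j l = (k == l)%:R.
Proof.
move=> us e0; have := congr1 (fun v => (v *m invmx s) 0 l) e0.
by rewrite -!row_mul mulmxV // !mxE.
Qed.

Lemma row_chart_inj s j k l : s \in unitmx -> row j U = row k s -> row j U = row l s -> k = l.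
Proof.
move=> us ek el; have := row_chart l us el; rewrite (row_chart l us ek) eqxx.
by case: (k =P l).
Qed.

(** Selects the rays of s among all rays, turning coordinates in the cone s into coordinates in
    K^N. *)
Definition emb (s : 'M[int]_n) : 'M[int]_(n, N) := \matrix_(k, j) (row j U == row k s)%:R.

Lemma emb_mul s : s \in S -> emb s *m U = s.
Proof.
move=> sS; apply/row_matrixP => k; have [j ej] := U_rows k sS.
apply/rowP => l; rewrite !mxE (bigD1 j) //= mxE ej eqxx mul1r big1 ?addr0.
  by have := congr1 (fun v : 'rV_n => v 0 l) ej; rewrite !mxE.
move=> i ij; rewrite mxE; case: eqP => [e0|]; last by rewrite mul0r.
by case/eqP: ij; apply: U_inj; rewrite e0.
Qed.

Lemma emb_left_inverse s : s \in S -> (invmx s *m emb s) *m U = 1%:M.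
Proof. by move=> sS; rewrite -mulmxA emb_mul // mulVmx // S_unit. Qed.

Lemma emb_supp s (c : 'rV[int]_n) j : (c *m emb s) 0 j != 0 -> ray s j.
Proof.
rewrite mxE => h; apply/rayP; apply: contrapT => no; case/eqP: h.
apply: big1 => k _; rewrite mxE; case: eqP => [e0|]; last by rewrite mulr0.
by case: no; exists k.
Qed.

Lemma emb_ge0 s (c : 'rV[int]_n) j : (forall k, 0 <= c 0 k) -> 0 <= (c *m emb s) 0 j.
Proof. by move=> c0; rewrite mxE; apply: sumr_ge0 => k _; rewrite mxE mulr_ge0. Qed.

Lemma cone_coef s (b : 'rV[int]_N) k j : s \in S ->
  (forall i, b 0 i != 0 -> ray s i) -> row j U = row k s ->
  (b *m U *m invmx s) 0 k = b 0 j.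
Proof.
move=> sS hb ej; have us := S_unit sS; rewrite -mulmxA mxE (bigD1 j) //=.
rewrite (row_chart k us ej) eqxx mulr1 big1 ?addr0 // => i ij.
case: (eqVneq (b 0 i) 0) => [->|/hb /rayP [l el]]; first by rewrite mul0r.
rewrite (row_chart k us el); case: eqP => [lk|]; last by rewrite mulr0.
by case/eqP: ij; apply: U_inj; rewrite el lk ej.
Qed.

Lemma cone_rep_emb s (b : 'rV[int]_N) : s \in S -> (forall i, b 0 i != 0 -> ray s i) ->
  b = b *m U *m invmx s *m emb s.
Proof.
move=> sS hb; apply/rowP => j; rewrite mxE.
case: (boolP (ray s j)) => [/rayP [k ej]|nr]; last first.
  rewrite big1 => [|k _]; first by apply/eqP/negPn/negP => /hb; apply/negP.
  rewrite [emb _ _ _]mxE; case: (row j U =P row k s) => [e0|]; last by rewrite mulr0.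
  by case/negP: nr; apply/rayP; exists k.
rewrite (bigD1 k) //= (cone_coef sS hb ej) [emb _ _ _]mxE ej eqxx mulr1 big1 ?addr0 // => l lk.
rewrite [emb _ _ _]mxE; case: (row j U =P row l s) => [e0|]; last by rewrite mulr0.
by case/eqP: lk; apply: row_chart_inj (S_unit sS) e0 ej.
Qed.

Lemma cone_exists (l : 'rV[int]_n) : exists2 s, s \in S & exists b : 'rV[int]_N,
  [/\ forall j, 0 <= b 0 j, forall j, b 0 j != 0 -> ray s j & b *m U = l].
Proof.
have [s sS hs] := S_complete l; exists s => //; exists (l *m invmx s *m emb s); split.
- by move=> j; apply: emb_ge0.
- by move=> j; apply: emb_supp.
- by rewrite -mulmxA emb_mul // -mulmxA mulVmx ?mulmx1 // S_unit.
Qed.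

(** The one-parameter subgroup t |-> e(t^(b U)) tends, as t goes to 0, to the point of the chart s
    whose coordinates are 0 on the rays occurring in b and 1 on the others. *)
Lemma cone_limit s (b : 'rV[int]_N) : s \in S -> (forall j, 0 <= b 0 j) ->
  (forall j, b 0 j != 0 -> ray s j) ->
  exists x, center (b *m U) 0 x /\ exists2 v0, chartat s v0 x &
    forall k, (v0 0 k == 0) = ((b *m U *m invmx s) 0 k != 0).
Proof.
move=> sS b0 hb; have us := S_unit sS.
pose v0 : 'rV[K]_n := \row_k ((b *m U *m invmx s) 0 k == 0)%:R.
have [x ch] := S_charts sS v0.
have c0 k : 0 <= (b *m U *m invmx s) 0 k.
  by have [j ej] := U_rows k sS; rewrite (cone_coef sS hb ej).
exists x; split; last first.
  by exists v0 => // k; rewrite [v0 _ _]mxE pnatr_eq0 eqb0.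
apply: (center_chartat_comp us); first by move=> k l _; rewrite ord1.
rewrite (_ : mexp _ _ = v0) //; apply/rowP => k; rewrite mexpE big_ord1 [v0 _ _]mxE [(0 : 'rV[K]_1) _ _]mxE.
by rewrite exp0rz.
Qed.

(** Cones meet in common faces. Both representations describe the same one-parameter subgroup, whose
    limit is unique. Comparing the two charts at it, [ray_match] identifies the rays along which the
    coordinates vanish, so b is also supported on rays of s', where b U determines it. *)
Lemma cone_unique s s' (b b' : 'rV[int]_N) : s \in S -> s' \in S ->
  (forall j, 0 <= b 0 j) -> (forall j, b 0 j != 0 -> ray s j) ->
  (forall j, 0 <= b' 0 j) -> (forall j, b' 0 j != 0 -> ray s' j) ->
  b *m U = b' *m U -> b = b'.
Proof.
move=> sS sS' b0 hb b0' hb' eb.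
have us := S_unit sS; have us' := S_unit sS'.
have [x [cx [v0 ch hv]]] := cone_limit sS b0 hb.
have [x' [cx' [v0' ch' hv']]] := cone_limit sS' b0' hb'.
have ex : x' = x by apply: center_uniq cx' _; rewrite -eb.
rewrite {}ex in ch' cx'.
have [C0 C1] := chart_transition us' ch.1 ch'.
have [C0' C1'] := chart_transition us ch'.1 ch.
have val0 (v : 'rV[K]_n) (C : 'M[int]_n) k l : v 0 k = 0 -> mexp C v 0 l != 0 -> C k l = 0.
  move=> vk; rewrite mexpE (bigD1 k) //= vk mulf_eq0 negb_or exp0rz => /andP[h _].
  by apply/eqP; apply: contraNT h => /negbTE ->.
have match_rays : forall k, v0 0 k == 0 -> exists2 l, v0' 0 l == 0 & row k s = row l s'.
  apply: (ray_match us us').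
  - by move=> k l /eqP; apply: C0.
  - by move=> k l /eqP vk vl; apply: val0 vk _; rewrite C1.
  - by move=> k l /eqP; apply: C0'.
  - by move=> k l /eqP vk vl; apply: val0 vk _; rewrite C1'.
have supp j : b 0 j != 0 -> ray s' j.
  move=> bj; have /rayP [k ej] := hb j bj.
  have [|l _ el] := match_rays k; first by rewrite hv (cone_coef sS hb ej).
  by apply/rayP; exists l; rewrite ej.
by rewrite (cone_rep_emb sS' supp) eb -(cone_rep_emb sS' hb').
Qed.

Lemma zeros_center s (w0 : 'rV[K]_N) x : s \in S -> (forall j, w0 0 j = 0 -> ray s j) ->
  chartat s (mexp (U *m invmx s) w0) x -> center U w0 x.
Proof.
move=> sS hz; have us := S_unit sS; apply: center_chartat_comp => // j l /hz /rayP [k ej].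
by rewrite (row_chart l us ej).
Qed.

Lemma zeros_center_exists s (w0 : 'rV[K]_N) : s \in S -> (forall j, w0 0 j = 0 -> ray s j) ->
  exists x, center U w0 x.
Proof.
move=> sS hz; have [x ch] := S_charts sS (mexp (U *m invmx s) w0).
by exists x; apply: zeros_center ch.
Qed.

(** If w0_j = 0, the absence of poles says that the j-th ray has non-negative coordinates in the
    cone s; being a ray of the fan, it is a ray of s by [cone_unique]. *)
Lemma center_zeros s (w0 : 'rV[K]_N) x v0 : s \in S -> center U w0 x -> chartat s v0 x ->
  (forall j, w0 0 j = 0 -> ray s j) /\ mexp (U *m invmx s) w0 = v0.
Proof.
move=> sS cx ch; have us := S_unit sS.
have [C0 C1] := chart_transition us cx ch; split => // j wj.
have [s' sS' rj] := U_ray j.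
have e1 : delta_mx 0 j = row j U *m invmx s *m emb s.
  apply: (@cone_unique s' s) => //.
  - by move=> i; rewrite mxE.
  - by move=> i; rewrite mxE eqxx /=; case: (i =P j) => [-> _|_]; [apply/rayP|rewrite eqxx].
  - by move=> i; apply: emb_ge0 => k; rewrite -row_mul mxE; apply: C0.
  - by move=> i; apply: emb_supp.
  - by rewrite -mulmxA emb_mul // -mulmxA mulVmx // mulmx1 rowE.
by apply: (@emb_supp s (row j U *m invmx s)); rewrite -e1 mxE !eqxx.
Qed.

(* On the chart of s, the coordinate of a ray of s is the corresponding        *)
(* homogeneous coordinate up to non-zero factors.                             *)
Lemma mexp_chart s (w : 'rV[K]_N) j k : s \in unitmx -> row j U = row k s ->
  mexp (U *m invmx s) w 0 k =
  w 0 j * \prod_(i | ~~ ray s i) w 0 i ^ (U *m invmx s) i k.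
Proof.
move=> us ej; rewrite mexpE (bigD1 j) //= (row_chart k us ej) eqxx expr1z; congr (_ * _).
rewrite (bigID (ray s)) /= big1 ?mul1r => [|i /andP[ij /rayP [l el]]].
  apply: eq_bigl => i; case: (eqVneq i j) => [->|] //=.
  by apply/esym/negbF/rayP; exists k.
rewrite (row_chart k us el); case: eqP => [lk|]; last by rewrite expr0z.
by case/eqP: ij; apply: U_inj; rewrite el lk.
Qed.

(** Give the rays of a chart containing x the coordinates of x in that chart, and all other rays the
    value 1. *)
Lemma center_surj x : exists w0, center U w0 x.
Proof.
have [s sS [v0 ch]] := S_cover x; have us := S_unit sS.
pose w0 : 'rV[K]_N := \row_j if [pick k | row j U == row k s] is Some k then v0 0 k else 1.
exists w0; apply: (zeros_center sS).
  move=> j; rewrite mxE; case: pickP => [k /eqP ej _|_ /eqP]; last by rewrite oner_eq0.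
  by apply/rayP; exists k.
rewrite (_ : mexp _ _ = v0) //; apply/rowP => k; have [j ej] := U_rows k sS.
rewrite (mexp_chart _ us ej) big1 ?mulr1 => [|i nr].
  rewrite mxE; case: pickP => [l /eqP el|/(_ k)]; last by rewrite ej eqxx.
  by rewrite (row_chart_inj us el ej).
rewrite mxE; case: pickP => [l /eqP el|_]; last by rewrite exp1rz.
by case/negP: nr; apply/rayP; exists l.
Qed.

(** Away from the rays of a chart at x both points have non-zero coordinates, and h is their
    quotient. On the rays of the chart, where coordinates may vanish, h is dictated by h^U = 1. *)
Lemma center_fibre (w w' : 'rV[K]_N) x : center U w x -> center U w' x ->
  exists h, [/\ tor h, mexp U h = const_mx 1 & w' = map2_mx *%R h w].
Proof.
move=> cw cw'; have [s sS [v0 ch]] := S_cover x; have us := S_unit sS.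
have [z ev] := center_zeros sS cw ch; have [z' ev'] := center_zeros sS cw' ch.
have w0 i : ~~ ray s i -> w 0 i != 0 by move=> nr; apply: contraNneq nr => /z.
have w0' i : ~~ ray s i -> w' 0 i != 0 by move=> nr; apply: contraNneq nr => /z'.
pose h0 i := w' 0 i / w 0 i.
pose pk (u : 'I_N -> K) k := \prod_(i | ~~ ray s i) u i ^ (U *m invmx s) i k.
have pk0 (u : 'I_N -> K) k : (forall i, ~~ ray s i -> u i != 0) -> pk u k != 0.
  by move=> hu; apply/prodf_neq0 => i nr; rewrite expfz_neq0 // hu.
pose h : 'rV[K]_N := \row_j if [pick k | row j U == row k s] is Some k then (pk h0 k)^-1 else h0 j.
have hr j k : row j U = row k s -> h 0 j = (pk h0 k)^-1.
  move=> ej; rewrite mxE; case: pickP => [l /eqP el|/(_ k)]; last by rewrite ej eqxx.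
  by rewrite (row_chart_inj us el ej).
have hn j : ~~ ray s j -> h 0 j = h0 j.
  move=> nr; rewrite mxE; case: pickP => // l /eqP el.
  by case/negP: nr; apply/rayP; exists l.
have h00 i : ~~ ray s i -> h0 i != 0 by move=> nr; rewrite mulf_neq0 ?invr_eq0 ?w0 ?w0'.
have th : tor h.
  move=> j; case: (boolP (ray s j)) => [/rayP [k ej]|nr]; last by rewrite hn // h00.
  by rewrite (hr _ _ ej) invr_eq0 pk0.
exists h; split => //.
  have -> : U = (U *m invmx s) *m s by rewrite -mulmxA mulVmx // mulmx1.
  rewrite -mexp_mulmx //; have -> : mexp (U *m invmx s) h = const_mx 1.
    apply/rowP => k; have [j ej] := U_rows k sS.
    rewrite (mexp_chart _ us ej) (hr _ _ ej) mxE.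
    have -> : \prod_(i | ~~ ray s i) h 0 i ^ (U *m invmx s) i k = pk h0 k.
      by apply: eq_bigr => i nr; rewrite hn.
    by rewrite mulVf // pk0.
  by apply/rowP => k; rewrite mexpE mxE big1 // => i _; rewrite mxE exp1rz.
apply/rowP => j; rewrite mxE; case: (boolP (ray s j)) => [/rayP [k ej]|nr]; last first.
  by rewrite hn // divfK // w0.
rewrite (hr _ _ ej).
have := congr1 (fun v : 'rV_n => v 0 k) ev'; rewrite -ev !(mexp_chart _ us ej).
rewrite -/(pk (w 0) k) -/(pk (w' 0) k).
have -> : pk h0 k = pk (w' 0) k / pk (w 0) k.
  by rewrite /pk -prodf_div; apply: eq_bigr => i nr; rewrite /h0 expfzMl exprz_inv invr_expz.
move: (pk0 (w 0) k w0) (pk0 (w' 0) k w0'); move: (pk (w 0) k) (pk (w' 0) k) => p p' p0 p0' E.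
by apply: (mulIf p0'); rewrite E invf_div mulrAC divfK // mulrC.
Qed.

(** Away from the rays of a chart at x the coordinates of w do not vanish, so h is 1 there; h^U = 1
    then gives the value 1 on the rays as well. *)
Lemma center_free (h w : 'rV[K]_N) x : center U w x -> mexp U h = const_mx 1 ->
  tor h -> map2_mx *%R h w = w -> h = const_mx 1.
Proof.
move=> cw hU th hw; have [s sS [v0 ch]] := S_cover x; have us := S_unit sS.
have [z ev] := center_zeros sS cw ch.
have hn j : ~~ ray s j -> h 0 j = 1.
  move=> nr; have wj : w 0 j != 0 by apply: contraNneq nr => /z.
  by have := congr1 (fun v : 'rV_N => v 0 j) hw; rewrite mxE -[RHS]mul1r => /(mulIf wj).
have h1 : mexp (U *m invmx s) h = const_mx 1.
  rewrite -mexp_mulmx // hU; apply/rowP => k; rewrite mexpE mxE big1 // => i _.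
  by rewrite mxE exp1rz.
apply/rowP => j; rewrite mxE; case: (boolP (ray s j)) => [/rayP [k ej]|]; last exact: hn.
have := congr1 (fun v : 'rV_n => v 0 k) h1; rewrite (mexp_chart _ us ej) mxE big1 ?mulr1 //.
by move=> i /hn ->; rewrite exp1rz.
Qed.

End Rays.

Lemma fan_structure_exists (R : realType) (X : variety R) n (e : 'rV[R[i]]_n -> X) a V e' :
  toric_structure e a V e' -> complete_variety X -> nonsingular X ->
  exists S N (U : 'M[int]_(N, n)), fan_structure e S U.
Proof.
move=> TS Xc Xn; have [S [S_charts S_complete]] := fan_exists TS Xc Xn.
pose rs := undup [seq row k s | s <- S, k <- enum 'I_n].
exists S, (size rs), (\matrix_(j < size rs) nth 0 rs j).
have rowE (j : 'I_(size rs)) : row j (\matrix_(j < size rs) nth 0 rs j) = nth 0 rs j.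
  exact: rowK.
split.
- by move=> s /S_charts [].
- by move=> s /S_charts [].
- exact: S_complete.
- exact: (charts_cover TS S_charts S_complete).
- move=> i j; rewrite /= !rowE => /eqP.
  by rewrite nth_uniq ?undup_uniq // => /eqP /val_inj.
- move=> s k sS; have : row k s \in rs.
    by rewrite mem_undup; apply: allpairs_f => //; rewrite mem_enum.
  by move=> /(nthP 0) [j jr ej]; exists (Ordinal jr); rewrite rowE.
- move=> j; have : nth 0 rs j \in rs by apply: mem_nth.
  rewrite mem_undup => /allpairsP [[s k] /= [sS _ ej]].
  by exists s => //; exists k; rewrite rowE.
Qed.


(** * Lifting morphisms to homogeneous coordinates *)

Lemma prod_count (A : comNzRingType) (T : eqType) (s Q : seq T) (F : T -> A) : uniq Q ->
  {subset s <= Q} -> \prod_(x <- s) F x = \prod_(x <- Q) F x ^+ count_mem x s.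
Proof.
move=> uQ; elim: s => [|y s IH] sQ.
  by rewrite big_nil big1 // => x _; rewrite expr0.
rewrite big_cons IH; last by move=> x xs; apply: sQ; rewrite inE xs orbT.
have yQ : y \in Q by apply: sQ; rewrite mem_head.
rewrite (bigD1_seq y) //= [in RHS](bigD1_seq y) //= eqxx exprD expr1 mulrA; congr (_ * _).
by apply: eq_bigr => x xy; rewrite eq_sym (negbTE xy).
Qed.

Section PrimeForms.
Variables (K : numClosedFieldType) (N : nat).
Implicit Types (q : {mpoly K[N]}) (Q : seq {mpoly K[N]}) (w : 'rV[K]_N).

Lemma prime_dvd_exp (A : idomainType) (p q : A) m : prime_elt p -> dvd p (q ^+ m) -> dvd p q.
Proof.
move=> pp; elim: m => [|m IH]; last by rewrite exprS => h; have [_ _ /(_ q (q ^+ m) h) []] := pp.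
by rewrite expr0 => /(prime_dvd_unit pp (unitr1 _)).
Qed.

Lemma mprime_X j : mprime ('X_j : {mpoly K[N]}).
Proof.
pose h (i : 'I_N) : {mpoly K[N]} := if i == j then 0 else 'X_i.
have div (p : {mpoly K[N]}) : exists d, p = d * 'X_j + mmap (@mpolyC N K) h p.
  elim/mpoly_rind: p => [c|i|p q [d ed] [d' ed']|p q [d ed] [d' ed']].
  - by exists 0; rewrite mmapC mul0r add0r.
  - rewrite mmapX mmap1U /h; case: eqP => [->|_].
      by exists 1; rewrite mul1r addr0.
    by exists 0; rewrite mul0r add0r.
  - exists (d + d'); rewrite rmorphD {1}ed {1}ed' /=; move: (mmap _ _ p) (mmap _ _ q) => x y; ring.
  - exists (d * d' * 'X_j + d * mmap (@mpolyC N K) h q + mmap (@mpolyC N K) h p * d').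
    rewrite rmorphM {1}ed {1}ed' /=; move: (mmap _ _ p) (mmap _ _ q) => x y; ring.
split; last by rewrite mleadXm mcoeffX eqxx.
split; first exact: mpolyX_neq0.
  apply/negP => /mpoly_unitP [c c0] /(congr1 (meval (fun=> 0))).
  by rewrite mevalXU mevalC => e; rewrite -e eqxx in c0.
move=> p q [d e].
have : mmap (@mpolyC N K) h p * mmap (@mpolyC N K) h q = 0.
  rewrite -rmorphM e rmorphM [X in _ * X]mmapX mmap1U /h eqxx; exact: mulr0.
move=> /eqP; rewrite mulf_eq0 => /orP[/eqP h0|/eqP h0]; [left|right].
  by have [d' ed] := div p; exists d'; rewrite ed h0 addr0.
by have [d' ed] := div q; exists d'; rewrite ed h0 addr0.
Qed.

Lemma gen_primes Q : (forall q, q \in Q -> mprime q) ->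
  gen (fun w => forall q, q \in Q -> q.@[w 0] != 0).
Proof.
move=> hQ; have : \prod_(q <- Q) q != 0.
  rewrite prodf_seq_neq0; apply/allP => q /hQ [[q0 _ _] _]; exact/implyP.
move=> /gen_neq0; apply: genW => w; rewrite rmorph_prod prodf_seq_neq0 => /allP h q qQ.
by have /implyP/(_ isT) := h q qQ.
Qed.

(** A prime of negative exponent would divide the denominator b, which does not vanish at w0; so
    such a prime does not pass through w0. *)
Lemma regat_prime_exps Q (E : {mpoly K[N]} -> int) c w0 v : uniq Q ->
  (forall q, q \in Q -> mprime q) -> c != 0 ->
  regat w0 (fun w => c * \prod_(q <- Q) q.@[w 0] ^ E q) v ->
  forall q, q \in Q -> q.@[w0 0] = 0 -> 0 <= E q.
Proof.
move=> uQ hQ c0 [a [b [b0 _ h]]] q qQ q0; rewrite leNgt; apply/negP => Eq.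
pose pos : {mpoly K[N]} := \prod_(p <- Q) p ^+ (if 0 <= E p then absz (E p) else 0).
pose neg : {mpoly K[N]} := \prod_(p <- Q) p ^+ (if 0 <= E p then 0 else absz (E p)).
have e : b * (c%:MP * pos) = a * neg.
  apply: gen_eq; apply: gen_and (gen_primes hQ) h => w tw; rewrite !mevalM mevalC => <-.
  rewrite -!mulrA; congr (_ * (_ * _)); rewrite !rmorph_prod -big_split.
  apply: eq_big_seq => p pQ /=; rewrite !rmorphXn /=.
  case: (ltP (E p) 0) => hj; rewrite expr0 ?mul1r ?mulr1.
    by case: (E p) hj => // m _; rewrite NegzE abszN /= -exprnN mulVf // expf_neq0 // tw.
  by case: (E p) hj => // m _; rewrite absz_nat.
have [pq _] := hQ q qQ; have [_ _ pP] := pq.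
have : dvd q (b * (c%:MP * pos)).
  rewrite e /neg (bigD1_seq q) //= leNgt Eq /=.
  move: Eq; case: (E q) => // m _; rewrite NegzE abszN /= exprS.
  exists (a * (q ^+ m * \prod_(i <- Q | i != q) i ^+ (if 0 <= E i then 0 else absz (E i)))).
  by ring.
case/pP => [[d ed]|/pP [d|]].
- by move: b0; rewrite ed mevalM q0 mulr0 eqxx.
- by apply: prime_dvd_unit pq _ d; apply: rmorph_unit; rewrite unitfE.
move=> /(prime_dvd_prod pq) [p pQ]; case: ifP => Ep.
  move=> /(prime_dvd_exp pq) /(mprime_dvd_eq (hQ q qQ) (hQ p pQ)) epq.
  by move: Ep; rewrite -epq leNgt Eq.
by rewrite expr0 => /(prime_dvd_unit pq (unitr1 _)).
Qed.

(** By [prime_point] every prime vanishes somewhere, and both the product and its inverse are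
    regular there. *)
Lemma prime_exps_eq0 Q (E : {mpoly K[N]} -> int) c : uniq Q ->
  (forall q, q \in Q -> mprime q) -> c != 0 ->
  gen (fun w => c * \prod_(q <- Q) q.@[w 0] ^ E q = 1) ->
  forall q, q \in Q -> E q = 0.
Proof.
move=> uQ hQ c0 h q qQ; have [pq _] := hQ q qQ.
have [w0 [q0 _]] := @prime_point K N q 1 pq (prime_dvd_unit pq (unitr1 _)).
apply/eqP; rewrite eq_le; apply/andP; split; last first.
  apply: (regat_prime_exps uQ hQ c0 (w0 := w0) (v := 1)) => //.
  by apply: regat_ext (regat_const _ 1); apply: genW h => w ->.
rewrite -oppr_ge0; apply: (@regat_prime_exps Q (fun q => - E q) c^-1 w0 1) => //.
  by rewrite invr_eq0.
apply: regat_ext (regat_const _ 1); apply: genW h => w h.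
transitivity ((c * \prod_(q <- Q) q.@[w 0] ^ E q)^-1); first by rewrite h invr1.
rewrite invfM; congr (_ * _); rewrite -prodfV; apply: eq_bigr => p _.
by rewrite invr_expz.
Qed.

Lemma prime_form k (F : 'I_k -> {mpoly K[N]}) : (forall j, F j != 0) ->
  exists Q (c : 'rV[K]_k) (m : {mpoly K[N]} -> 'rV[int]_k),
  [/\ uniq Q, forall q, q \in Q -> mprime q, tor c,
      forall w j, (F j).@[w 0] = c 0 j * \prod_(q <- Q) q.@[w 0] ^ m q 0 j &
      forall q j, 0 <= m q 0 j /\ (m q 0 j != 0 -> dvd q (F j))].
Proof.
move=> F0; have /choice [c /choice [s hs]] j := mfactor (F0 j).
pose Q := undup (flatten [seq s j | j <- enum 'I_k]).
exists Q, (\row_j c j), (fun q => \row_j (count_mem q (s j))%:Z).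
have sQ j : {subset s j <= Q}.
  move=> q qs; rewrite mem_undup; apply/flattenP; exists (s j) => //.
  by apply: map_f; rewrite mem_enum.
have pQ q : q \in Q -> mprime q.
  rewrite mem_undup => /flattenP [_ /mapP [j _ ->]]; by case: (hs j) => _ /(_ q).
split => //; first exact: undup_uniq.
- by move=> j; rewrite mxE; case: (hs j).
- move=> w j; have [c0 _ ->] := hs j; rewrite mevalZ mxE; congr (_ * _).
  rewrite (@prod_count _ _ (s j) Q id) ?undup_uniq // rmorph_prod.
  by apply: eq_bigr => q _; rewrite mxE rmorphXn.
- move=> q j; rewrite mxE; split => // h; have [c0 _ ->] := hs j.
  have qs : q \in s j by rewrite -has_pred1 has_count lt0n; apply: contra h => /eqP ->.
  exists (c j *: \prod_(p <- rem q (s j)) p); rewrite -scalerAl (big_rem q) //=.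
  by rewrite mulrC.
Qed.

Lemma mexp_prime_form k n Q (c : 'rV[K]_k) (m : {mpoly K[N]} -> 'rV[int]_k)
    (C : 'M[int]_(k, n)) w l : (forall q, q \in Q -> q.@[w 0] != 0) ->
  mexp C (\row_j (c 0 j * \prod_(q <- Q) q.@[w 0] ^ m q 0 j)) 0 l =
  mexp C c 0 l * \prod_(q <- Q) q.@[w 0] ^ (m q *m C) 0 l.
Proof.
move=> hw; rewrite !mexpE.
transitivity (\prod_j (c 0 j ^ C j l * \prod_(q <- Q) q.@[w 0] ^ (m q 0 j * C j l))).
  apply: eq_bigr => j _; rewrite mxE expfzMl; congr (_ * _); rewrite exprz_prod.
  by apply: eq_bigr => q _; rewrite exprz_exp.
rewrite big_split /= exchange_big /=; congr (_ * _); apply: eq_big_seq => q qQ.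
by rewrite mxE exprz_sum // hw.
Qed.

End PrimeForms.


(** * Existence and uniqueness of lifts *)

Section Lifts.
Variables (R : realType) (X : variety R) (n : nat).
Local Notation K := (R[i]).
Variables (e : 'rV[K]_n -> X) (a : 'rV[K]_n * X -> X) (V : set X) (e' : X -> 'rV[K]_n).
Hypothesis TS : toric_structure e a V e'.
Local Notation eA := (monomial_map e).
Local Notation center := (center e).
Local Notation chartat := (chartat e).
Variables (S : seq 'M[int]_n) (N : nat) (U : 'M[int]_(N, n)).
Hypothesis FS : fan_structure e S U.
Implicit Types (Phi Psi : 'I_N -> {mpoly K[N]}) (w : 'rV[K]_N) (G : X -> X).

Definition ev Phi w : 'rV[K]_N := \row_j (Phi j).@[w 0].

Definition lifts Phi G := forall w x, center U w x -> center U (ev Phi w) (G x).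

Lemma left_inverse : exists B : 'M[int]_(n, N), B *m U = 1%:M.
Proof.
have [s sS _] := fan_complete FS 0.
by exists (invmx s *m emb U s); apply: (emb_left_inverse FS).
Qed.

Lemma torus_point z : tor z -> exists w : 'rV[K]_N, tor w /\ eA U w = e z.
Proof.
move=> tz; have [B BU] := left_inverse; exists (mexp B z); split; first exact: mexp_tor.
by rewrite /monomial_map mexp_mulmx // BU mexp1.
Qed.

Lemma center_torus w x : center U w x -> V x -> tor w.
Proof.
move=> cw Vx; have [tx ex] := ts_e'K TS Vx; have [w' [tw' ew']] := torus_point tx.
have cw' : center U w' x by rewrite -ex -ew'; apply: (center_eA TS).
have [h [th _ ->]] := center_fibre FS cw' cw.
exact: tor_map2.
Qed.

(** Factor the torus coordinates of G(e(w^U)). The exponents of a prime q form a vector [dm q] of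
    Z^n, written as b_q U with b_q non-negative and supported on one cone. The j-th component of the
    lift is the product of the q^(b_q j), times constants with the required image in the torus. *)
Lemma lift_exists G : @morphism_on R X X setT G -> (forall y, exists x, G x = y) ->
  exists Phi, lifts Phi G.
Proof.
move=> [Gopen Greg] Gsurj.
pose O : set X := setT `&` G @^-1` V.
have oO : zopen O := Gopen V (ts_open TS).
have O0 : O !=set0.
  have [V1 _] := e_const1 TS; have [x ex] := Gsurj (e (const_mx 1)).
  by exists x; split => //; rewrite /preimage /= ex.
have [z [tz Oz]] := meet_V TS oO O0.
have [w1 [tw1 ew1]] := torus_point tz; rewrite -ew1 in Oz.
have rf j : regular_on O (fun x => e' (G x) 0 j) := Greg _ _ (e'_coord TS j).
have /choice [al /choice [be hab]] j : exists al be : {mpoly K[N]}, [/\ al != 0, be != 0 &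
    gen (fun w => be.@[w 0] * e' (G (eA U w)) 0 j = al.@[w 0])].
  have [al [be [b0 E h]]] := center_regat (center_eA TS U tw1) (rf j) Oz.
  exists al, be; split => //; last exact: meval_neq0 b0.
  apply: (@meval_neq0 _ _ w1); rewrite -E mulf_neq0 //.
  by have [tG _] := ts_e'K TS (proj2 Oz); apply: tG.
pose F (j : 'I_(n + n)) := match split j with inl k => al k | inr k => be k end.
have F0 j : F j != 0 by rewrite /F; case: (split j) => k; case: (hab k).
have [Q [c [m [uQ pQ tc hF hm]]]] := prime_form F0.
pose dm q : 'rV[int]_n := \row_j (m q 0 (lshift n j) - m q 0 (rshift n j)).
pose c' : 'rV[K]_n := \row_j (c 0 (lshift n j) / c 0 (rshift n j)).
have tc' : tor c' by move=> j; rewrite mxE mulf_neq0 ?invr_eq0.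
have Fl k : F (lshift n k) = al k by rewrite /F -[lshift n k]/(unsplit (inl k)) unsplitK.
have Fr k : F (rshift n k) = be k by rewrite /F -[rshift n k]/(unsplit (inr k)) unsplitK.
have ratio w k : (forall q, q \in Q -> q.@[w 0] != 0) ->
    (al k).@[w 0] / (be k).@[w 0] = c' 0 k * \prod_(q <- Q) q.@[w 0] ^ dm q 0 k.
  move=> hw; rewrite -Fl -Fr !hF mxE invfM mulrACA; congr (_ * _).
  rewrite -prodf_div; apply: eq_big_seq => q qQ.
  by rewrite mxE expfzDr ?hw // invr_expz.
have /choice [b /choice [sq hb]] q : exists (b : 'rV[int]_N) s, [/\ s \in S,
    forall j, 0 <= b 0 j, forall j, b 0 j != 0 -> ray U s j & b *m U = dm q].
  by have [s sS [b [h1 h2 h3]]] := cone_exists FS (dm q); exists b, s.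
have [B BU] := left_inverse; pose C := mexp B c'.
have tC : tor C by apply: mexp_tor.
pose Phi j : {mpoly K[N]} := (C 0 j)%:MP * \prod_(q <- Q) q ^+ absz (b q 0 j).
have PhiE w j : (Phi j).@[w 0] = C 0 j * \prod_(q <- Q) q.@[w 0] ^ b q 0 j.
  rewrite mevalM mevalC rmorph_prod; congr (_ * _); apply: eq_bigr => q _.
  by have [_ b0 _ _] := hb q; rewrite rmorphXn -{2}(gez0_abs (b0 j)) -exprnP.
have evE w : ev Phi w = \row_j (C 0 j * \prod_(q <- Q) q.@[w 0] ^ b q 0 j).
  by apply/rowP => j; rewrite [LHS]mxE [RHS]mxE PhiE.
have Phi_tor w : (forall q, q \in Q -> q.@[w 0] != 0) -> tor (ev Phi w).
  move=> hw j; rewrite mxE PhiE mulf_neq0 // prodf_seq_neq0; apply/allP => q qQ.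
  by apply/implyP => _; rewrite expfz_neq0 // hw.
have genA : gen (fun w => (forall q, q \in Q -> q.@[w 0] != 0) /\ G (eA U w) = eA U (ev Phi w)).
  have gO := center_gen (center_eA TS U tw1) oO Oz.
  have gab := gen_all (fun j => genI (let: And3 _ _ h := hab j in h)
     (gen_neq0 (let: And3 _ h _ := hab j in h))).
  apply: gen_and (genI (gen_primes pQ) gO) gab => w [hw [tw [_ Vw]]] hj.
  split => //; have [tG eG] := ts_e'K TS Vw; rewrite -eG /monomial_map; congr e.
  apply/rowP => k; have [h bk] := hj k.
  rewrite evE mexp_prime_form //.
  have -> : mexp U C = c' by rewrite /C mexp_mulmx // BU mexp1.
  transitivity ((al k).@[w 0] / (be k).@[w 0]); first by rewrite -h mulrC mulKf.
  by rewrite ratio //; congr (_ * _); apply: eq_bigr => q _; case: (hb q) => _ _ _ ->.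
exists Phi => w0 x cx.
have [s sS [v0 ch]] := fan_cover FS (G x); have us := fan_unit FS sS.
have hreg k : regat w0 (fun w => mexp (U *m invmx s) (ev Phi w) 0 k) (v0 0 k).
  have [W [f [rW Wy <- fw]]] := ch.2 k.
  have rG := Greg W f rW.
  have cr := center_regat cx rG (conj I Wy); have cg := center_gen cx rG.1 (conj I Wy).
  apply: regat_ext cr; apply: gen_and cg genA => w [tw [_ Ww]] [hw Gw].
  have tP := Phi_tor w hw; move: Ww; rewrite /preimage /= Gw (eA_chart e U us tP) => Ww.
  by apply: fw => //; apply: mexp_tor.
(* The coordinates of G x in the chart s are regular at w0, so a prime q through w0 occurs in them
   with non-negative exponents. Thus [dm q] lies in the cone s, and [cone_unique] shows that the
   rays of b_q belong to s. The zeros of the lift at w0 are therefore among the rays of s. *)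
have pos q k : q \in Q -> q.@[w0 0] = 0 -> 0 <= (b q *m (U *m invmx s)) 0 k.
  have tk : mexp (U *m invmx s) C 0 k != 0 by apply: mexp_tor.
  move=> qQ q0; apply: (regat_prime_exps uQ pQ tk (w0 := w0) (v := v0 0 k) (E := fun q => (b q *m (U *m invmx s)) 0 k)) => //.
  apply: regat_ext (hreg k); apply: genW (gen_primes pQ) => w hw.
  by rewrite evE (mexp_prime_form _ _ _ _ hw).
have supp q j : q \in Q -> q.@[w0 0] = 0 -> b q 0 j != 0 -> ray U s j.
  move=> qQ q0; have [sqS b0 bs _] := hb q.
  rewrite (@cone_unique _ _ _ _ _ _ _ FS (sq q) s (b q) (b q *m (U *m invmx s) *m emb U s)) //.
  - exact: emb_supp.
  - by move=> i; apply: emb_ge0 => k; apply: pos.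
  - exact: emb_supp.
  - by rewrite -!mulmxA (emb_mul FS) // mulVmx // mulmx1.
have zeros j : ev Phi w0 0 j = 0 -> ray U s j.
  rewrite mxE PhiE => /eqP; rewrite mulf_eq0 (negbTE (tC j)) prodf_seq_eq0 /= => /hasP [q qQ].
  rewrite expfz_eq0 => /andP[bj /eqP q0]; exact: supp bj.
apply: (zeros_center FS sS zeros).
have -> // : mexp (U *m invmx s) (ev Phi w0) = v0.
apply/rowP => k; apply: regat_uniq (hreg k); rewrite mexpE.
apply: (@regat_ext _ _ _ (fun w => \prod_j ev Phi w 0 j ^ (U *m invmx s) j k)).
  by apply: gen_true => w; rewrite mexpE.
apply: regat_prod => j; apply: regat_exprz.
  rewrite mxE; apply: regat_ext (regat_mevalM w0 (Phi j)).
  by apply: gen_true => w; rewrite mxE.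
by move=> /zeros /rayP [l el]; rewrite (row_chart k us el).
Qed.

Lemma lifts_generic Phi G : @morphism_on R X X setT G -> (forall y, exists x, G x = y) ->
  lifts Phi G -> gen (fun w => [/\ tor w, tor (ev Phi w) & G (eA U w) = eA U (ev Phi w)]).
Proof.
move=> [Gopen Greg] Gsurj hP.
have oO : zopen (setT `&` G @^-1` V) := Gopen V (ts_open TS).
have [V1 _] := e_const1 TS; have [x ex] := Gsurj (e (const_mx 1)).
have Ox : (setT `&` G @^-1` V) x by split => //; rewrite /preimage /= ex.
have [w0 cx] := center_surj FS x.
apply: genW (center_gen cx oO Ox) => w [tw [_ Vw]].
have cw := hP _ _ (center_eA TS U tw); have tP := center_torus cw Vw.
by split => //; apply: center_uniq cw (center_eA TS U tP).
Qed.

Lemma lifts_neq0 Phi G j : @morphism_on R X X setT G -> (forall y, exists x, G x = y) ->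
  lifts Phi G -> Phi j != 0.
Proof.
move=> GM Gs hP; have [w [_ tP _]] := gen_ex (lifts_generic GM Gs hP).
by apply: (@meval_neq0 _ _ w); have := tP j; rewrite mxE.
Qed.

(** Both lifts have the same torus coordinates, so their exponents [ml q] and [mr q] of a prime q
    have the same image under U. At a suitable point of q = 0 both lifts have their zeros in a
    common cone, so the two exponents are equal by [cone_unique], and only constants remain. *)
Lemma lift_unique Phi Psi G : @morphism_on R X X setT G -> (forall y, exists x, G x = y) ->
  lifts Phi G -> lifts Psi G ->
  exists h, [/\ tor h, mexp U h = const_mx 1 & forall w, ev Psi w = map2_mx *%R h (ev Phi w)].
Proof.
move=> GM Gs hP hP'.
pose F (j : 'I_(N + N)) := match split j with inl k => Phi k | inr k => Psi k end.
have F0 j : F j != 0.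
  by rewrite /F; case: (split j) => k; [apply: lifts_neq0 hP|apply: lifts_neq0 hP'].
have [Q [c [m [uQ pQ tc hF hm]]]] := prime_form F0.
have Fl k : F (lshift N k) = Phi k by rewrite /F -[lshift N k]/(unsplit (inl k)) unsplitK.
have Fr k : F (rshift N k) = Psi k by rewrite /F -[rshift N k]/(unsplit (inr k)) unsplitK.
pose cl : 'rV[K]_N := \row_j c 0 (lshift N j); pose cr : 'rV[K]_N := \row_j c 0 (rshift N j).
pose ml q : 'rV[int]_N := \row_j m q 0 (lshift N j); pose mr q : 'rV[int]_N := \row_j m q 0 (rshift N j).
have evl w : ev Phi w = \row_j (cl 0 j * \prod_(q <- Q) q.@[w 0] ^ ml q 0 j).
  apply/rowP => j; rewrite mxE -Fl hF !mxE; congr (_ * _).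
  by apply: eq_bigr => q _; rewrite mxE.
have evr w : ev Psi w = \row_j (cr 0 j * \prod_(q <- Q) q.@[w 0] ^ mr q 0 j).
  apply/rowP => j; rewrite mxE -Fr hF !mxE; congr (_ * _).
  by apply: eq_bigr => q _; rewrite mxE.
have tcl : tor cl by move=> j; rewrite mxE.
have tcr : tor cr by move=> j; rewrite mxE.
have genE : gen (fun w => (forall q, q \in Q -> q.@[w 0] != 0) /\
    mexp U (ev Phi w) = mexp U (ev Psi w)).
  apply: gen_and (gen_primes pQ) (genI (lifts_generic GM Gs hP) (lifts_generic GM Gs hP')).
  move=> w hw [[tw tP e1] [_ tP' e2]]; split; first exact: hw.
  have E := congr1 e' (etrans (esym e1) e2).
  rewrite -(proj2 (ts_eK TS (mexp_tor U tP))) -(proj2 (ts_eK TS (mexp_tor U tP'))).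
  exact: E.
have degU q : q \in Q -> ml q *m U = mr q *m U.
  move=> qQ; apply/rowP => l.
  pose k0 := mexp U cl 0 l / mexp U cr 0 l.
  have k00 : k0 != 0 by rewrite mulf_neq0 ?invr_eq0 //; apply: mexp_tor.
  have := prime_exps_eq0 uQ pQ k00 (E := fun q => (ml q *m U) 0 l - (mr q *m U) 0 l).
  move=> /(_ _ q qQ) E; apply/eqP; rewrite -subr_eq0; apply/eqP; apply: E.
  apply: genW genE => w [hw E].
  have := congr1 (fun v : 'rV_n => v 0 l) E; rewrite evl evr (mexp_prime_form cl ml U l hw) (mexp_prime_form cr mr U l hw) => {}E.
  transitivity ((mexp U cl 0 l * \prod_(q <- Q) q.@[w 0] ^ (ml q *m U) 0 l) /
     (mexp U cr 0 l * \prod_(q <- Q) q.@[w 0] ^ (mr q *m U) 0 l)).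
    rewrite invfM mulrACA -prodf_div; congr (_ * _); apply: eq_big_seq => p pQ'.
    by rewrite expfzDr ?hw // invr_expz.
  rewrite E; apply: divff; apply: mulf_neq0; first exact: (mexp_tor U tcr).
  by rewrite prodf_seq_neq0; apply/allP => p pQ'; apply/implyP => _; rewrite expfz_neq0 // hw.
have meq q : q \in Q -> ml q = mr q.
  move=> qQ; have [pq lq] := pQ q qQ.
  (* Where q = 0 but p0 does not vanish, a zero coordinate w_j means q = X_j. So at most one
     coordinate vanishes, and the map e(w^U) is defined there. *)
  pose p0 : {mpoly K[N]} := \prod_(j | ~~ `[< dvd q 'X_j >]) 'X_j.
  have [|w0 [qw pw]] := prime_point pq (p := p0).
    have := @prime_dvd_prod _ q _ [seq j <- index_enum 'I_N | ~~ `[< dvd q 'X_j >]] (fun j => 'X_j) pq.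
    rewrite big_filter => H d; have [j] := H d.
    by rewrite mem_filter => /andP[/asboolP nd _] /nd.
  have zX j : w0 0 j = 0 -> q = 'X_j.
    move=> wj; apply: (@mprime_dvd_eq _ N q 'X_j (pQ q qQ) (@mprime_X _ N j)).
    apply: contrapT => nd; move: pw; rewrite rmorph_prod => /prodf_neq0 /(_ j).
    have nd' : ~~ `[< dvd q 'X_j >] by apply/negP => /asboolP.
    by move=> /(_ nd'); rewrite /= mevalXU wj eqxx.
  have [s0 s0S hz] : exists2 s, s \in S & forall j, w0 0 j = 0 -> ray U s j.
    case: (pselect (exists j, w0 0 j = 0)) => [[j wj]|no]; last first.
      have [s sS _] := fan_complete FS 0; exists s => // j wj; case: no; by exists j.
    have [s sS sj] := fan_ray FS j; exists s => // i wi.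
    have := congr1 (meval (fun k => (k == i)%:R)) (etrans (esym (zX i wi)) (zX j wj)).
    rewrite !mevalXU eqxx; case: (j =P i) => [<- _|_ /eqP]; [exact/rayP|by rewrite eqr_nat].
  have [x cx] := zeros_center_exists FS s0S hz.
  have [s sS [v0 ch]] := fan_cover FS (G x).
  have [z1 _] := center_zeros FS sS (hP _ _ cx) ch.
  have [z2 _] := center_zeros FS sS (hP' _ _ cx) ch.
  have dz (f : {mpoly K[N]}) : dvd q f -> f.@[w0 0] = 0 by move=> [d ->]; rewrite mevalM qw mulr0.
  apply: (cone_unique FS sS sS); last exact: degU.
  - by move=> j; rewrite mxE; case: (hm q (lshift N j)).
  - move=> j; rewrite mxE; case: (hm q (lshift N j)) => _ h /h /dz; rewrite Fl => Pj.
    by apply: z1; rewrite mxE.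
  - by move=> j; rewrite mxE; case: (hm q (rshift N j)).
  - move=> j; rewrite mxE; case: (hm q (rshift N j)) => _ h /h /dz; rewrite Fr => Pj.
    by apply: z2; rewrite mxE.
pose h : 'rV[K]_N := \row_j (cr 0 j / cl 0 j).
have th : tor h by move=> j; rewrite mxE mulf_neq0 ?invr_eq0.
have hE w : ev Psi w = map2_mx *%R h (ev Phi w).
  apply/rowP => j; rewrite evl evr !mxE mulrA divfK //; congr (_ * _).
  apply: eq_big_seq => q qQ; by have := congr1 (fun v : 'rV_N => v 0 j) (meq q qQ); rewrite !mxE => ->.
exists h; split => //.
have [w [[_ E] [tw tP _]]] := gen_ex (genI genE (lifts_generic GM Gs hP)).
rewrite hE mexp_map2 in E; apply/rowP => l; rewrite [RHS]mxE.
have := congr1 (fun v : 'rV_n => v 0 l) E; rewrite [RHS]mxE -[LHS]mul1r => /esym.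
by move=> /(mulIf (mexp_tor U tP l)).
Qed.

End Lifts.


(** * Averaging weighted homogeneous maps *)

Section Averaging.
Variables (K : numFieldType) (N : nat).
Implicit Types (p : {mpoly K[N]}) (d : 'I_N -> nat) (w : 'rV[K]_N).

Definition qhom d M p := forall m, m \in msupp p -> (\sum_i m i * d i = M)%N.

Definition dscale d (t : K) : 'rV[K]_N := \row_i t ^+ d i.

Lemma dscale_tor d t : t != 0 -> tor (dscale d t).
Proof. by move=> t0 i; rewrite mxE expf_neq0. Qed.

Lemma mcoeff_dscale d (t : K) p m :
  (rescale (dscale d t) p)@_m = t ^+ (\sum_i m i * d i)%N * p@_m.
Proof.
rewrite mcoeff_rescale; congr (_ * _); rewrite -prodrXr.
by apply: eq_bigr => i _; rewrite mxE -exprM mulnC.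
Qed.

(** Scaling by 2 alone detects the weight, distinct powers of 2 being different. *)
Lemma qhom_dscale d p (c : K) : (forall w, p.@[map2_mx *%R (dscale d 2) w 0] = c * p.@[w 0]) ->
  exists M, qhom d M p /\ (p != 0 -> c = 2 ^+ M).
Proof.
move=> h; have E (m : 'X_{1..N}) : 2 ^+ (\sum_i m i * d i)%N * p@_m = c * p@_m.
  rewrite -mcoeff_dscale -mcoeffZ; congr (_@__); apply: mpoly_ext => w.
  by rewrite mevalZ meval_rescale h.
have key (m : 'X_{1..N}) : m \in msupp p -> c = 2 ^+ (\sum_i m i * d i)%N.
  by rewrite mcoeff_msupp => mp; apply/esym/(mulIf mp).
case: (eqVneq p 0) => [->|p0].
  by exists 0%N; split => // m; rewrite msupp0.
have := p0; rewrite -msupp_eq0; case es : (msupp p) => [|m0 s] // _.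
have m0p : m0 \in msupp p by rewrite es mem_head.
exists (\sum_i m0 i * d i)%N; split => [m mp|_]; last exact: key.
have := key m mp; rewrite (key m0 m0p) => /eqP.
by rewrite -!natrX eqr_nat eqn_exp2l // => /eqP.
Qed.

Lemma qhom_meval d M p (t : K) w : qhom d M p ->
  p.@[map2_mx *%R (dscale d t) w 0] = t ^+ M * p.@[w 0].
Proof.
move=> h; rewrite -meval_rescale -mevalZ; congr (_.@[_]); apply/mpolyP => m.
rewrite mcoeff_dscale mcoeffZ; case: (boolP (m \in msupp p)) => [/h ->//|/memN_msupp_eq0 ->].
by rewrite !mulr0.
Qed.

(** As the weights are positive, a monomial of weight M either is a single variable or involves only
    variables of smaller weight, on which the points v_i agree. In both cases it commutes with the
    average. *)
Lemma meval_average (I : finType) d M p (v : I -> 'rV[K]_N) (i0 : I) : (0 < M)%N ->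
  (forall i, 0 < d i)%N -> qhom d M p ->
  (forall j, (d j < M)%N -> forall i, v i 0 j = v i0 0 j) ->
  p.@[(#|I|%:R^-1 *: \sum_i v i) 0] = #|I|%:R^-1 * \sum_i p.@[v i 0].
Proof.
move=> M0 d0 hp hv.
have I0 : #|I|%:R != 0 :> K by rewrite pnatr_eq0 -lt0n; apply/card_gt0P; exists i0.
have cE j : (#|I|%:R^-1 *: \sum_i v i) 0 j = #|I|%:R^-1 * \sum_i v i 0 j.
  by rewrite mxE summxE.
have const (x : K) (f : I -> K) : (forall i, f i = x) -> #|I|%:R^-1 * \sum_i f i = x.
  move=> fx; under eq_bigr do rewrite fx.
  rewrite sumr_const -[x *+ _]mulr_natl; exact: mulKf.
rewrite mevalE; under [in RHS]eq_bigr do rewrite mevalE.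
rewrite exchange_big mulr_sumr; apply: eq_big_seq => m mp /=.
rewrite -mulr_sumr mulrCA; congr (_ * _).
have wm := hp m mp.
case: (pselect (exists2 j, (0 < m j)%N & (M <= d j)%N)) => [[j mj dj]|no].
  have wj : (\sum_(i | i != j) m i * d i = 0)%N /\ m j = 1%N.
    move: wm; rewrite (bigD1 j) //=; move: (\sum_(i | _) _)%N => s.
    by have := d0 j; case: (m j) mj => // [[|k]] _ dj0 E; split; lia.
  case: wj => s0 mj1.
  have other i : i != j -> m i = 0%N.
    move=> ij; move/eqP: s0; rewrite sum_nat_eq0 => /forallP /(_ i) /implyP /(_ ij).
    by rewrite muln_eq0 => /orP[/eqP //|]; rewrite eqn0Ngt d0.
  have mono (u : 'I_N -> K) : \prod_i u i ^+ m i = u j.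
    rewrite (bigD1 j) //= mj1 expr1 big1 ?mulr1 // => i /other ->.
    by rewrite expr0.
  by rewrite mono cE; congr (_ * _); apply: eq_bigr => i _; rewrite mono.
have lowdeg j : (0 < m j)%N -> (d j < M)%N.
  by move=> mj; rewrite ltnNge; apply/negP => Mj; apply: no; exists j.
have eqv j i : v i 0 j ^+ m j = v i0 0 j ^+ m j.
  by case: (posnP (m j)) => [->|/lowdeg /hv -> //]; rewrite !expr0.
rewrite (const (\prod_j v i0 0 j ^+ m j)); last by move=> i; apply: eq_bigr.
apply: eq_bigr => j _; rewrite cE.
case: (posnP (m j)) => [->|/lowdeg /hv h]; first by rewrite !expr0.
by rewrite (const (v i0 0 j)).
Qed.

End Averaging.


(** * Lifting the group action *)

Section GroupAction.
Variables (R : realType) (gT : finGroupType) (X : gvariety R gT).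
Implicit Types (x : X) (g h : gT).

Lemma gactM x g h : gact X x (g * h)%g = gact X (gact X x g) h.
Proof. by case: (gact X) => to [_ h2] /=; apply: h2; rewrite inE. Qed.

Lemma gact1 x : gact X x 1%g = x.
Proof.
have inj : injective (fun x => gact X x 1%g) by case: (gact X) => to [h1 _] /=; apply: h1.
by apply: inj; rewrite /= -gactM mulg1.
Qed.

Lemma gactKV g x : gact X (gact X x g^-1%g) g = x.
Proof. by rewrite -gactM mulVg gact1. Qed.

Lemma act_surj g (y : X) : exists x, gact X x g = y.
Proof. by exists (gact X y g^-1%g); apply: gactKV. Qed.

End GroupAction.

Section GroupLift.
Variables (R : realType) (gT : finGroupType) (X : gvariety R gT) (n : nat).
Local Notation K := (R[i]).
Variables (e : 'rV[K]_n -> X) (a : 'rV[K]_n * X -> X) (V : set X) (e' : X -> 'rV[K]_n).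
Hypothesis TS : toric_structure e a V e'.
Local Notation center := (center e).
Variables (S : seq 'M[int]_n) (N : nat) (U : 'M[int]_(N, n)).
Hypothesis FS : fan_structure e S U.
Local Notation lifts := (lifts e U).
Implicit Types (Phi Psi : 'I_N -> {mpoly K[N]}) (w : 'rV[K]_N) (g : gT).

Definition comp_poly Phi Psi j := mmap (@mpolyC N K) Psi (Phi j).

Lemma ev_comp Phi Psi w : ev (comp_poly Phi Psi) w = ev Phi (ev Psi w).
Proof.
apply/rowP => j; rewrite !mxE meval_mmap; apply: meval_eq => k; by rewrite mxE.
Qed.

Lemma center_H h w x : tor h -> mexp U h = const_mx 1 -> center U w x ->
  center U (map2_mx *%R h w) x.
Proof. by move=> th hU /(center_scale TS th); rewrite hU (ts_a1 TS). Qed.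

(** Multiply each lift by the element of H that makes it fix w0, a point over the fixed point. H
    acts freely there, so a lift fixing w0 is unique, which forces compatibility with
    composition. *)
Lemma equivariant_lift : has_fixed_point X -> exists Phi : gT -> 'I_N -> {mpoly K[N]},
  [/\ forall g, lifts (Phi g) (fun x => gact X x g),
      forall g h w, ev (Phi (g * h)%g) w = ev (Phi h) (ev (Phi g) w) &
      forall w, ev (Phi 1%g) w = w].
Proof.
move=> [x0 fx0]; have [w0 c0] := center_surj FS x0.
have /choice [Phi hPhi] g : exists Phi, lifts Phi (fun x => gact X x g) /\ ev Phi w0 = w0.
  have [Phi hP] := lift_exists TS FS (gact_morphism X g) (@act_surj _ _ X g).
  have c1 := hP _ _ c0; rewrite fx0 in c1.
  have [h [th hU hw]] := center_fibre FS c1 c0.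
  have evh w : ev (fun j => h 0 j *: Phi j) w = map2_mx *%R h (ev Phi w).
    by apply/rowP => j; rewrite !mxE mevalZ.
  exists (fun j => h 0 j *: Phi j); rewrite evh -hw; split => // w x cw.
  by rewrite evh; apply: center_H => //; apply: hP.
have uniq g Phi1 Phi2 : lifts Phi1 (fun x => gact X x g) -> ev Phi1 w0 = w0 ->
    lifts Phi2 (fun x => gact X x g) -> ev Phi2 w0 = w0 -> forall w, ev Phi1 w = ev Phi2 w.
  move=> h1 e1 h2 e2 w.
  have [h [th hU hw]] := lift_unique TS FS (gact_morphism X g) (@act_surj _ _ X g) h1 h2.
  have h1' : h = const_mx 1.
    by apply: (center_free FS c0 hU th); have := hw w0; rewrite e1 e2.
  by rewrite hw h1'; apply/rowP => j; rewrite !mxE mul1r.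
exists Phi; split.
- by move=> g; case: (hPhi g).
- move=> g h w; rewrite -ev_comp; have [h1 e1] := hPhi g; have [h2 e2] := hPhi h.
  have [h3 e3] := hPhi (g * h)%g; apply: (uniq (g * h)%g) => //; last by rewrite ev_comp e1.
  by move=> u x cu; rewrite ev_comp gactM; apply: h2; apply: h1.
- move=> w; have [h1 e1] := hPhi 1%g; have evX u : ev (fun j => 'X_j) u = u.
    by apply/rowP => j; rewrite mxE mevalXU.
  rewrite -[RHS]evX; apply: (uniq 1%g) => //.
  by move=> u x cu; rewrite evX gact1.
Qed.

Variable Phi : gT -> 'I_N -> {mpoly K[N]}.
Hypothesis Phi_lifts : forall g, lifts (Phi g) (fun x => gact X x g).
Hypothesis PhiM : forall g h w, ev (Phi (g * h)%g) w = ev (Phi h) (ev (Phi g) w).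
Hypothesis Phi1 : forall w, ev (Phi 1%g) w = w.

(** By completeness, minus the sum of the rays is a non-negative combination b of rays; adding the
    sum gives a relation with coefficients b_j + 1 > 0. *)
Lemma ray_relation : exists2 d : 'I_N -> nat, forall j, (0 < d j)%N &
  forall t : K, t != 0 -> mexp U (dscale d t) = const_mx 1.
Proof.
have [s sS [b [b0 _ bU]]] := cone_exists FS (- ((const_mx 1 : 'rV[int]_N) *m U)).
exists (fun j => (absz (b 0 j)).+1) => // t t0; apply/rowP => l; rewrite mexpE mxE.
transitivity (\prod_j t ^ ((b 0 j + 1) * U j l)).
  apply: eq_bigr => j _; rewrite mxE exprnP exprz_exp; congr (t ^ (_ * _)).
  by rewrite -addn1 PoszD gez0_abs.
rewrite -exprz_sum // (_ : \sum_j _ = (b *m U + const_mx 1 *m U) 0 l).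
  by rewrite bU addNr mxE expr0z.
by rewrite !mxE -big_split; apply: eq_bigr => j _; rewrite mxE mulrDl.
Qed.

Lemma PhiK g w : ev (Phi g) (ev (Phi g^-1%g) w) = w.
Proof. by rewrite -PhiM mulVg Phi1. Qed.

Lemma Phi_neq0 g j : Phi g j != 0.
Proof. exact: (lifts_neq0 TS FS j (gact_morphism X g) (@act_surj _ _ X g) (Phi_lifts g)). Qed.

(** Scaling by d stays in the fibres, so the composite of Phi_g with it is another lift of g; by
    [lift_unique] each component of Phi_g is homogeneous, of weight D g j. The map Phi_h carries the
    scaling by D g to the scaling by D (g h), hence preserves the sum of the D g over G. This sum is
    positive since Phi_1 is the identity. *)
Lemma invariant_grading : exists2 d : 'I_N -> nat, forall j, (0 < d j)%N &
  forall g j, qhom d (d j) (Phi g j).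
Proof.
have [d d0 dU] := ray_relation; have two : (2 : K) != 0 by rewrite pnatr_eq0.
have /choice [D hD] g : exists D : 'I_N -> nat, forall j, qhom d (D j) (Phi g j).
  have t2 := dscale_tor d two.
  pose Psi j := rescale (dscale d 2) (Phi g j).
  have evP w : ev Psi w = ev (Phi g) (map2_mx *%R (dscale d 2) w).
    by apply/rowP => j; rewrite !mxE meval_rescale.
  have lP : lifts Psi (fun x => gact X x g).
    by move=> w x cw; rewrite evP; apply: Phi_lifts; apply: center_H => //; apply: dU.
  have [h [_ _ hw]] := lift_unique TS FS (gact_morphism X g) (@act_surj _ _ X g) (Phi_lifts g) lP.
  have /choice [D hD] j : exists M, qhom d M (Phi g j).
    have [|M [hM _]] := @qhom_dscale _ _ d (Phi g j) (h 0 j); last by exists M.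
    move=> w; have := congr1 (fun v : 'rV_N => v 0 j) (hw w); rewrite evP.
    by rewrite [RHS]mxE [LHS]mxE [ev _ _ _ _]mxE.
  by exists D.
have scale g (t : K) w : ev (Phi g) (map2_mx *%R (dscale d t) w) =
    map2_mx *%R (dscale (D g) t) (ev (Phi g) w).
  by apply/rowP => j; rewrite [LHS]mxE (qhom_meval _ _ (hD g j)) !mxE.
have scale' g h (t : K) v : t != 0 -> ev (Phi h) (map2_mx *%R (dscale (D g) t) v) =
    map2_mx *%R (dscale (D (g * h)%g) t) (ev (Phi h) v).
  by move=> t0; rewrite -{1}(PhiK g v) -scale -PhiM scale PhiM PhiK.
pose E j := (\sum_g D g j)%N.
exists E => [j|h j].
  rewrite /E (bigD1 1%g) //= addn_gt0; apply/orP; left; rewrite lt0n; apply/eqP => D0.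
  have c0 m : m \in msupp (Phi 1%g j) -> m = 0%MM.
    move=> /(hD 1%g j); rewrite D0 => /eqP; rewrite sum_nat_eq0 => /forallP h.
    apply/mnmP => i; have /implyP/(_ isT) := h i.
    by rewrite muln_eq0 mnm0E => /orP[/eqP //|]; rewrite eqn0Ngt d0.
  have := Phi_neq0 1%g j.
  have const w : w 0 j = (Phi 1%g j)@_0.
    rewrite -{1}(Phi1 w) mxE mevalE; case es : (msupp (Phi 1%g j)) => [|m0 s].
      have /eqP := es; rewrite msupp_eq0 => /eqP ->; by rewrite big_nil mcoeff0.
    have um := msupp_uniq (Phi 1%g j); rewrite es in um *.
    have c0' m : m \in m0 :: s -> m = 0%MM by rewrite -es; apply: c0.
    case: s um c0' es => [|m1 s] um c0' es.
      rewrite big_seq1 (c0' m0) ?mem_head // big1 ?mulr1 // => i _.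
      by rewrite mnm0E expr0.
    have := c0' m1; rewrite inE mem_head orbT => /(_ isT) E1.
    by move: um; rewrite (c0' m0) ?mem_head // E1 /= inE eqxx.
  have := const (const_mx 1); rewrite -(const 0) !mxE => /eqP; by rewrite oner_eq0.
have sumscale (s : seq gT) (t : K) v : t != 0 ->
    ev (Phi h) (map2_mx *%R (dscale (fun j => \sum_(g <- s) D g j)%N t) v) =
    map2_mx *%R (dscale (fun j => \sum_(g <- s) D (g * h)%g j)%N t) (ev (Phi h) v).
  move=> t0; elim: s v => [|g s IH] v.
    have one f : map2_mx *%R (dscale (fun j => \sum_(g <- [::]) f g j)%N t) =1 (id : 'rV[K]_N -> 'rV[K]_N).
      by move=> u; apply/rowP => i; rewrite !mxE big_nil expr0 mul1r.
    by rewrite !one.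
  have cons (f : gT -> 'I_N -> nat) u : map2_mx *%R (dscale (fun j => \sum_(g <- g :: s) f g j)%N t) u =
      map2_mx *%R (dscale (f g) t) (map2_mx *%R (dscale (fun j => \sum_(g <- s) f g j)%N t) u).
    by apply/rowP => i; rewrite !mxE big_cons exprD mulrA.
  by rewrite !cons scale' // IH.
have [|M [hM]] := @qhom_dscale _ _ E (Phi h j) (2 ^+ E j).
  move=> w; have := congr1 (fun v : 'rV_N => v 0 j) (sumscale (index_enum gT) 2 w two).
  rewrite [LHS]mxE => ->; rewrite 2!mxE [ev _ _ _ _]mxE; congr (_ ^+ _ * _).
  by rewrite /E [RHS](reindex_inj (mulIg h)) /=.
move=> /(_ (Phi_neq0 h j)) /eqP; rewrite -!natrX eqr_nat eqn_exp2l // => /eqP ->.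
exact: hM.
Qed.

End GroupLift.


(** * Equivariant maps *)

Lemma interpolation (K : fieldType) (I : finType) E (c : I -> 'rV[K]_E) (v : I -> K) :
  injective c -> exists P : {mpoly K[E]}, forall i, P.@[c i 0] = v i.
Proof.
move=> c_inj.
have /choice [k hk] (gh : I * I) : exists k : option 'I_E, gh.1 != gh.2 ->
    exists2 l, k = Some l & c gh.1 0 l != c gh.2 0 l.
  case: (eqVneq gh.1 gh.2) => [_|gh12]; first by exists None.
  have /existsNP [l /eqP hl] : ~ forall l, c gh.1 0 l = c gh.2 0 l.
    by move=> h; case/eqP: gh12; apply: c_inj; apply/rowP.
  by exists (Some l) => _; exists l.
pose fac i j : {mpoly K[E]} := if k (i, j) is Some l then
  (c i 0 l - c j 0 l)^-1 *: ('X_l - (c j 0 l)%:MP) else 1.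
have fac1 i j : j != i -> (fac i j).@[c i 0] = 1.
  move=> ji; have [|l el hl] := hk (i, j); first by rewrite eq_sym.
  by rewrite /fac el mevalZ mevalB mevalXU mevalC mulVf // subr_eq0.
have fac0 i j : j != i -> (fac i j).@[c j 0] = 0.
  move=> ji; have [|l el hl] := hk (i, j); first by rewrite eq_sym.
  by rewrite /fac el mevalZ mevalB mevalXU mevalC subrr mulr0.
exists (\sum_i v i *: \prod_(j | j != i) fac i j) => i.
rewrite rmorph_sum (bigD1 i) //= [X in _ + X]big1 => [|j ji].
  rewrite addr0 mevalZ rmorph_prod big1 ?mulr1 // => j; exact: fac1.
have ij : i != j by rewrite eq_sym.
by rewrite mevalZ rmorph_prod (bigD1 i) //= (fac0 j i ij) mul0r mulr0.
Qed.

Lemma open_meet_all (R : realType) (X : variety R) (I : finType) (O : I -> set X) :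
  (forall i, zopen (O i)) -> (forall i, O i !=set0) -> exists x, forall i, O i x.
Proof.
move=> oO nO.
suff H (s : seq I) : zopen [set x | forall i, i \in s -> O i x] /\
    [set x | forall i, i \in s -> O i x] !=set0.
  by have [_ [x hx]] := H (enum I); exists x => i; apply: hx; rewrite mem_enum.
elim: s => [|i s [os ns]].
  rewrite (_ : [set x | _] = setT); last by apply/seteqP; split.
  by split; [exact: zopenT|have [[x _] _] := variety_irreducible X; exists x].
have -> : [set x | forall j, j \in i :: s -> O j x] = O i `&` [set x | forall j, j \in s -> O j x].
  apply/seteqP; split => [x h|x [h1 h2] j].
    by split => [|j js]; apply: h; rewrite inE ?eqxx // js orbT.
  by rewrite inE => /orP[/eqP -> //|]; apply: h2.
by split; [exact: zopenI|exact: open_meet].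
Qed.

(** * Morphisms to X through the torus *)

Section TorusValued.
Variables (R : realType) (X : variety R) (n : nat).
Local Notation K := (R[i]).
Variables (e : 'rV[K]_n -> X) (a : 'rV[K]_n * X -> X) (V : set X) (e' : X -> 'rV[K]_n).
Hypothesis TS : toric_structure e a V e'.
Variables (Y : variety R) (T : set Y) (z : Y -> 'rV[K]_n).
Hypothesis oT : zopen T.
Hypothesis z_reg : forall j, regular_on T (fun y => z y 0 j).
Hypothesis z_tor : forall y, T y -> tor (z y).

Let rP (P : {mpoly K[n]}) : regular_on T (fun y => P.@[z y 0]).
Proof. exact: (@reg_meval _ _ _ _ (fun k y => z y 0 k) P oT z_reg). Qed.

Lemma torus_valued_open (W : set X) : zopen W -> zopen (T `&` [set y | W (e (z y))]).
Proof.
move=> oW; apply: zopen_local => y [Ty Wy].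
have [Q [Qy hQ]] := e_open TS oW (z_tor Ty) Wy.
exists (T `&` [set y | Q.@[z y 0] != 0]); split; [exact: reg_nz_open (rP Q)|by []|].
by move=> y' [Ty' Qy']; split => //; case: (hQ _ Qy').
Qed.

Lemma torus_valued_regular (W : set X) f : regular_on W f ->
  regular_on (T `&` [set y | W (e (z y))]) (fun y => f (e (z y))).
Proof.
move=> rf; have oW := torus_valued_open rf.1; apply: reg_local => y [Ty Wy].
have [p [q [qy h]]] := e_rat TS rf (z_tor Ty) Wy.
have oQ := zopenI oW (reg_nz_open (rP q)).
exists ((T `&` [set y | W (e (z y))]) `&` (T `&` [set y | q.@[z y 0] != 0])); split => //.
apply: (@reg_eq _ _ _ (fun y => p.@[z y 0] / q.@[z y 0])) => [y' [[Ty' Wy'] [_ qy']]|].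
  by rewrite -(h _ (z_tor Ty') Wy') mulrC mulKf.
have sub (P : {mpoly K[n]}) := reg_sub oQ (fun y h => proj1 (proj1 h)) (rP P).
apply: regM (sub p) _; apply: regV (sub q) => y' [_ [_ ?]] //.
Qed.

End TorusValued.

Section FreeOrbit.
Variables (R : realType) (gT : finGroupType) (Y : gvariety R gT).
Local Notation K := (R[i]).

Lemma gact_open (W : set Y) (g : gT) : zopen W -> zopen [set y | W (gact Y y g)].
Proof.
move=> oW; have := (gact_morphism Y g).1 W oW.
by congr zopen; apply/seteqP; split => [y [_ h] //|y h]; split.
Qed.

Lemma gact_reg (W : set Y) f (g : gT) : regular_on W f ->
  regular_on [set y | W (gact Y y g)] (fun y => f (gact Y y g)).
Proof.
move=> rf; have := (gact_morphism Y g).2 W f rf; apply: reg_sub; first exact: gact_open rf.1.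
by move=> y h; split.
Qed.

Lemma gact_dense (W : set Y) (g : gT) : zopen W -> W !=set0 ->
  (forall y, W y -> gact Y y g = y) -> forall y, gact Y y g = y.
Proof.
move=> oW W0 hW y.
have [i [gi dy]] := good_chart y; have [j [gj dy']] := good_chart (gact Y y g).
have [B [Sp ->] hB] := variety_separated (i, j).
suff : [set xy : Y * Y | xy.1 = xy.2] (y, gact Y y g) by move=> /= <-.
apply/(proj2 (hB (y, gact Y y g) (conj dy dy'))) => P SP /=.
pose O : set Y := dom i `&` [set y | dom j (gact Y y g)].
have oO : zopen O := zopenI gi (gact_open g gj).
have rP : regular_on O (fun y => P.@[row_mx (chart i y) (chart j (gact Y y g)) 0]).
  apply: (@reg_meval _ _ _ _ (fun k y => row_mx (chart i y) (chart j (gact Y y g)) 0 k) P oO) => k.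
  case: (splitP k) => l el.
    have -> : k = lshift (edim j) l by apply/val_inj.
    apply: reg_eq (reg_sub oO (@subIsetl _ _ _) (reg_chart l)) => y' _.
    by rewrite row_mxEl.
  have -> : k = rshift (edim i) l by apply/val_inj.
  apply: reg_eq (reg_sub oO (@subIsetr _ _ _) (gact_reg g (reg_chart l))) => y' _.
  by rewrite row_mxEr.
apply: (reg_eq_dense rP (reg_const 0 oO) oW W0) => [y' [di dj] Wy'|]; last by split.
rewrite /= in dj; rewrite hW // in dj *.
exact: (proj1 (hB (y', y') (conj di dj)) erefl P SP).
Qed.

(** O is the intersection of the translates of a chart domain, hence invariant. By faithfulness and
    density, every g != 1 moves the chart coordinates on a non-empty open part of O; y0 is taken in
    all of these parts. *)
Lemma free_orbit : faithful_action Y -> exists (i : index Y) (O : set Y) (y0 : Y),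
  [/\ good i, zopen O, (forall y, O y -> dom i y), (forall y (g : gT), O y -> O (gact Y y g)) &
      O y0 /\ injective (fun g : gT => chart i (gact Y y0 g))].
Proof.
move=> Yf; have [[y _] _] := variety_irreducible Y.
have [i [gi dy]] := good_chart y.
pose O : set Y := [set y | forall g : gT, dom i (gact Y y g)].
have oO : zopen O by apply: zopen_all => g; apply: gact_open.
have O0 : O !=set0.
  have [|g|y' hy'] := @open_meet_all R Y gT (fun g => [set y | dom i (gact Y y g)]).
  - by move=> g; apply: gact_open.
  - by exists (gact Y y g^-1%g); rewrite /mkset gactKV.
  - by exists y'.
have Od y' : O y' -> dom i y' by move=> h; have := h 1%g; rewrite gact1.
have Oi y' (g : gT) : O y' -> O (gact Y y' g) by move=> h g'; rewrite -gactM.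
have /choice [D hD] (g : gT) : exists D : set Y, [/\ zopen D, D !=set0, D `<=` O &
    g != 1%g -> forall y, D y -> chart i (gact Y y g) <> chart i y].
  case: (eqVneq g 1%g) => [_|g1]; first by exists O; split => // y0.
  have /existsNP [y1 /not_implyP [Oy1 ne]] : ~ forall y, O y -> gact Y y g = y.
    by move=> h; case/eqP: g1; apply: Yf; apply: gact_dense h.
  have [_ cinj _ _] := variety_prevariety Y.
  have /existsNP [k /eqP hk] : ~ forall k, chart i (gact Y y1 g) 0 k = chart i y1 0 k.
    move=> h; apply: ne; apply: (cinj i); [exact: Oy1|exact: Od|exact/rowP].
  have r1 := reg_sub oO (fun y (h : O y) => h g) (gact_reg g (reg_chart k : regular_on (dom i : set Y) _)).
  have r2 := reg_sub oO Od (reg_chart k : regular_on (dom i : set Y) _).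
  have r := regD r1 (regM (reg_const (-1) oO) r2).
  exists (O `&` [set y | chart i (gact Y y g) 0 k + -1 * chart i y 0 k != 0]); split.
  - exact: reg_nz_open r.
  - by exists y1; split => //=; rewrite mulN1r subr_eq0.
  - by move=> y' [].
  - by move=> _ y' [_ /= h] e0; move: h; rewrite e0 mulN1r subrr eqxx.
have [||y0 hy0] := @open_meet_all R Y gT D; try by move=> g; case: (hD g).
have Oy0 : O y0 by have [_ _ DO _] := hD 1%g; apply: DO.
exists i, O, y0; split => //; split => // g h e0.
apply/eqP; rewrite eq_mulgV1; apply: contrapT => /negP ne.
have [_ cinj _ _] := variety_prevariety Y.
have E : gact Y y0 g = gact Y y0 h by apply: (cinj i) e0.
have [_ _ _ /(_ ne y0 (hy0 _))] := hD (g * h^-1)%g; apply.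
by rewrite gactM E -gactM mulgV gact1.
Qed.

End FreeOrbit.


(** * Making a map to K^N equivariant *)

Section Equivariant.
Variables (R : realType) (gT : finGroupType) (Y : gvariety R gT) (N : nat).
Local Notation K := (R[i]).
Variables (Phi : gT -> 'I_N -> {mpoly K[N]}) (d : 'I_N -> nat).
Hypothesis PhiM : forall g h w, ev (Phi (g * h)%g) w = ev (Phi h) (ev (Phi g) w).
Hypothesis d_gt0 : forall j, (0 < d j)%N.
Hypothesis Phi_qhom : forall g j, qhom d (d j) (Phi g j).
Implicit Types (F : Y -> 'rV[K]_N) (g h : gT).

Definition average F (y : Y) : 'rV[K]_N :=
  #|gT|%:R^-1 *: \sum_(g : gT) ev (Phi g) (F (gact Y y g^-1%g)).

Definition equivariant_below m F := forall j, (d j < m)%N -> forall y g,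
  F (gact Y y g) 0 j = ev (Phi g) (F y) 0 j.

(* The components of weight m of Phi g are affine in the coordinates of       *)
(* weight m once those of smaller weight are fixed, so they commute with the  *)
(* average.                                                                   *)
Lemma average_equivariant m F : equivariant_below m F -> equivariant_below m.+1 (average F).
Proof.
move=> Fm j jm y h.
have hv i : (d i < d j)%N -> forall g, ev (Phi g) (F (gact Y y g^-1%g)) 0 i =
    ev (Phi 1%g) (F (gact Y y 1^-1%g)) 0 i.
  move=> ij g; have im : (d i < m)%N by apply: leq_trans ij _.
  by rewrite -!Fm // !gactKV.
rewrite [RHS]mxE (meval_average (v := fun g => ev (Phi g) (F (gact Y y g^-1%g)))
  (d_gt0 j) d_gt0 (@Phi_qhom h j) hv).
rewrite mxE summxE (reindex_inj (mulIg h)) /=; congr (_ * _); apply: eq_bigr => g _.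
by rewrite PhiM [LHS]mxE -gactM invMg mulgA mulgV mul1g.
Qed.

(** F is already equivariant along the orbit, so all terms of the average coincide there. *)
Lemma average_orbit F y x : (forall g, F (gact Y y g) = ev (Phi g) x) ->
  forall g, average F (gact Y y g) = ev (Phi g) x.
Proof.
move=> hF g; rewrite /average; under eq_bigr => h _ do rewrite -gactM hF -PhiM mulgKV.
rewrite sumr_const -scalerMnr scalerMnl -mulr_natr mulVf ?scale1r //.
by rewrite pnatr_eq0 -lt0n; apply/card_gt0P; exists 1%g.
Qed.

Lemma average_regular (O : set Y) F : zopen O -> (forall y g, O y -> O (gact Y y g)) ->
  (forall j, regular_on O (fun y => F y 0 j)) -> forall j, regular_on O (fun y => average F y 0 j).
Proof.
move=> oO Oi rF j.
have rg g : regular_on O (fun y => ev (Phi g) (F (gact Y y g^-1%g)) 0 j).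
  have rk k : regular_on O (fun y => F (gact Y y g^-1%g) 0 k).
    by apply: reg_sub oO _ (gact_reg g^-1%g (rF k)) => y; apply: Oi.
  apply: reg_eq (@reg_meval _ _ _ _ (fun k y => F (gact Y y g^-1%g) 0 k) (Phi g j) oO rk).
  by move=> y _; rewrite mxE.
have rs (s : seq gT) : regular_on O (fun y => \sum_(g <- s) ev (Phi g) (F (gact Y y g^-1%g)) 0 j).
  elim: s => [|g s IH].
    by apply: reg_eq (reg_const 0 oO) => y _; rewrite big_nil.
  by apply: reg_eq (regD (rg g) IH) => y _; rewrite big_cons.
apply: reg_eq (regM (reg_const (#|gT|%:R^-1) oO) (rs (index_enum gT))) => y _.
by rewrite mxE summxE.
Qed.

Lemma equivariant_extension (O : set Y) (i : index Y) y0 x : good i -> zopen O ->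
  (forall y, O y -> dom i y) -> (forall y g, O y -> O (gact Y y g)) ->
  injective (fun g : gT => chart i (gact Y y0 g)) ->
  exists F, [/\ forall j, regular_on O (fun y => F y 0 j),
    forall g, F (gact Y y0 g) = ev (Phi g) x &
    forall y g, F (gact Y y g) = ev (Phi g) (F y)].
Proof.
move=> gi oO Od Oi cinj.
have /choice [P hP] j := interpolation (fun g => ev (Phi g) x 0 j) cinj.
pose F0 y : 'rV[K]_N := \row_j (P j).@[chart i y 0].
(* Each average settles one more weight, and M exceeds all the weights. *)
pose M := (\sum_j d j).+1.
have H m : [/\ forall j, regular_on O (fun y => iter m average F0 y 0 j),
    forall g, iter m average F0 (gact Y y0 g) = ev (Phi g) x &
    equivariant_below m (iter m average F0)].
  elim: m => [|m [h1 h2 h3]]; split => //=.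
  - move=> j; have rc k := reg_sub oO Od (reg_chart k : regular_on (dom i : set Y) _).
    apply: reg_eq (@reg_meval _ _ _ _ (fun k y => chart i y 0 k) (P j) oO rc) => y _.
    by rewrite mxE.
  - by move=> g; apply/rowP => j; rewrite mxE hP.
  - exact: average_regular.
  - exact: average_orbit.
  - exact: average_equivariant.
have [h1 h2 h3] := H M; exists (iter M average F0); split => // y g.
apply/rowP => j; apply: h3; rewrite ltnS (bigD1 j) //=; exact: leq_addr.
Qed.

End Equivariant.

Theorem corollary3p5 (R : realType) (gT : finGroupType) (X : gvariety R gT)
  (X_faithful : faithful_action X) (X_toric : toric X)
  (X_complete : complete_variety X) (X_nonsingular : nonsingular X)
  (X_fixed : has_fixed_point X) :
  versal X.
Proof.
split=> // Y Y_faithful W oW W0 W_inv.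
have [n [e [a [[V oV [e' [eM e'M eK e'K]]] aM a1 aA aE]]]] := X_toric.
have TS : toric_structure e a V e'.
  by split.
have [S [N [U FS]]] := fan_structure_exists TS X_complete X_nonsingular.
have [Phi [Phi_lifts PhiM Phi1]] := equivariant_lift TS FS X_fixed.
have [d d_gt0 Phi_qhom] := invariant_grading TS FS Phi_lifts PhiM Phi1.
have [z [tz Wz]] := meet_V TS oW W0.
have [x [tx ex]] := torus_point FS tz; rewrite -ex in Wz.
have [i [O [y0 [gi oO Od Oi [Oy0 cinj]]]]] := free_orbit Y_faithful.
have [F [rF Fy0 Fg]] := equivariant_extension PhiM d_gt0 Phi_qhom x gi oO Od Oi cinj.
have rprod : regular_on O (fun y => (\prod_j 'X_j : {mpoly R[i][N]}).@[F y 0]).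
  exact: (@reg_meval _ _ _ _ (fun k y => F y 0 k) _ oO rF).
(* Where F has non-zero coordinates, e(F^U) is given by the embedding of the torus. *)
pose T : set Y := O `&` [set y | tor (F y)].
have TE : T = O `&` [set y | (\prod_j 'X_j : {mpoly R[i][N]}).@[F y 0] != 0].
  apply/seteqP; split => y [Oy /= h]; split => //=.
    by rewrite rmorph_prod; apply/prodf_neq0 => j _; rewrite /= mevalXU.
  by move=> j; move: h; rewrite rmorph_prod => /prodf_neq0 /(_ j isT); rewrite /= mevalXU.
have oT : zopen T by rewrite TE; apply: reg_nz_open rprod.
have TO : T `<=` O by move=> y [].
have z_reg j : regular_on T (fun y => mexp U (F y) 0 j).
  apply: reg_mexp => // [k|y [_ ty]]; [exact: reg_sub oT TO (rF k)|exact: ty].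
have z_tor y : T y -> tor (mexp U (F y)) by move=> [_ h]; apply: mexp_tor.
pose V' := T `&` [set y | W (e (mexp U (F y)))].
have oV' : zopen V' := torus_valued_open TS oT z_reg z_tor oW.
exists V', (fun y => e (mexp U (F y))); split => //.
(* F takes at y0 the value x, which was chosen over the given open set. *)
- exists y0; have Fx : F y0 = x by rewrite -[y0 in LHS]gact1 Fy0 Phi1.
  by split; rewrite /= ?Fx //; split => //=; rewrite Fx.
- split=> [W' oW'|W' f rf].
    have := zopenI oV' (torus_valued_open TS oT z_reg z_tor oW').
    by congr zopen; apply/seteqP; split => y [h1 h2]; split => //; [case: h2|split => //; case: h1].
  have := torus_valued_regular TS oT z_reg z_tor rf.
  apply: reg_sub; last by move=> y [[h1 _] h2]; split.
  have := zopenI oV' (torus_valued_open TS oT z_reg z_tor rf.1).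
  by congr zopen; apply/seteqP; split => y [h1 h2]; split => //; [case: h2|split => //; case: h1].
- by move=> y [].
- move=> g y [[_ ty] _] [[_ tyg] _].
  (* F(y g) = Phi_g(F(y)) lies over the image of e(F(y)^U) under g, and a point of K^N lies over
     only one point of X. *)
  have c1 := Phi_lifts g _ _ (center_eA TS U ty); rewrite -Fg in c1.
  exact: center_uniq (center_eA TS U tyg) c1.
Qed.
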